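(* Let $L$ be a free Lie algebra with basis $X$ over a field $k$, and let $I$ be any non-zero proper ideal of $L$. Then $I'=[I,I]$ is not finitely generated as an ideal of $L$. In fact, for every integer $n>1$, the ''Schur multiplier'' $H_2(L/I^n,k)$ of $L/I^n$ is not finitely generated (as a $k$-module, i.e. it is an infinite-dimensional $k$-vector space), and hence the Lie algebra $L/I^n$ is not finitely presented.
   Context: $L$ is the free Lie algebra over $k$ on the set $X$; no restriction is placed on the characteristic of $k$. ''Proper ideal'' means $I\neq L$. The powers $I^n$ denote the terms of the lower central series of $I$: $I^1=I$ and $I^n=[I^{n-1},I]$ for $n>1$, where $[A,B]$ is the $k$-span of all brackets $[a,b]$ with $a\in A$, $b\in B$; in particular $I^2=I'=[I,I]$. Each $I^n$ is an ideal of $L$. For a Lie algebra $\mathcal{G}$ over $k$, $H_2(\mathcal{G},k)$ is the second Lie algebra homology of $\mathcal{G}$ with coefficients in the trivial module $k$, i.e. $\mathrm{Tor}_2^{U(\mathcal{G})}(k,k)$ with $U(\mathcal{G})$ the universal enveloping algebra. A Lie algebra over $k$ is finitely presented if it is isomorphic to $F/R$ with $F$ a free Lie algebra over $k$ on a finite set and $R$ an ideal of $F$ that is finitely generated as an ideal. *)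

(* Defs.v *)
(* Subsets are boolean predicates; the classical `[< _ >] of boolp turns any
   proposition into one, so no decidability is being assumed. *)
From HB Require Import structures.
From mathcomp Require Import all_boot all_algebra.
From mathcomp Require Import finmap monalg boolp.

Set Implicit Arguments.
Unset Strict Implicit.
Unset Printing Implicit Defensive.

Import GRing.Theory.
Local Open Scope ring_scope.
Local Open Scope quotient_scope.

Record submodule (R : pzRingType) (V : lmodType R) := SubModule {
  submodule_pred :> {pred V};
  submodule_closed : submod_closed submodule_pred
}.

HB.instance Definition _ (R : pzRingType) (V : lmodType R) (W : submodule V) :=
  GRing.isSubmodClosed.Build R V (submodule_pred W) (submodule_closed W).

Section Span.
Variables (R : pzRingType) (V : lmodType R) (S : V -> Prop).

Definition span_pred : {pred V} :=
  fun x => `[< forall W : submodule V, (forall y, S y -> y \in W) -> x \in W >].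

Lemma span_predP x :
  reflect (forall W : submodule V, (forall y, S y -> y \in W) -> x \in W)
          (x \in span_pred).
Proof. exact: asboolP. Qed.

Lemma span_submod_closed : submod_closed span_pred.
Proof.
split=> [|a u v /span_predP Su /span_predP Sv]; apply/span_predP => W WS.
  exact: rpred0.
by apply: rpredD; [apply: rpredZ; apply: Su | apply: Sv].
Qed.

Definition span : submodule V := SubModule span_submod_closed.

Lemma mem_span x : S x -> x \in span.
Proof. by move=> Sx; apply/span_predP => W; apply. Qed.

Lemma span_min (W : submodule V) x :
  (forall y, S y -> y \in W) -> x \in span -> x \in W.
Proof. by move=> SW /span_predP; apply. Qed.

End Span.

Section QuotientModule.
Variables (R : pzRingType) (V : lmodType R) (W : submodule V).

Definition quotm : Type := Quotient.quot (submodule_pred W).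
HB.instance Definition _ := GRing.Zmodule.on quotm.
HB.instance Definition _ :=
  EqQuotient.copy quotm (Quotient.quot (submodule_pred W)).

Definition qmod (x : V) : quotm := \pi_quotm x.

Lemma qmod_repr (x : quotm) : qmod (repr x) = x.
Proof. exact: reprK. Qed.

Lemma qmod_eq (x y : V) : (qmod x == qmod y) = (x - y \in W).
Proof. apply/esym/(Quotient.idealrBE (submodule_pred W)). Qed.

Lemma qmodB : {morph qmod : x y / x - y}.
Proof. exact: (raddfB (\pi_(Quotient.quot (submodule_pred W)))). Qed.

Lemma qmodD : {morph qmod : x y / x + y}.
Proof. exact: (raddfD (\pi_(Quotient.quot (submodule_pred W)))). Qed.

Definition qscale (a : R) (x : quotm) : quotm := qmod (a *: repr x).

Lemma qmodZ a x : qscale a (qmod x) = qmod (a *: x).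
Proof.
apply/eqP; rewrite /qscale qmod_eq -scalerBr rpredZ // -qmod_eq.
by rewrite qmod_repr.
Qed.

Lemma qscaleA a b x : qscale a (qscale b x) = qscale (a * b) x.
Proof. by rewrite -[x]qmod_repr !qmodZ scalerA. Qed.

Lemma qscale1 : left_id 1 qscale.
Proof. by move=> x; rewrite -[x]qmod_repr qmodZ scale1r. Qed.

Lemma qscaleDr : right_distributive qscale +%R.
Proof.
move=> a x y; rewrite -[x]qmod_repr -[y]qmod_repr -qmodD !qmodZ.
by rewrite scalerDr qmodD.
Qed.

Lemma qscaleDl x : {morph qscale^~ x : a b / a + b}.
Proof. by move=> a b; rewrite -[x]qmod_repr !qmodZ scalerDl qmodD. Qed.

HB.instance Definition _ := GRing.Zmodule_isLmodule.Build R quotm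
  qscaleA qscale1 qscaleDr qscaleDl.

Lemma qmod_is_linear : linear qmod.
Proof. by move=> a x y; rewrite qmodD -qmodZ. Qed.

HB.instance Definition _ :=
  GRing.isLinear.Build R V quotm *:%R qmod qmod_is_linear.

End QuotientModule.

Section Kernel.
Variables (R : pzRingType) (V W : lmodType R) (f : {linear V -> W}).

Record kernel : predArgType := Kernel { ker_val : V; _ : f ker_val == 0 }.

HB.instance Definition _ := [isSub for ker_val].
HB.instance Definition _ := [Choice of kernel by <:].

Definition ker_pred : {pred V} := fun x => f x == 0.

Lemma ker_submod_closed : submod_closed ker_pred.
Proof.
split=> [|a u v]; rewrite !unfold_in /ker_pred ?linear0 //.
by move=> /eqP fu /eqP fv; rewrite linearP fu fv scaler0 addr0.
Qed.

HB.instance Definition _ :=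
  GRing.isSubmodClosed.Build R V ker_pred ker_submod_closed.
HB.instance Definition _ := GRing.SubChoice_isSubLmodule.Build R V ker_pred
  kernel (submodClosedP ker_pred).

Lemma ker_val_is_linear : linear ker_val.
Proof. by move=> a u v; rewrite -[ker_val]/val linearP. Qed.

HB.instance Definition _ :=
  GRing.isLinear.Build R kernel V *:%R ker_val ker_val_is_linear.

End Kernel.

Definition fg_module (R : pzRingType) (V : lmodType R) : Prop :=
  exists (n : nat) (b : 'I_n -> V),
    forall v : V, exists c : 'I_n -> R, v = \sum_(i < n) c i *: b i.

HB.mixin Record Lmodule_isLieAlgebra (k : comNzRingType) L
    of GRing.Lmodule k L := {
  lie : L -> L -> L;
  lie_linearl : forall y, linear (lie^~ y);
  lie_linearr : forall x, linear (lie x);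
  liexx : forall x, lie x x = 0;
  lie_jacobi : forall x y z,
    lie x (lie y z) + lie y (lie z x) + lie z (lie x y) = 0
}.

#[short(type="lieAlgType")]
HB.structure Definition LieAlgebra (k : comNzRingType) :=
  {L of Lmodule_isLieAlgebra k L & GRing.Lmodule k L}.

Record lieIdeal (k : comNzRingType) (L : lieAlgType k) := LieIdeal {
  ideal_submodule :> submodule L;
  ideal_closed : forall x y : L, y \in ideal_submodule -> lie x y \in ideal_submodule
}.

Section LieTheory.
Variables (k : comNzRingType) (L : lieAlgType k).
Implicit Types (x y z : L) (I J : lieIdeal L).

HB.instance Definition _ x :=
  GRing.isLinear.Build k L L *:%R (lie x) (lie_linearr x).

Lemma lieDl x x' y : lie (x + x') y = lie x y + lie x' y.
Proof. by have /= := lie_linearl y 1 x x'; rewrite !scale1r. Qed.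
Lemma lieDr x y y' : lie x (y + y') = lie x y + lie x y'.
Proof. exact: linearD. Qed.
Lemma lieBl x x' y : lie (x - x') y = lie x y - lie x' y.
Proof.
by have /= := lie_linearl y (-1) x' x; rewrite !scaleN1r ![- _ + _]addrC.
Qed.
Lemma lieBr x y y' : lie x (y - y') = lie x y - lie x y'.
Proof. exact: linearB. Qed.

Lemma lieC x y : lie x y = - lie y x.
Proof.
apply/eqP; rewrite -addr_eq0; have := liexx (x + y).
by rewrite lieDl !lieDr !liexx add0r addr0 => /eqP.
Qed.

Lemma lieA x y z : lie x (lie y z) = lie (lie x y) z + lie y (lie x z).
Proof.
apply/eqP; rewrite -subr_eq0 -(lie_jacobi x y z) opprD addrA addrAC.
by rewrite -[X in _ + X](@lieC z) (@lieC z x) linearN.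
Qed.

Lemma mem_lier I x y : y \in I -> lie x y \in I.
Proof. exact: ideal_closed. Qed.

Lemma mem_liel I x y : x \in I -> lie x y \in I.
Proof. by move=> Ix; rewrite lieC rpredN mem_lier. Qed.

Definition lie_span (A B : {pred L}) : submodule L :=
  span (fun z => exists a b, [/\ a \in A, b \in B & z = lie a b]).

Lemma lie_span_closed I J x y : y \in lie_span I J -> lie x y \in lie_span I J.
Proof.
have WP : submod_closed (fun u => lie x u \in lie_span I J).
  split=> [|a u v xu xv].
    by rewrite -[_ \in _]/(lie x 0 \in lie_span I J) linear0 rpred0.
  rewrite -[_ \in _]/(lie x (a *: u + v) \in lie_span I J) linearP.
  by apply: rpredD => //; apply: rpredZ.
apply: (span_min (W := SubModule WP)) => _ [a [b [Ia Jb ->]]].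
rewrite -[_ \in _]/(lie x (lie a b) \in lie_span I J) lieA; apply: rpredD; apply: mem_span.
  by exists (lie x a), b; split=> //; apply: mem_lier.
by exists a, (lie x b); split=> //; apply: mem_lier.
Qed.

Definition lie_prod I J : lieIdeal L := LieIdeal (@lie_span_closed I J).

(* The value at n = 0 is a dummy one. *)
Definition ideal_pow I (n : nat) : lieIdeal L :=
  iter n.-1 (fun J => lie_prod J I) I.

Definition ideal_generated_by (S : {pred L}) I : Prop :=
  {subset S <= I} /\
  forall J, {subset S <= J} -> {subset I <= J}.

Definition fg_ideal I : Prop := exists s : seq L, ideal_generated_by (mem s) I.

End LieTheory.

Section QuotientLie.
Variables (k : comNzRingType) (L : lieAlgType k) (I : lieIdeal L).

Definition quotl : Type := quotm I.
HB.instance Definition _ := GRing.Lmodule.copy quotl (quotm I).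

Definition qlie (x y : quotl) : quotl := qmod I (lie (repr x) (repr y)).

Lemma qmod_lie (x y : L) : qlie (qmod I x) (qmod I y) = qmod I (lie x y).
Proof.
apply/eqP; rewrite /qlie qmod_eq.
set x' := repr _; set y' := repr _.
have -> : lie x' y' - lie x y = lie (x' - x) y' + lie x (y' - y).
  by rewrite lieBl lieBr addrA subrK.
by apply: rpredD; [apply: mem_liel | apply: mem_lier]; rewrite -qmod_eq qmod_repr.
Qed.

Lemma qlie_linearl y : linear (qlie^~ y).
Proof.
move=> a u v; rewrite -[y]qmod_repr -[u]qmod_repr -[v]qmod_repr.
by rewrite -[_ *: _ + _]linearP !qmod_lie lie_linearl linearP.
Qed.

Lemma qlie_linearr x : linear (qlie x).
Proof.
move=> a u v; rewrite -[x]qmod_repr -[u]qmod_repr -[v]qmod_repr.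
by rewrite -[_ *: _ + _]linearP !qmod_lie lie_linearr linearP.
Qed.

Lemma qliexx x : qlie x x = 0.
Proof. by rewrite -[x]qmod_repr qmod_lie liexx linear0. Qed.

Lemma qlie_jacobi x y z :
  qlie x (qlie y z) + qlie y (qlie z x) + qlie z (qlie x y) = 0.
Proof.
rewrite -[x]qmod_repr -[y]qmod_repr -[z]qmod_repr !qmod_lie.
by rewrite -[RHS](linear0 (qmod I)) -(lie_jacobi (repr x) (repr y) (repr z)) !linearD.
Qed.

HB.instance Definition _ := Lmodule_isLieAlgebra.Build k quotl
  qlie_linearl qlie_linearr qliexx qlie_jacobi.

End QuotientLie.

Definition lie_hom (k : comNzRingType) (L M : lieAlgType k) (f : L -> M) : Prop :=
  linear f /\ {morph f : x y / lie x y}.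

Definition lie_isomorphic (k : comNzRingType) (L M : lieAlgType k) : Prop :=
  exists f : L -> M, lie_hom f /\ bijective f.

Definition free_lie_on (k : comNzRingType) (X : Type) (L : lieAlgType k)
    (i : X -> L) : Prop :=
  forall (M : lieAlgType k) (f : X -> M), exists g : L -> M,
    [/\ lie_hom g, forall x, g (i x) = f x
      & forall h : L -> M, lie_hom h -> (forall x, h (i x) = f x) -> h =1 g].

Definition finitely_presented (k : comNzRingType) (G : lieAlgType k) : Prop :=
  exists (n : nat) (F : lieAlgType k) (i : 'I_n -> F) (R : lieIdeal F),
    [/\ free_lie_on i, fg_ideal R & lie_isomorphic G (quotl R)].

Lemma malg_scalerAr (K : monomType) (R : comNzRingType) (a : R)
    (x y : {malg R[K]}) :
  a *: (x * y) = x * (a *: y).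
Proof.
apply/malgP => m; rewrite mcoeffZ (mcoeffMl x y).
rewrite (mcoeffMlw m (fsubset_refl (msupp x)) (msuppZ_le a y)).
rewrite mulr_sumr; apply: eq_bigr => u _; rewrite mulr_sumr.
by apply: eq_bigr => v _; rewrite mcoeffZ mulrnAr mulrCA.
Qed.

Section Envelope.
Variables (k : fieldType) (G : lieAlgType k).

(* T is the free associative algebra on the set underlying G: {fmonom G} is
   the monoid of words in the elements of G. *)
Local Notation T := {malg k[{fmonom G}]}.

Definition gen (x : G) : T := << fmu x >>.

Inductive env_rel : T -> Prop :=
| EnvLin a x y : env_rel (gen (a *: x + y) - (a *: gen x + gen y))
| EnvLie x y : env_rel (gen (lie x y) - (gen x * gen y - gen y * gen x)).

Definition two_sided (J : submodule T) : Prop :=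
  forall a u : T, u \in J -> (a * u \in J) /\ (u * a \in J).

Definition env_pred : {pred T} :=
  fun u => `[< forall J : submodule T,
                 two_sided J -> (forall r, env_rel r -> r \in J) -> u \in J >].

Lemma env_predP u :
  reflect (forall J : submodule T,
             two_sided J -> (forall r, env_rel r -> r \in J) -> u \in J)
          (u \in env_pred).
Proof. exact: asboolP. Qed.

Lemma env_submod_closed : submod_closed env_pred.
Proof.
split=> [|a u v /env_predP Ju /env_predP Jv]; apply/env_predP => J Jt Jr.
  exact: rpred0.
by apply: rpredD; [apply: rpredZ; apply: Ju | apply: Jv].
Qed.

Definition env_ideal : submodule T := SubModule env_submod_closed.

Lemma env_ideal_two_sided : two_sided env_ideal.
Proof.
move=> a u /env_predP Ju; split; apply/env_predP => J Jt Jr.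
  exact: (Jt a u (Ju J Jt Jr)).1.
exact: (Jt a u (Ju J Jt Jr)).2.
Qed.

Definition U : Type := quotm env_ideal.
HB.instance Definition _ := GRing.Lmodule.copy U (quotm env_ideal).

Definition upi (u : T) : U := qmod env_ideal u.

Lemma upi_repr (x : U) : upi (repr x) = x.
Proof. exact: qmod_repr. Qed.

Lemma upi_eq (u v : T) : (upi u == upi v) = (u - v \in env_ideal).
Proof. exact: qmod_eq. Qed.

Lemma upi_is_linear : linear upi.
Proof. exact: (qmod_is_linear env_ideal). Qed.

HB.instance Definition _ := GRing.isLinear.Build k T U *:%R upi upi_is_linear.

Lemma upi_scale (a : k) (u : T) : a *: upi u = upi (a *: u).
Proof. by rewrite linearZ. Qed.

Definition uone : U := upi 1.
Definition umul (x y : U) : U := upi (repr x * repr y).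

Lemma upi_umul (u v : T) : umul (upi u) (upi v) = upi (u * v).
Proof.
apply/eqP; rewrite /umul upi_eq.
set u' := repr _; set v' := repr _.
have -> : u' * v' - u * v = (u' - u) * v' + u * (v' - v).
  by rewrite mulrBl mulrBr addrA subrK.
apply: rpredD.
  by apply: (env_ideal_two_sided v' _).2; rewrite -upi_eq upi_repr.
by apply: (env_ideal_two_sided u _).1; rewrite -upi_eq upi_repr.
Qed.

Lemma coef1M (u v : T) : (u * v)@_mone = u@_mone * v@_mone.
Proof. exact: (rmorphM (@mcoeff {fmonom G} k mone)). Qed.

Lemma env_rel_coef1 (u : T) : env_rel u -> u@_mone = 0.
Proof.
have gen1 x : (gen x)@_mone = 0 :> k.
  by rewrite mcoeffU1; case: eqP => // /(congr1 (@fdeg G)); rewrite fdegU fdeg1.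
case=> [a x y|x y].
  by rewrite mcoeffB mcoeffD mcoeffZ !gen1 mulr0 addr0 subr0.
have comm0 (v w : T) : v@_mone = 0 -> w@_mone = 0 -> (v * w - w * v)@_mone = 0.
  by move=> v0 w0; rewrite mcoeffB !coef1M v0 w0 mulr0 subr0.
by rewrite mcoeffB gen1 sub0r comm0 ?gen1 ?oppr0.
Qed.

Lemma coef1_submod_closed : submod_closed (fun u : T => u@_mone == 0).
Proof.
split=> [|a u v /eqP u0 /eqP v0]; apply/eqP; first exact: mcoeff0.
by rewrite mcoeffD mcoeffZ u0 v0 mulr0 addr0.
Qed.

Lemma env_ideal_coef1 (u : T) : u \in env_ideal -> u@_mone = 0.
Proof.
move=> /env_predP /(_ (SubModule coef1_submod_closed)) u0; apply/eqP/u0.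
  move=> a v /eqP v0; split; apply/eqP; rewrite coef1M v0.
    by rewrite mulr0.
  by rewrite mul0r.
by move=> r /env_rel_coef1 r0; apply/eqP.
Qed.

Lemma umulA : associative umul.
Proof.
move=> x y z; rewrite -[x]upi_repr -[y]upi_repr -[z]upi_repr !upi_umul.
by rewrite mulrA.
Qed.

Lemma umul1r : left_id uone umul.
Proof. by move=> x; rewrite -[x]upi_repr upi_umul mul1r. Qed.

Lemma umulr1 : right_id uone umul.
Proof. by move=> x; rewrite -[x]upi_repr upi_umul mulr1. Qed.

Lemma umulDl : left_distributive umul +%R.
Proof.
move=> x y z; rewrite -[x]upi_repr -[y]upi_repr -[z]upi_repr.
by rewrite -linearD !upi_umul mulrDl linearD.
Qed.

Lemma umulDr : right_distributive umul +%R.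
Proof.
move=> x y z; rewrite -[x]upi_repr -[y]upi_repr -[z]upi_repr.
by rewrite -linearD !upi_umul mulrDr linearD.
Qed.

Lemma uone_neq0 : uone != 0.
Proof.
apply/negP; rewrite -[0](linear0 upi) upi_eq subr0 => /env_ideal_coef1/eqP.
by rewrite mcoeff1 eqxx oner_eq0.
Qed.

HB.instance Definition _ := GRing.Zmodule_isNzRing.Build U
  umulA umul1r umulr1 umulDl umulDr uone_neq0.

Lemma upi_is_monoid_morphism : monoid_morphism upi.
Proof. by split=> [|x y]; [|rewrite -upi_umul]. Qed.

HB.instance Definition _ :=
  GRing.isMonoidMorphism.Build T U upi upi_is_monoid_morphism.

Lemma uscalerAl (a : k) (x y : U) : a *: (x * y) = (a *: x) * y.
Proof.
rewrite -[x]upi_repr -[y]upi_repr -[_ * _]/(umul _ _) -[_ * _]/(umul _ _).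
by rewrite upi_umul !upi_scale upi_umul scalerAl.
Qed.

HB.instance Definition _ := GRing.Lmodule_isLalgebra.Build k U uscalerAl.

Lemma uscalerAr (a : k) (x y : U) : a *: (x * y) = x * (a *: y).
Proof.
rewrite -[x]upi_repr -[y]upi_repr -[_ * _]/(umul _ _) -[_ * _]/(umul _ _).
by rewrite upi_umul !upi_scale upi_umul malg_scalerAr.
Qed.

HB.instance Definition _ := GRing.Lalgebra_isAlgebra.Build k U uscalerAr.

(* The augmentation U -> k: the algebra morphism killing the image of G. *)
Definition counit (u : U) : k := (repr u)@_mone.

Lemma counit_upi (u : T) : counit (upi u) = u@_mone.
Proof.
apply/eqP; rewrite -subr_eq0 -mcoeffB; apply/eqP/env_ideal_coef1.
by rewrite -upi_eq upi_repr.
Qed.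

Lemma counit_is_zmod_morphism : zmod_morphism counit.
Proof.
move=> x y; rewrite -[x]upi_repr -[y]upi_repr -linearB !counit_upi.
by rewrite mcoeffB.
Qed.

Lemma counit_is_monoid_morphism : monoid_morphism counit.
Proof.
split=> [|x y]; first by rewrite -[1]/(upi 1) counit_upi rmorph1.
rewrite -[x]upi_repr -[y]upi_repr -[_ * _]/(umul _ _) upi_umul !counit_upi.
exact: coef1M.
Qed.

HB.instance Definition _ :=
  GRing.isZmodMorphism.Build U k counit counit_is_zmod_morphism.
HB.instance Definition _ :=
  GRing.isMonoidMorphism.Build U k counit counit_is_monoid_morphism.

End Envelope.

(* k as a trivial left module over U G, and as a trivial right module *)
Definition trivl (k : fieldType) (G : lieAlgType k) : Type := k.
Definition trivr (k : fieldType) (G : lieAlgType k) : Type := k.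

Section TrivialModules.
Variables (k : fieldType) (G : lieAlgType k).
Local Notation U := (U G).
Local Notation trivl := (trivl G).
Local Notation trivr := (trivr G).

HB.instance Definition _ := GRing.Zmodule.copy trivl k.
HB.instance Definition _ := GRing.Zmodule.copy trivr k.

Definition trivl_scale (u : U) (c : trivl) : trivl := counit u * (c : k).

Lemma trivl_scaleA u v c : trivl_scale u (trivl_scale v c) = trivl_scale (u * v) c.
Proof. by rewrite /trivl_scale rmorphM /= mulrA. Qed.

Lemma trivl_scale1 : left_id 1 trivl_scale.
Proof. by move=> c; rewrite /trivl_scale rmorph1 mul1r. Qed.

Lemma trivl_scaleDr : right_distributive trivl_scale +%R.
Proof. by move=> u c d; rewrite /trivl_scale -mulrDr. Qed.

Lemma trivl_scaleDl c : {morph trivl_scale^~ c : u v / u + v}.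
Proof. by move=> u v; rewrite /trivl_scale rmorphD /= mulrDl. Qed.

HB.instance Definition _ := GRing.Zmodule_isLmodule.Build U trivl
  trivl_scaleA trivl_scale1 trivl_scaleDr trivl_scaleDl.

Definition trivr_scale (u : U^c) (c : trivr) : trivr := counit u * (c : k).

Lemma trivr_scaleA (u v : U^c) c :
  trivr_scale u (trivr_scale v c) = trivr_scale (u * v) c.
Proof.
by rewrite /trivr_scale -[counit (u * v)]/(counit ((v : U) * (u : U))) rmorphM
  /= mulrA (mulrC (counit v)).
Qed.

Lemma trivr_scale1 : left_id (1 : U^c) trivr_scale.
Proof. by move=> c; rewrite /trivr_scale rmorph1 mul1r. Qed.

Lemma trivr_scaleDr : right_distributive trivr_scale +%R.
Proof. by move=> u c d; rewrite /trivr_scale -mulrDr. Qed.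

Lemma trivr_scaleDl c : {morph trivr_scale^~ c : u v / u + v}.
Proof.
by move=> u v; rewrite /trivr_scale -[counit (u + v)]/(counit ((u : U) + (v : U)))
  rmorphD /= mulrDl.
Qed.

HB.instance Definition _ := GRing.Zmodule_isLmodule.Build U^c trivr
  trivr_scaleA trivr_scale1 trivr_scaleDr trivr_scaleDl.

End TrivialModules.

(* {malg A[K]} is the free A-module with basis K; malg_lift is the linear
   extension of a map from the basis. *)
Section FreeModule.
Variables (A : nzRingType) (K : choiceType) (V : lmodType A) (f : K -> V).

Definition malg_lift (g : {malg A[K]}) : V := \sum_(x <- msupp g) g@_x *: f x.

Lemma malg_liftEw (d : {fset K}) (g : {malg A[K]}) :
  (msupp g `<=` d)%fset -> malg_lift g = \sum_(x <- d) g@_x *: f x.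
Proof.
move=> le; rewrite /malg_lift (big_fset_incl _ le) //= => x xd.
by move=> /mcoeff_outdom ->; rewrite scale0r.
Qed.

Lemma malg_lift_is_linear : linear malg_lift.
Proof.
move=> a u v; set d := (msupp u `|` msupp v `|` msupp (a *: u + v))%fset.
rewrite !(@malg_liftEw d) /d.
- rewrite scaler_sumr -big_split /=; apply: eq_bigr => x _.
  by rewrite mcoeffD mcoeffZ scalerDl scalerA.
- by rewrite -fsetUA fsetUCA; apply: fsubsetUl.
- by rewrite -fsetUA; apply: fsubsetUl.
- exact: fsubsetUr.
Qed.

HB.instance Definition _ :=
  GRing.isLinear.Build A {malg A[K]} V *:%R malg_lift malg_lift_is_linear.

Lemma malg_liftU x : malg_lift << x >> = f x.
Proof. by rewrite (malg_liftEw msuppU_le) big_seq_fset1 mcoeffUU scale1r. Qed.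

End FreeModule.

Section Tensor.
Variables (k : fieldType) (A : algType k) (M : lmodType A^c).

(* M is a right A-module, m.a being (a : A^c) *: m, and k acts on M and N
   through A; the tensor product is taken as a k-space. *)
Inductive tens_rel (N : lmodType A) : {malg k[(M * N)%type]} -> Prop :=
| TensDl m m' n :
    tens_rel (<< (m + m', n) >> - (<< (m, n) >> + << (m', n) >>))
| TensDr m n n' :
    tens_rel (<< (m, n + n') >> - (<< (m, n) >> + << (m, n') >>))
| TensBal m (a : A) n :
    tens_rel (<< ((a : A^c) *: m, n) >> - << (m, a *: n) >>)
| TensZ (c : k) m n :
    tens_rel (<< (m, c%:A *: n) >> - c *: << (m, n) >>).

Definition tensor (N : lmodType A) : Type := quotm (span (@tens_rel N)).
HB.instance Definition _ N := GRing.Lmodule.copy (tensor N)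
  (quotm (span (@tens_rel N))).

Definition tens (N : lmodType A) (m : M) (n : N) : tensor N :=
  qmod (span (@tens_rel N)) << (m, n) >>.

Lemma tens_relE (N : lmodType A) u v :
  @tens_rel N (u - v) -> qmod (span (@tens_rel N)) u = qmod (span (@tens_rel N)) v.
Proof. by move=> ruv; apply/eqP; rewrite qmod_eq; apply: mem_span. Qed.

Section Map.
Variables (N N' : lmodType A) (f : {linear N -> N'}).

Definition tens_lift : {malg k[(M * N)%type]} -> tensor N' :=
  malg_lift (fun p => tens p.1 (f p.2)).
HB.instance Definition _ := GRing.Linear.on tens_lift.

Definition tens_map (t : tensor N) : tensor N' := tens_lift (repr t).

Lemma tens_map_qmod (u : {malg k[(M * N)%type]}) :
  tens_map (qmod (span (@tens_rel N)) u) = tens_lift u.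
Proof.
have WP : submod_closed (fun v => tens_lift v == 0).
  split=> [|a v w /eqP v0 /eqP w0]; apply/eqP; first exact: linear0.
  by rewrite linearP /= v0 w0 scaler0 addr0.
apply/eqP; rewrite -subr_eq0 -linearB.
suff relW v : tens_rel v -> v \in SubModule WP.
  by apply: (span_min relW); rewrite -qmod_eq qmod_repr.
have liftU m n : tens_lift << (m, n) >> = tens m (f n).
  by rewrite /tens_lift malg_liftU.
case=> [m m' n|m n n'|m a n|c m n]; rewrite -[_ \in _]/(_ == 0);
  rewrite linearB /= subr_eq0 ?linearD ?[tens_lift (c *: _)]linearZ /= !liftU;
  apply/eqP; rewrite /tens -?linearD -?[c *: qmod _ _]linearZ; apply: tens_relE.
- exact: TensDl.
- by rewrite linearD; apply: TensDr.
- by rewrite linearZ; apply: TensBal.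
- by rewrite linearZ; apply: TensZ.
Qed.

Lemma tens_map_is_linear : linear tens_map.
Proof.
move=> a s t; rewrite -[s]qmod_repr -[t]qmod_repr -[_ *: _ + _]linearP.
by rewrite !tens_map_qmod linearP.
Qed.

HB.instance Definition _ :=
  GRing.isLinear.Build k (tensor N) (tensor N') *:%R tens_map tens_map_is_linear.

Lemma tens_mapE m n : tens_map (tens m n) = tens m (f n).
Proof. by rewrite tens_map_qmod /tens_lift malg_liftU. Qed.

End Map.
End Tensor.

Section Homology.
Variables (R : pzRingType) (V2 V1 V0 : lmodType R).
Variables (d2 : {linear V2 -> V1}) (d1 : {linear V1 -> V0}).

Definition boundary_pred : {pred kernel d1} :=
  fun z => `[< exists w, ker_val z = d2 w >].

Lemma boundary_submod_closed : submod_closed boundary_pred.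
Proof.
split=> [|a u v /asboolP[x ux] /asboolP[y vy]]; apply/asboolP.
  by exists 0; rewrite !linear0.
by exists (a *: x + y); rewrite linearP -ux -vy linearP.
Qed.

(* ker d1 / (im d2 `&` ker d1), the homology at V1 when d1 \o d2 = 0 *)
Definition homology : lmodType R := quotm (SubModule boundary_submod_closed).

End Homology.

Section Tor.
Variables (k : fieldType) (A : algType k).

Section Resolution.
Variable N : lmodType A.

Definition free_cover (V : lmodType A) : {linear {malg A[V]} -> V} :=
  malg_lift (@id V).

(* The standard free resolution ... -> P_1 -> P_0 -> N -> 0, in which P_n is
   the free module on the set of elements of the n-th syzygy, i.e. of N for
   n = 0 and of the kernel of the cover P_(n-1) -> syzygy (n-1) otherwise. *)
Fixpoint syzygy (n : nat) : lmodType A :=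
  if n is m.+1 then kernel (free_cover (syzygy m)) else N.

Definition res (n : nat) : lmodType A := {malg A[syzygy n]}.

(* The differential P_n -> P_(n-1); it is zero for n = 0. *)
Definition res_d (n : nat) : {linear res n -> res n.-1} :=
  match n with
  | 0 => \0
  | m.+1 => @ker_val _ _ _ (free_cover (syzygy m)) \o free_cover (syzygy m.+1)
  end.

End Resolution.

Definition Tor (n : nat) (M : lmodType A^c) (N : lmodType A) : lmodType k :=
  homology (@tens_map k A M _ _ (res_d N n.+1)) (@tens_map k A M _ _ (res_d N n)).

End Tor.

Definition lie_homology (n : nat) (k : fieldType) (G : lieAlgType k) : lmodType k :=
  @Tor k (U G) n (trivr G) (trivl G).

(* Main.v *)
Require Import Defs.
From mathcomp Require Import all_boot all_algebra.
From HB Require Import structures.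
From mathcomp Require Import ssrAC finmap monalg boolp wochoice zify ring.
From mathcomp Require mpoly.
Import Defs.

(* Let Q = L/I and S = I^n.  Suppose a matrix representation rho of L over a
   k-algebra confines S to the top right corner and has zero first and last
   diagonal entries.  Then rho kills [L, S], so that rho(S) is a quotient of
   S/[L, S]; since S lies in [L, L], Hopf's formula makes S/[L, S] the Schur
   multiplier of L/S, and each of the three finiteness conditions forces rho(S)
   to be finite-dimensional.  It remains to find rho with rho(S)
   infinite-dimensional.

   Take upper triangular matrices over the enveloping algebra of g = Q^(n-1),
   with diagonal 0, h_1, .., h_(n-1), 0, where h_l is the diagonal embedding of
   Q into the slots l, .., n-1, and with superdiagonal 1 on one generator x0 and
   0 on the others.  On m in I the superdiagonal entries are images of the Fox
   derivative dm/dx0 in U(Q), which is non-zero for some m and x0.  The corner of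
   [..[ad(q)^j m, m], .., m] has, by the Poincare-Birkhoff-Witt theorem, a leading
   term that can be computed in a polynomial ring, and its degree grows with j.
   If n = 2 and k has characteristic 2 these leading terms cancel: when Q is not
   abelian ad(q)^j ad(a) m replaces ad(q)^j m, and when Q is abelian 4 x 4
   matrices involving a linear form on Q are used. *)

Set Implicit Arguments.
Unset Strict Implicit.
Unset Printing Implicit Defensive.

Import GRing.Theory.
Local Open Scope ring_scope.

(** Put w_l = h_l - h_(l+1), where h_0 = h_n = 0: for l > 0 this is the slot l alone, and w_0 is
    minus the sum of all slots. Left and right multiplication agree on leading terms, so the entry
    of m at (l, l+1) has as leading term that of dm/dx0 taken at w_l, and ad(q)^j multiplies it by
    w_l(q)^j. Bracketing n - 1 times with m then yields the product of the leading terms of m at all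
    places, times the iterated difference of order n - 1 of the sequence w_l(q)^j. The product is
    non-zero in a domain; the slots are kept apart so that the difference does not cancel. For n > 2
    the mixed monomials of w_0(q)^j survive whenever j is non-zero in k. For n = 2 there is one
    slot, w_0 = - w_1, and the difference is ((-1)^j - 1) w_1(q)^j, which vanishes in characteristic
    2. There a term of lower degree has to be used: the commutator of a with q^j if Q is not
    abelian. If Q is abelian no commutator is left, and the factor j q^(j-1) comes from an
    additional row in which q has the entry 1. *)

Definition to_linear (R : pzRingType) (U V : lmodType R) (f : U -> V)
    (lf : linear f) : {linear U -> V} :=
  HB.pack f (GRing.isLinear.Build R U V *:%R f lf).

Section MalgInd.
Variables (R : nzRingType) (K : choiceType).

Lemma malgUZ (a : R) (x : K) : << a *g x >> = a *: << x >>.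
Proof.
by apply/malgP => y; rewrite mcoeffZ !mcoeffU mulrnAr mulr1.
Qed.

Lemma malg_ind (P : {malg R[K]} -> Prop) :
  P 0 -> (forall a u v, P u -> P v -> P (a *: u + v)) ->
  (forall x, P << x >>) -> forall t, P t.
Proof.
move=> P0 PD PU t; rewrite [t]monalgE; elim/big_rec: _ => // x u _ Pu.
by rewrite malgUZ; apply: PD.
Qed.

End MalgInd.

(** * Ordered bases and the Poincare-Birkhoff-Witt theorem *)

Section Basis.
Variables (k : fieldType) (V : lmodType k).

Record obasis := OBasis {
  bas_ix : choiceType;
  bas_le : rel bas_ix;
  bas : bas_ix -> V;
  bas_coord : V -> {malg k[bas_ix]};
  bas_le_total : total bas_le;
  bas_le_anti : antisymmetric bas_le;
  bas_le_trans : transitive bas_le;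
  bas_coord_linear : linear bas_coord;
  bas_coordK : forall v, malg_lift bas (bas_coord v) = v;
  bas_coord_bas : forall b, bas_coord (bas b) = << b >> }.

HB.instance Definition _ (B : obasis) :=
  GRing.isLinear.Build k V {malg k[bas_ix B]} *:%R (@bas_coord B)
    (@bas_coord_linear B).

Lemma total_max (T : eqType) (le : rel T) (s : seq T) x0 :
  total le -> transitive le -> x0 \in s ->
  exists2 m, m \in s & forall x, x \in s -> le x m.
Proof.
move=> tot tr; elim: s x0 => // y s IHs x0 _.
case: s IHs => [_|z s IHs].
  exists y; first by rewrite mem_head.
  by move=> x; rewrite inE => /eqP ->; have /orP[] := tot y y.
have [m ms mM] := IHs z (mem_head _ _).
have /orP[ym|my] := tot y m.
  exists m; first by rewrite inE ms orbT.
  by move=> x; rewrite inE => /orP[/eqP->|/mM].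
exists y; first by rewrite mem_head.
move=> x; rewrite inE => /orP[/eqP->|/mM xm]; last exact: tr my.
by have /orP[] := tot y y.
Qed.

(* Along a well-order of V, the vectors outside the span of their predecessors
   form a basis, which moreover comes with a total order. *)
Lemma basis_exists : inhabited obasis.
Proof.
have [le wole] := well_ordering_principle V.
have wol : wo_chain le predT by move=> A _; apply: wole.
have tot : total le by move=> x y; apply: (wo_chainW wol).
have refl : reflexive le by move=> x; apply: (wo_chain_reflexive wol).
have anti : antisymmetric le.
  by move=> x y; apply: (wo_chain_antisymmetric wol).
have tr : transitive le.
  move=> y x z xy yz.
  have [|m [[mA mm] _]] := wole (mem [:: x; y; z]); first by exists x; rewrite !inE eqxx.
  have mx : le m x by apply: mm; rewrite !inE eqxx.
  have my : le m y by apply: mm; rewrite !inE eqxx orbT.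
  have mz : le m z by apply: mm; rewrite !inE eqxx !orbT.
  move: mA; rewrite !inE => /or3P[]/eqP em; rewrite em in mx my mz => //.
    by rewrite (anti x y) // xy mx.
  by rewrite (anti z y) // yz my.
pose below b := span (fun y : V => le y b /\ y <> b).
pose B := {b : V | b \notin below b}.
pose bs (b : B) : V := val b.
(* A least vector outside the span of [B] would itself be in [B], or be a combination of its
   predecessors, which are in that span. *)
have surj v : exists g : {malg k[B]}, malg_lift bs g == v.
  apply: contrapT => nv.
  have [|m [[mA mm] _]] := wole (fun v => ~~ `[< exists g : {malg k[B]}, malg_lift bs g == v >]).
    by exists v; apply/negP => /asboolP.
  have mA' : ~ exists g : {malg k[B]}, malg_lift bs g == m by move/asboolP; apply/negP.
  apply: mA'.
  have [mb|mb] := boolP (m \in below m); last first.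
    by exists << (exist _ m mb : B) >>; rewrite malg_liftU.
  have WP : submod_closed (fun v => `[< exists g : {malg k[B]}, malg_lift bs g == v >]).
    split=> [|a u w /asboolP[g /eqP gu] /asboolP[h /eqP hw]]; apply/asboolP.
      by exists 0; rewrite linear0.
    by exists (a *: g + h); rewrite linearP /= gu hw.
  have : m \in SubModule WP.
    apply: (span_min _ mb) => y [ym nym].
    apply: contrapT => nsy; apply: nym; apply: anti; rewrite ym; apply: mm.
    by apply/negP.
  by move/asboolP.
(* The largest index in the support of a relation would be a combination of its predecessors,
   contrary to its membership in [B]. *)
have inj (g : {malg k[B]}) : malg_lift bs g = 0 -> g = 0.
  move=> g0; suff /eqP s0 : msupp g == fset0%fset.
    by apply/malgP => x; rewrite mcoeff0 mcoeff_outdom // s0 inE.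
  apply/negPn/negP => /fset0Pn[x xg].
  have [m mg mM] : exists2 m, m \in msupp g & forall x, x \in msupp g -> le (bs x) (bs m).
    apply: (total_max (le := relpre bs le) _ _ xg) => [y z|y z w].
      exact: tot.
    exact: tr.
  have /negP := valP m; apply.
  have gm : g@_m != 0 by rewrite mcoeff_neq0.
  pose h := g - g@_m *: << m >>.
  have hb : malg_lift bs h \in below (val m).
    rewrite /malg_lift big_seq rpred_sum // => y; rewrite -mcoeff_neq0 /h mcoeffB mcoeffZ mcoeffU.
    case: (eqVneq m y) => [->|my]; first by rewrite mulr1 subrr eqxx.
    rewrite mulr0 subr0 => gy; apply: rpredZ; apply: mem_span; split.
      by apply: mM; rewrite -mcoeff_neq0.
    by move/val_inj => ym; rewrite ym eqxx in my.
  have e : val m = - (g@_m)^-1 *: malg_lift bs h.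
    rewrite /h linearB linearZ /= malg_liftU g0 sub0r scalerN scaleNr opprK.
    by rewrite scalerA mulVf // scale1r.
  by rewrite {1}e; apply: rpredZ.
have [c cK] : exists c, forall v, malg_lift bs (c v) = v.
  by have [c cK] := choice surj; exists c => v; apply/eqP.
have injE g h : malg_lift bs g = malg_lift bs h -> g = h.
  by move=> gh; apply/eqP; rewrite -subr_eq0; apply/eqP/inj; rewrite linearB /= gh subrr.
constructor; apply: (@OBasis B (relpre bs le) bs c) => //.
- by move=> x y; apply: tot.
- by move=> x y /anti /val_inj.
- by move=> x y z; apply: tr.
- by move=> a u v; apply: injE; rewrite linearP /= !cK.
- by move=> b; apply: injE; rewrite cK malg_liftU.
Qed.

End Basis.

Lemma mmapZ_semi (k C : nzRingType) (iota : {rmorphism k -> C}) (K : choiceType)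
  (h : K -> C) a (g : {malg k[K]}) : mmap iota h (a *: g) = iota a * mmap iota h g.
Proof.
rewrite (mmapEw (msuppZ_le _ _)) mmapE big_distrr /=.
by apply/eq_bigr=> x _; rewrite mcoeffZ rmorphM /= mulrA.
Qed.

Section SemilinearExtension.
Variables (k : fieldType) (V : lmodType k) (B : obasis V).
Variables (C : comNzRingType) (iota : {rmorphism k -> C}).
Local Notation I := (bas_ix B).
Local Notation b := (@bas _ _ B).

(** [C] is only a ring under [k] through [iota], with no module structure over [k]; hence this form
    instead of [linear]. *)
Definition semilinear_map (f : V -> C) :=
  forall a x y, f (a *: x + y) = iota a * f x + f y.

Definition ext (h : I -> C) (x : V) : C := mmap iota h (bas_coord B x).

Lemma ext_semi h : semilinear_map (ext h).
Proof.
by move=> a x y; rewrite /ext linearP /= raddfD /= mmapZ_semi.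
Qed.

Lemma ext_bas h i : ext h (b i) = h i.
Proof. by rewrite /ext bas_coord_bas mmapU /= rmorph1 mul1r. Qed.

Lemma semi0 f : semilinear_map f -> f 0 = 0.
Proof.
move=> sf; have := sf (-1) 0 0.
by rewrite scaler0 addr0 rmorphN1 mulN1r addNr.
Qed.

Lemma semiN f x : semilinear_map f -> f (- x) = - f x.
Proof.
by move=> sf; rewrite -[- x]addr0 -scaleN1r sf semi0 // rmorphN1 mulN1r addr0.
Qed.

Lemma semiD f x y : semilinear_map f -> f (x + y) = f x + f y.
Proof. by move=> sf; rewrite -[x]scale1r sf rmorph1 mul1r scale1r. Qed.

Lemma semi_eq f g : semilinear_map f -> semilinear_map g ->
  (forall i, f (b i) = g (b i)) -> f =1 g.
Proof.
move=> sf sg fg x; rewrite -(bas_coordK B x).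
elim/malg_ind: (bas_coord B x) => [|a u v fu fv|i]; first by rewrite linear0 !semi0.
  by rewrite linearP sf sg fu fv.
by rewrite malg_liftU.
Qed.

Lemma eq_ext h h' : h =1 h' -> ext h =1 ext h'.
Proof. by move=> hh' x; apply: eq_bigr => i _; rewrite hh'. Qed.

Lemma ext_sub h h' x : ext h x - ext h' x = ext (fun i => h i - h' i) x.
Proof.
rewrite /ext /mmap -sumrB; apply: eq_bigr => i _; by rewrite mulrBr.
Qed.

Lemma ext_comp (f : V -> C) (x : V) :
  semilinear_map f -> ext (fun i => f (b i)) x = f x.
Proof.
move=> sf; apply: semi_eq => //; first exact: ext_semi.
by move=> i; rewrite ext_bas.
Qed.

Lemma ext_exchange (h : I -> I -> C) x y :
  ext (fun i => ext (h i) y) x = ext (fun j => ext (h^~ j) x) y.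
Proof.
rewrite /ext /mmap; under eq_bigr do rewrite mulr_sumr.
rewrite exchange_big; apply: eq_bigr => i _; rewrite mulr_sumr.
by apply: eq_bigr => j _; rewrite mulrCA.
Qed.

End SemilinearExtension.

(** * Straightening of words and its confluence *)

Section Diamond.
Variables (k : fieldType) (G : lieAlgType k) (B : obasis G).
Variables (C : comNzRingType) (iota : {rmorphism k -> C}).
Local Notation I := (bas_ix B).
Local Notation b := (@bas _ _ B).
Local Notation le := (@bas_le _ _ B).
Local Notation ext := (@ext _ _ B _ iota).
Variables (lam : I -> C) (d : nat).

(** The prescribed value on words of length at most [d]. It ignores the order of the letters, so
    these words are never straightened. *)
Definition symw (w : seq I) : C := (size w == d)%:R * \prod_(i <- w) lam i.

Fixpoint inv (w : seq I) : nat :=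
  if w is i :: s then (count (fun j => ~~ le i j) s + inv s)%N else 0%N.

(* Straightening rewrites u i j v into u j i v, which has one inversion less, and
   u [i, j] v, whose words are shorter; mu decreases in both cases. *)
Definition mu w := (size w ^ 3 + inv w)%N.

Lemma inv_le w : (inv w <= size w ^ 2)%N.
Proof.
elim: w => //= i s IH; have := count_size (fun j => ~~ le i j) s.
move: IH; rewrite !expnS !expn0; nia.
Qed.

Lemma inv_swap u i j v : ~~ le i j ->
  inv (u ++ i :: j :: v) = (inv (u ++ j :: i :: v)).+1.
Proof.
move=> ij; have ji : le j i by have /orP[|//] := bas_le_total (o:=B) i j; rewrite (negPf ij).
elim: u => [|x u IH] /=; first by rewrite ij ji /=; lia.
rewrite IH !count_cat /=; lia.
Qed.

Lemma mu_swap u i j v : ~~ le i j -> (mu (u ++ j :: i :: v) < mu (u ++ i :: j :: v))%N.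
Proof. by move=> ij; rewrite /mu (inv_swap _ _ ij) !size_cat /=; lia. Qed.

(** A shorter word may have more inversions, but at most the square of its length, which the drop of
    the cube outweighs. *)
Lemma mu_short w w' : (size w' < size w)%N -> (mu w' < mu w)%N.
Proof.
move=> ww'; rewrite /mu; have := inv_le w'; move: (inv w') (inv w) => a a'.
move: ww'; move: (size w) (size w') => n m mn am.
have e1 : (m ^ 3 + a <= m ^ 2 * n)%N.
  by apply: leq_trans (leq_add (leqnn _) am) _; rewrite expnSr -mulnSr leq_mul.
have e2 : (m ^ 2 * n < n ^ 3)%N.
  by rewrite (expnSr n 2) ltn_mul2r ltn_sqr mn (leq_ltn_trans _ mn).
exact: leq_trans (leq_ltn_trans e1 e2) (leq_addr _ _).
Qed.

Definition red (f : seq I -> C) (q : seq I * I * I * seq I) : C :=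
  let: (u, i, j, v) := q in
  f (u ++ j :: i :: v) + ext (fun c => f (u ++ c :: v)) (lie (b i) (b j)).

Definition descent (w : seq I) (q : seq I * I * I * seq I) : Prop :=
  let: (u, i, j, v) := q in w = u ++ i :: j :: v /\ ~~ le i j.

(** The descent is picked arbitrarily; confluence shows that the value does not depend on it. Sorted
    words longer than [d] get the value 0, a free choice since they stand for independent elements
    of the envelope. *)
Definition step (f : seq I -> C) (w : seq I) : C :=
  if (size w <= d)%N then symw w else
  if pselect (exists q, descent w q) is left e then red f (projT1 (cid e)) else 0.

(** [N] is fuel: [step] consults only words of smaller [mu], so every fuel above [mu w] gives the
    same value. *)
Fixpoint straight (N : nat) (w : seq I) : C :=
  if N is N'.+1 then if mu w == N' then step (straight N') w else straight N' w
  else 0.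

Definition str w := straight (mu w).+1 w.

Lemma straightE N w : (mu w < N)%N -> straight N w = str w.
Proof.
elim: N => // N IH; rewrite ltnS leq_eqVlt => /orP[/eqP <-|muN]; first by [].
by rewrite /= (ltn_eqF muN) IH.
Qed.

Lemma strE w : str w = step str w.
Proof.
rewrite {1}/str /= eqxx /step; case: ifP => // _.
case: pselect => // e; case: (cid e) => -[[[u i] j] v] /= [ew ij].
rewrite straightE ?ew ?mu_swap //; congr (_ + _).
apply: eq_ext => c; rewrite straightE //; apply: mu_short.
by rewrite !size_cat /=; lia.
Qed.

Lemma str_small w : (size w <= d)%N -> str w = symw w.
Proof. by move=> wd; rewrite strE /step wd. Qed.

Lemma str_descent w q : (d < size w)%N -> descent w q ->
  exists2 q', descent w q' & str w = red str q'.
Proof.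
move=> wd wq; rewrite strE /step leqNgt wd /=.
case: pselect => [e|]; last by case; exists q.
by case: (cid e) => q' /= wq'; exists q'.
Qed.

(** The recursion gives this equation only at the descent it selects. At all places and for all
    pairs of letters, it says that [str] respects the bracket relation of the envelope. *)
Definition rel_at u i j v := str (u ++ i :: j :: v) = red str (u, i, j, v).

Section Confluence.
Variable n : nat.
Hypothesis IHn : forall u i j v, ((size u + size v).+2 < n)%N -> rel_at u i j v.
Variable N : nat.
Hypothesis IHN : forall u i j v, (size u + size v).+2 = n ->
  (inv (u ++ i :: j :: v) < N)%N -> ~~ le i j -> rel_at u i j v.

(** [IHn] summed over the coordinates of [x]: in shorter words the relation already holds with an
    arbitrary element as one of the two letters. *)
Lemma mid_bracket u x c v : ((size u + size v).+2 < n)%N ->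
  ext (fun e => str (u ++ e :: c :: v)) x - ext (fun e => str (u ++ c :: e :: v)) x
  = ext (fun e => str (u ++ e :: v)) (lie x (b c)).
Proof.
move=> uv; rewrite ext_sub.
have sS := @ext_semi _ _ B _ iota (fun e => str (u ++ e :: v)).
transitivity (ext (fun e => ext (fun e => str (u ++ e :: v)) (lie (b e) (b c))) x).
  by apply: eq_ext => e; rewrite IHn //= addrC addKr.
apply: (@ext_comp _ _ B _ iota (fun y => ext _ (lie y (b c)))) => a y z.
by rewrite lie_linearl sS.
Qed.

(** Both reducts are reduced further until they can be compared, by induction on length ([IHn]) and,
    in equal length, on inversions ([IHN]). Overlapping descents need the Jacobi identity, disjoint
    ones only the exchange of two sums. *)
Lemma confl_aux w q q' : size w = n -> (inv w <= N)%N ->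
  descent w q -> descent w q' ->
  (size q.1.1.1 <= size q'.1.1.1)%N -> red str q = red str q'.
Proof.
case: q q' => [[[u i] j] v] [[[u' i'] j'] v'] /= sw iw [ew ij] [ew' ij'].
rewrite leq_eqVlt => /orP[/eqP su|].
  have /eqP : u ++ i :: j :: v = u' ++ i' :: j' :: v' by rewrite -ew.
  by rewrite eqseq_cat // => /andP[/eqP-> /eqP[-> -> ->]].
(* Overlap: [i], [j], [c] are consecutive and strictly decreasing, so the pair [i], [c] is a descent
   as well once it becomes adjacent. *)
rewrite leq_eqVlt => /orP[/eqP su|su].
  have /eqP : (u ++ [:: i]) ++ j :: v = u' ++ i' :: j' :: v' by rewrite -ew' ew -catA.
  rewrite eqseq_cat; last by rewrite size_cat addn1.
  case/andP => /eqP eu' /eqP[ei ev]; subst u' i' v w; rename j' into c.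
  have ic : ~~ le i c.
    apply: contra ij => ic; apply: bas_le_trans ic _.
    by have /orP[|//] := bas_le_total (o:=B) j c; rewrite (negPf ij').
  have s1 : rel_at (u ++ [:: j]) i c v'.
    apply: IHN => //; first by move: sw; rewrite !size_cat /=; lia.
    by move: iw; rewrite (inv_swap _ _ ij) -catA /=.
  have s2 : rel_at u j c (i :: v').
    apply: IHN => //; first by move: sw; rewrite !size_cat /=; lia.
    move: iw; rewrite (inv_swap _ _ ij).
    have := inv_swap (u ++ [:: j]) v' ic; rewrite -!catA /= => ->; lia.
  have s3 : rel_at u i c (j :: v').
    apply: IHN => //; first by move: sw; rewrite !size_cat /=; lia.
    move: iw; have := inv_swap (u ++ [:: i]) v' ij'; rewrite -!catA /= => ->; lia.
  have s4 : rel_at (u ++ [:: c]) i j v'.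
    apply: IHN => //; first by move: sw; rewrite !size_cat /=; lia.
    move: iw; have := inv_swap (u ++ [:: i]) v' ij'; rewrite -!catA /= => ->.
    by rewrite (inv_swap _ _ ic); lia.
  move: s1 s2 s3 s4; rewrite /rel_at /= -!catA /= => -> -> -> ->.
  have sn : ((size u + size v').+2 < n)%N by move: sw; rewrite size_cat /=; lia.
  pose S := ext (fun e => str (u ++ e :: v')).
  have sS : semilinear_map iota S by apply: ext_semi.
  have m1 := mid_bracket (lie (b i) (b j)) c sn.
  have m2 := mid_bracket (lie (b j) (b c)) i sn.
  have m3 := mid_bracket (lie (b i) (b c)) j sn.
  rewrite -/S in m1 m2 m3.
  (* After three swaps on each side both reach the same sorted triple; what remains of the bracket
     terms is a Jacobi sum. *)
  have jac : S (lie (lie (b i) (b j)) (b c)) + S (lie (lie (b j) (b c)) (b i))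
           - S (lie (lie (b i) (b c)) (b j)) = 0.
    rewrite -(semiN _ sS) -!(semiD _ _ sS) -(semi0 sS); congr S.
    rewrite (lieC (lie (b i) (b j))) (lieC (lie (b j) (b c))).
    rewrite (lieC (lie (b i) (b c))) opprK (lieC (b i) (b c)) linearN.
    rewrite -[RHS]oppr0 -(lie_jacobi (b i) (b j) (b c)) !opprD.
    by rewrite /= -!addrA [LHS]addrC -!addrA.
  have cE z y : ext (fun e => str ((u ++ [:: z]) ++ e :: v')) y
      = ext (fun e => str (u ++ z :: e :: v')) y.
    by apply: eq_ext => e; rewrite -catA.
  rewrite !cE; move: jac; rewrite -m1 -m2 -m3 => jac.
  by apply/eqP; rewrite -subr_eq0; apply/eqP; rewrite -[RHS]jac; ring.
(* The remaining case: disjoint descents, separated by a word [t]. *)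
have [t ev] : exists t, v = t ++ i' :: j' :: v' /\ u' = u ++ i :: j :: t.
  exists (drop (size u).+2 u').
  have /eqP := ew'; rewrite ew -{1}[u'](cat_take_drop (size u).+2).
  have -> : u ++ i :: j :: v = (u ++ [:: i; j]) ++ v by rewrite -catA.
  rewrite -[(take _ _ ++ _) ++ _]catA eqseq_cat; last by rewrite size_cat size_takel //= addn2.
  case/andP => /eqP e1 /eqP ->; split=> //.
  by rewrite -{1}[u'](cat_take_drop (size u).+2) -e1 -catA.
case: ev => ev eu'; subst u' v w.
have s1 : rel_at (u ++ j :: i :: t) i' j' v'.
  apply: IHN => //; first by move: sw; rewrite !size_cat /= size_cat /=; lia.
  by move: iw; rewrite (inv_swap _ _ ij) -catA /=.
have s2 : rel_at u i j (t ++ j' :: i' :: v').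
  apply: IHN => //; first by move: sw; rewrite !size_cat /= size_cat /=; lia.
  move: iw; have := inv_swap (u ++ i :: j :: t) v' ij'; rewrite -!catA /= => ->; lia.
move: s1 s2; rewrite /rel_at /= -!catA /= => -> ->.
set P := str _; rewrite -!addrA; congr (_ + _).
have e1 : ext (fun c => str (u ++ c :: t ++ i' :: j' :: v')) (lie (b i) (b j))
   - ext (fun c => str (u ++ c :: t ++ j' :: i' :: v')) (lie (b i) (b j))
   = ext (fun c => ext (fun e => str (u ++ c :: t ++ e :: v')) (lie (b i') (b j')))
       (lie (b i) (b j)).
  rewrite ext_sub; apply: eq_ext => c.
  have -> : u ++ c :: t ++ i' :: j' :: v' = (u ++ c :: t) ++ i' :: j' :: v' by rewrite -catA.
  rewrite IHn; last by move: sw; rewrite !size_cat /= size_cat /=; lia.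
  rewrite /= -catA /= addrC addKr; apply: eq_ext => e; by rewrite -catA.
have e2 : ext (fun c => str (u ++ i :: j :: t ++ c :: v')) (lie (b i') (b j'))
   - ext (fun c => str (u ++ j :: i :: t ++ c :: v')) (lie (b i') (b j'))
   = ext (fun c => ext (fun e => str (u ++ e :: t ++ c :: v')) (lie (b i) (b j)))
       (lie (b i') (b j')).
  rewrite ext_sub; apply: eq_ext => c.
  rewrite IHn; last by move: sw; rewrite !size_cat /= !size_cat /=; lia.
  by rewrite /= addrC addKr.
(* The two differences are one double sum over the letters of both brackets, taken in either
   order. *)
rewrite ext_exchange -e2 in e1.
have cE z z' y : ext (fun c => str ((u ++ [:: z, z' & t]) ++ c :: v')) y
    = ext (fun c => str (u ++ [:: z, z' & t ++ c :: v'])) y.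
  by apply: eq_ext => e; rewrite -catA.
rewrite !cE; apply/eqP; rewrite -subr_eq0.
move/eqP: e1; rewrite -subr_eq0 => /eqP e1; rewrite -[X in _ == X]e1.
by apply/eqP; ring.
Qed.

Lemma confl w q q' : size w = n -> (inv w <= N)%N ->
  descent w q -> descent w q' -> red str q = red str q'.
Proof.
move=> sw iw wq wq'; have /orP[qq'|qq'] := leq_total (size q.1.1.1) (size q'.1.1.1).
  exact: confl_aux iw wq wq' qq'.
exact/esym/(confl_aux sw iw wq' wq qq').
Qed.

End Confluence.

Lemma symw_swap u i j v : symw (u ++ i :: j :: v) = symw (u ++ j :: i :: v).
Proof. by rewrite /symw !size_cat /= !big_cat !big_cons /= (mulrCA (lam i)). Qed.

Lemma symw_short w : (size w < d)%N -> symw w = 0.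
Proof. by move=> wd; rewrite /symw (ltn_eqF wd) mul0r. Qed.

Lemma ext0 (h : I -> C) x : h =1 (fun=> 0) -> ext h x = 0.
Proof. by move=> h0; apply: big1 => i _; rewrite h0 mulr0. Qed.

Lemma str_rel u i j v : rel_at u i j v.
Proof.
have [n] := ubnP (size u + size v).+2; elim: n u i j v => // n IHn u i j v.
rewrite ltnS leq_eqVlt => /orP[/eqP sn|]; last exact: IHn.
have IHn' u1 i1 j1 v1 : ((size u1 + size v1).+2 < n)%N -> rel_at u1 i1 j1 v1.
  by move=> ?; apply: IHn.
(* In length at most [d] the value is symmetric, and the bracket term involves words shorter than
   [d], of value 0. *)
have [nd|dn] := leqP n d.
  rewrite /rel_at /= !str_small ?size_cat /=; [|lia..].
  rewrite symw_swap ext0 ?addr0 // => c.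
  by rewrite str_small ?symw_short // size_cat /=; lia.
have desc N : forall u i j v, (size u + size v).+2 = n ->
    (inv (u ++ i :: j :: v) < N)%N -> ~~ le i j -> rel_at u i j v.
  elim: N => // N IHN u1 i1 j1 v1 s1; rewrite ltnS => i1N ij1.
  have wq : descent (u1 ++ i1 :: j1 :: v1) (u1, i1, j1, v1) by [].
  have sw : size (u1 ++ i1 :: j1 :: v1) = n by rewrite size_cat /=; lia.
  have [|q' wq' eq'] := str_descent _ wq; first by rewrite sw.
  rewrite /rel_at eq'; exact: (confl IHn' IHN sw i1N wq' wq).
(* A strict ascent is the descent relation read backwards, with [lieC]; for equal letters it is
   [liexx]. *)
have [ij|ij] := boolP (le i j); last exact: desc ij.
have [ji|ji] := boolP (le j i).
  have -> : j = i by apply/esym/(bas_le_anti (o := B)); rewrite ij ji.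
  by rewrite /rel_at /= liexx (semi0 (ext_semi _ _)) addr0.
have := desc _ u j i v sn (ltnSn _) ji; rewrite /rel_at /= => ->.
rewrite (lieC (b i)) (semiN _ (ext_semi _ _)); by rewrite addrK.
Qed.

(** The multilinear extension of [str] to words in arbitrary elements of [G]; [u] accumulates the
    letters already expanded in the basis. *)
Fixpoint strx (u : seq I) (w : seq G) : C :=
  if w is x :: w' then ext (fun c => strx (rcons u c) w') x else str u.

Lemma strx_swap w u i j v :
  strx (u ++ i :: j :: v) w - strx (u ++ j :: i :: v) w
  = ext (fun c => strx (u ++ c :: v) w) (lie (b i) (b j)).
Proof.
elim: w u i j v => [|x w IH] u i j v /=; first by rewrite str_rel /= addrC addKr.
rewrite ext_sub ext_exchange; apply: eq_ext => c.
rewrite !rcons_cat /= IH; apply: eq_ext => e; by rewrite rcons_cat.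
Qed.

Lemma ext_lin a (h h' : I -> C) x :
  iota a * ext h x + ext h' x = ext (fun c => iota a * h c + h' c) x.
Proof.
rewrite /ext /mmap mulr_sumr -big_split; apply: eq_bigr => i _ /=.
by rewrite mulrDr mulrCA.
Qed.

Lemma strx_semi u p q : semilinear_map iota (fun x => strx u (p ++ x :: q)).
Proof.
elim: p u => [|y p IH] u a x z /=; first exact: ext_semi.
by rewrite ext_lin; apply: eq_ext => c; rewrite IH.
Qed.

Lemma strx_lie u p q x y :
  strx u (p ++ x :: y :: q) - strx u (p ++ y :: x :: q)
  = strx u (p ++ lie x y :: q).
Proof.
elim: p u => [|z p IH] u /=; last by rewrite ext_sub; apply: eq_ext => c; apply: IH.
rewrite [X in _ - X]ext_exchange ext_sub.
have sS := @ext_semi _ _ B _ iota (fun c => strx (rcons u c) q).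
transitivity (ext (fun c => ext (fun e => ext (fun c => strx (rcons u c) q)
                                          (lie (b c) (b e))) y) x).
  apply: eq_ext => c; rewrite ext_sub; apply: eq_ext => e.
  transitivity (ext (fun z => strx (u ++ [:: z]) q) (lie (b c) (b e))).
    by rewrite -strx_swap -!cats1 -!catA.
  by apply: eq_ext => z; rewrite cats1.
transitivity (ext (fun c => ext (fun c => strx (rcons u c) q) (lie (b c) y)) x).
  apply: eq_ext => c.
  apply: (@ext_comp _ _ B _ iota (fun z => ext _ (lie (b c) z))) => a z t.
  by rewrite linearP sS.
apply: (@ext_comp _ _ B _ iota (fun z => ext _ (lie z y))) => a z t.
by rewrite lie_linearl sS.
Qed.

Lemma ext_mulr (h : I -> C) m x : ext (fun c => h c * m) x = ext h x * m.
Proof. by rewrite /ext /mmap mulr_suml; apply: eq_bigr => i _; rewrite mulrA. Qed.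

Lemma strx_symw u w : (size u + size w <= d)%N ->
  strx u w = (size u + size w == d)%N%:R * (\prod_(i <- u) lam i * \prod_(x <- w) ext lam x).
Proof.
elim: w u => [|x w IH] u /=.
  by rewrite addn0 => ud; rewrite str_small // /symw big_nil mulr1.
rewrite addnS => uw; transitivity (ext (fun c => (lam c) * ((size u + size w).+1 == d)%N%:R *
    (\prod_(i <- u) lam i * \prod_(x <- w) ext lam x)) x).
  apply: eq_ext => c; rewrite IH ?size_rcons ?addSn // -cats1 big_cat big_seq1 /=.
  by ring.
rewrite (@eq_ext _ _ B _ iota _ (fun c => lam c * (((size u + size w).+1 == d)%N%:R *
    (\prod_(i <- u) lam i * \prod_(x <- w) ext lam x)))); last by move=> c; rewrite -!mulrA.
by rewrite ext_mulr big_cons; ring.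
Qed.

End Diamond.

Section EnvelopeWords.
Variables (k : fieldType) (G : lieAlgType k).

Definition ug (x : G) : U G := upi (gen x).

Definition uword (w : seq G) : U G := \prod_(x <- w) ug x.

Lemma ug_linear : linear ug.
Proof.
move=> a x y; rewrite /ug -linearP; apply/eqP; rewrite upi_eq.
by apply/env_predP => J _ Jr; apply/Jr/EnvLin.
Qed.

HB.instance Definition _ := GRing.isLinear.Build k G (U G) *:%R ug ug_linear.

Lemma ug0 : ug 0 = 0.
Proof. exact: linear0. Qed.

Lemma ugP a x y : ug (a *: x + y) = a *: ug x + ug y.
Proof. exact: linearP. Qed.

Lemma ugZ a x : ug (a *: x) = a *: ug x.
Proof. exact: linearZ. Qed.

Lemma ug_lie x y : ug (lie x y) = ug x * ug y - ug y * ug x.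
Proof.
rewrite /ug -!rmorphM -linearB; apply/eqP; rewrite upi_eq.
by apply/env_predP => J _ Jr; apply/Jr/EnvLie.
Qed.

Lemma malgUM (K : monomType) (x y : K) : << mmul x y >> = << x >> * << y >> :> {malg k[K]}.
Proof. by rewrite malgM_def fgmulUU mulr1. Qed.

Lemma malg_mulDD (K : monomType) (x y : {malg k[K]}) a u v :
  x * (a *: u + v) * y = a *: (x * u * y) + x * v * y.
Proof. by rewrite mulrDr mulrDl -(malg_scalerAr a x u) -scalerAl. Qed.

Lemma FMonom_cons (K : choiceType) (x : K) w : FMonom (x :: w) = mmul (fmu x) (FMonom w).
Proof. by apply/eqP; rewrite fmP fmM fmU. Qed.

Lemma FMonom_cat (K : choiceType) (v w : seq K) : FMonom (v ++ w) = mmul (FMonom v) (FMonom w).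
Proof. by apply/eqP; rewrite fmP fmM. Qed.

Lemma FMonom_nil (K : choiceType) : FMonom [::] = mone :> {fmonom K}.
Proof. by apply/eqP; rewrite fmP fm1. Qed.

Lemma upi_word w : upi << FMonom w >> = uword w.
Proof.
elim: w => [|x w IH]; rewrite /uword.
  by rewrite big_nil FMonom_nil -[<< _ >>]/(1 : {malg k[{fmonom G}]}) rmorph1.
by rewrite FMonom_cons malgUM rmorphM /= IH big_cons.
Qed.

Lemma uword_ind (P : U G -> Prop) :
  P 0 -> (forall a u v, P u -> P v -> P (a *: u + v)) ->
  (forall w, P (uword w)) -> forall u, P u.
Proof.
move=> P0 PD Pw u; rewrite -(upi_repr u); elim/malg_ind: (repr u) => [|a t t' IH IH'|[w]].
- by rewrite linear0.
- by rewrite linearP; apply: PD.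
- by rewrite upi_word.
Qed.

Lemma uword_cat v w : uword (v ++ w) = uword v * uword w.
Proof. exact: big_cat. Qed.

Lemma uword_cons x w : uword (x :: w) = ug x * uword w.
Proof. exact: big_cons. Qed.

Lemma uword_nil : uword [::] = 1.
Proof. exact: big_nil. Qed.

Lemma counit_ug x : counit (ug x) = 0.
Proof.
rewrite counit_upi mcoeffU1; case: eqP => // /(congr1 (@fdeg G)).
by rewrite fdegU fdeg1.
Qed.

End EnvelopeWords.

Section PBW.
Variables (k : fieldType) (G : lieAlgType k).
Variables (C : comNzRingType) (iota : {rmorphism k -> C}).
Variables (lam : G -> C) (d : nat).
Hypothesis lam_semi : semilinear_map iota lam.

(* The Poincare-Birkhoff-Witt theorem, in the form that the associated graded
   of U G maps onto the symmetric algebra: the degree d part of the extension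
   of lam to symmetric tensors is well defined on elements of degree d. *)
Theorem pbw : exists f : U G -> C, semilinear_map iota f /\
  forall w : seq G, (size w <= d)%N ->
    f (uword w) = (size w == d)%N%:R * \prod_(x <- w) lam x.
Proof.
have [B] := basis_exists G.
pose sx := strx (B := B) iota (fun i => lam (bas i)) d [::].
have [F [F_semi FU]] : exists F : {malg k[{fmonom G}]} -> C,
    semilinear_map iota F /\ forall w, F << FMonom w >> = sx w.
  exists (fun t => mmap iota (fun m : {fmonom G} => sx m) t); split=> [a x y|w].
    by rewrite raddfD /= mmapZ_semi.
  by rewrite mmapU /= rmorph1 mul1r.
(* [sd p t q] is [t] multiplied by the words [p] on the left and [q] on the right; only the listed
   properties are used below. *)
have [sd [[sdP sdg sdgg sdl sdr] sd1]] : exists sd : seq G -> {malg k[{fmonom G}]} -> seq G -> {malg k[{fmonom G}]},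
    [/\ forall p q, linear (fun t => sd p t q),
        forall p x q, sd p (gen x) q = << FMonom (p ++ x :: q) >>,
        forall p x y q, sd p (gen x * gen y) q = << FMonom (p ++ x :: y :: q) >>,
        forall p w t q, sd p (<< FMonom w >> * t) q = sd (p ++ w) t q
      & forall p w t q, sd p (t * << FMonom w >>) q = sd p t (w ++ q)] /\
    forall t, sd [::] t [::] = t.
  exists (fun p t q => << FMonom p >> * t * << FMonom q >>); split; first split.
  - by move=> p q a u v; apply: malg_mulDD.
  - by move=> p x q; rewrite -mulrA /gen -malgUM -FMonom_cons -malgUM -FMonom_cat.
  - move=> p x y q.
    by rewrite -!mulrA /gen -!malgUM -!FMonom_cons -FMonom_cat.
  - by move=> p w t q; rewrite mulrA -malgUM -FMonom_cat.
  - by move=> p w t q; rewrite FMonom_cat malgUM !mulrA.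
  - by move=> t; rewrite FMonom_nil -[<< _ >>]/(1 : {malg k[{fmonom G}]}) mul1r mulr1.
have sd0 p q : sd p 0 q = 0 by apply: (linear0 (to_linear (sdP p q))).
have sdB p q u v : sd p (u - v) q = sd p u q - sd p v q.
  exact: (linearB (to_linear (sdP p q))).
have FB x y : F (x - y) = F x - F y by rewrite (semiD _ _ F_semi) (semiN _ F_semi).
(* Asking for all two-sided multiples by words makes the vanishing of [F] a two-sided ideal, to
   which [env_predP] applies. *)
pose W (t : {malg k[{fmonom G}]}) := `[< forall p q : seq G, F (sd p t q) = 0 >].
have WP : submod_closed W.
  split=> [|a u v /asboolP Wu /asboolP Wv]; apply/asboolP => p q.
    by rewrite sd0 (semi0 F_semi).
  by rewrite sdP F_semi Wu Wv mulr0 addr0.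
have F0 t : t \in env_ideal G -> F t = 0.
  move=> /env_predP /(_ (SubModule WP)) H.
  have /asboolP /(_ [::] [::]) : t \in SubModule WP.
    apply: H => [a u /asboolP Wu|r].
      split; apply/asboolP => p q; elim/malg_ind: a => [|c a a' IH IH'|[w]].
      - by rewrite mul0r sd0 (semi0 F_semi).
      - rewrite mulrDl -scalerAl sdP F_semi.
        by rewrite [X in _ * X + _]IH [X in _ + X]IH' mulr0 addr0.
      - by rewrite sdl.
      - by rewrite mulr0 sd0 (semi0 F_semi).
      - rewrite mulrDr -(malg_scalerAr c u a) sdP F_semi.
        by rewrite [X in _ * X + _]IH [X in _ + X]IH' mulr0 addr0.
      - by rewrite sdr.
    case=> [a x y|x y]; apply/asboolP => p q.
      by rewrite sdB sdP !sdg FB F_semi !FU /sx strx_semi subrr.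
    move: (sdgg p x y q) (sdgg p y x q) (sdg p (lie x y) q).
    move: (gen x * gen y) (gen y * gen x) (gen (lie x y)) => u v z eu ev ez.
    by rewrite !sdB eu ev ez !FB !FU /sx strx_lie subrr.
  by rewrite sd1.
exists (fun u => F (repr u)); have FE t : F (repr (upi t)) = F t.
  apply/eqP; rewrite -subr_eq0 -(semiN _ F_semi) -(semiD _ _ F_semi).
  by apply/eqP/F0; rewrite -upi_eq upi_repr.
split=> [a u v|w wd].
  by rewrite -[u]upi_repr -[v]upi_repr -linearP !FE F_semi.
rewrite -upi_word FE FU /sx strx_symw // big_nil mul1r add0n.
congr (_ * _); apply: eq_bigr => x _; exact: ext_comp.
Qed.

End PBW.

(** * Leading terms in enveloping algebras *)

Module PolynomialDomain.
Import mpoly.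

(** [psi] is only linear because [A] need not commute: it orders the factors of a monomial by index.
    It serves to lift a leading term back to the envelope, up to lower degree. *)
Lemma polynomial_domain (k : fieldType) (n : nat) :
  exists (C : idomainType) (iota : {rmorphism k -> C}) (X : 'I_n -> C),
  forall (A : algType k) (h : 'I_n -> A), exists psi : C -> A,
    (forall a x y, psi (iota a * x + y) = a *: psi x + psi y) /\
    forall w : seq 'I_n,
      psi (\prod_(i <- w) X i) = \prod_(i < n) h i ^+ count_mem i w.
Proof.
exists (mpoly n k), (@mpolyC n k), (fun i => mpolyX k (mnm1 i)) => A h.
exists (mmap (in_alg A) h); split=> [a x y|w].
  by rewrite mul_mpolyC mmapD mmapZ mulr_algl.
have -> : \prod_(i <- w) mpolyX k (mnm1 i) = mpolyX k [multinom count_mem i w | i < n].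
  elim: w => [|i w IH].
    rewrite big_nil -mpolyX0; congr (mpolyX k _).
  rewrite big_cons IH -mpolyXD; congr (mpolyX k _); apply/mnmP => j.
  by rewrite mnmDE !mnmE.
by rewrite mmapX /mmap1; apply: eq_bigr => i _; rewrite mnmE.
Qed.

End PolynomialDomain.

Lemma comm_mull (R : nzRingType) (x y w : R) :
  x * (y * w) - y * w * x = (x * y - y * x) * w + y * (x * w - w * x).
Proof. by rewrite mulrBl mulrBr !mulrA addrA subrK. Qed.

Lemma move_mull (R : nzRingType) (x v w w' : R) :
  x * v - w * (x * w') = x * (v - w * w') + (x * w - w * x) * w'.
Proof. by rewrite mulrBr mulrBl !mulrA addrA subrK. Qed.

Section Degree.
Variables (k : fieldType) (G : lieAlgType k).
Implicit Types (s : seq (k * seq G)) (u v : U G).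

Definition wsum s : U G := \sum_(p <- s) p.1 *: uword p.2.

Definition scale_words a s : seq (k * seq G) := [seq (a * p.1, p.2) | p <- s].

Definition cons_words x s : seq (k * seq G) := [seq (p.1, x :: p.2) | p <- s].

Lemma wsum_cat s t : wsum (s ++ t) = wsum s + wsum t.
Proof. exact: big_cat. Qed.

Lemma wsum_scale a s : wsum (scale_words a s) = a *: wsum s.
Proof.
rewrite /wsum big_map scaler_sumr; apply: eq_bigr => p _.
by rewrite scalerA.
Qed.

Lemma wsum_cons x s : wsum (cons_words x s) = ug x * wsum s.
Proof.
rewrite /wsum big_map mulr_sumr; apply: eq_bigr => p _.
by rewrite uword_cons uscalerAr.
Qed.

Definition size_lt d s := all (fun p => size p.2 < d)%N s.

(** The strict bound leaves room for 0, the only element with [deg_lt 0]. *)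
Definition deg_lt (d : nat) u := exists2 s, size_lt d s & u = wsum s.

Lemma deg_lt0 d : deg_lt d 0.
Proof. by exists [::] => //; rewrite /wsum big_nil. Qed.

Lemma size_lt_scale d a s : size_lt d (scale_words a s) = size_lt d s.
Proof. by rewrite /size_lt all_map; apply: eq_all. Qed.

Lemma size_lt_cons d x s : size_lt d.+1 (cons_words x s) = size_lt d s.
Proof. by rewrite /size_lt all_map; apply: eq_all. Qed.

Lemma deg_lt_lin d a u v : deg_lt d u -> deg_lt d v -> deg_lt d (a *: u + v).
Proof.
move=> [s sd ->] [t td ->]; exists (scale_words a s ++ t).
  by rewrite /size_lt all_cat -!/(size_lt _ _) size_lt_scale sd.
by rewrite wsum_cat wsum_scale.
Qed.

Lemma deg_ltD d u v : deg_lt d u -> deg_lt d v -> deg_lt d (u + v).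
Proof. by move=> du dv; rewrite -[u]scale1r; apply: deg_lt_lin. Qed.

Lemma deg_ltZ d a u : deg_lt d u -> deg_lt d (a *: u).
Proof. by move=> du; rewrite -[_ *: _]addr0; apply/deg_lt_lin/deg_lt0. Qed.

Lemma deg_lt_sum d (J : Type) (r : seq J) (P : pred J) (F : J -> U G) :
  (forall j, P j -> deg_lt d (F j)) -> deg_lt d (\sum_(j <- r | P j) F j).
Proof.
move=> dF; elim/big_rec: _ => [|j u Pj du]; first exact: deg_lt0.
by apply: deg_ltD => //; apply: dF.
Qed.

Lemma deg_lt_mulug d x u : deg_lt d u -> deg_lt d.+1 (ug x * u).
Proof.
move=> [s sd ->]; exists (cons_words x s); first by rewrite size_lt_cons.
by rewrite wsum_cons.
Qed.

Lemma deg_ltW d d' u : (d <= d')%N -> deg_lt d u -> deg_lt d' u.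
Proof.
move=> dd' [s sd ->]; exists s => //; apply: sub_all sd => p.
by move=> /leq_trans; apply.
Qed.

Lemma deg_lt_word d w : (size w < d)%N -> deg_lt d (uword w).
Proof.
move=> wd; exists [:: (1, w)]; first by rewrite /size_lt /= wd.
by rewrite /wsum big_seq1 scale1r.
Qed.

Lemma deg_lt_mul_uword w d u : deg_lt d u -> deg_lt (d + size w) (u * uword w).
Proof.
move=> [s sd ->]; rewrite /wsum mulr_suml big_seq; apply: deg_lt_sum => p ps.
rewrite -uscalerAl -uword_cat; apply/deg_ltZ/deg_lt_word.
by rewrite size_cat ltn_add2r; apply: (allP sd).
Qed.

Lemma deg_lt_exists u : exists d, deg_lt d u.
Proof.
elim/uword_ind: u => [|a u v [d du] [e ev]|w].
- by exists 0%N; apply: deg_lt0.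
- exists (maxn d e); apply: deg_lt_lin; apply: deg_ltW du || apply: deg_ltW ev.
    exact: leq_maxl.
  exact: leq_maxr.
- by exists (size w).+1; apply: deg_lt_word.
Qed.

Lemma deg_lt_comm x w : deg_lt (size w).+1 (ug x * uword w - uword w * ug x).
Proof.
elim: w => [|y w IH].
  by rewrite uword_nil mulr1 mul1r subrr; apply: deg_lt0.
have -> : ug x * uword (y :: w) - uword (y :: w) * ug x
  = uword (lie x y :: w) + ug y * (ug x * uword w - uword w * ug x).
  by rewrite !uword_cons ug_lie; apply: comm_mull.
apply: deg_ltD; first exact: deg_lt_word.
exact: deg_lt_mulug.
Qed.

(** Moving a letter across a word costs only commutators, and these replace two letters by one. *)
Lemma deg_lt_perm (v w : seq G) : perm_eq v w -> deg_lt (size v) (uword v - uword w).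
Proof.
elim: v w => [|x v IH] w.
  rewrite perm_sym => /perm_nilP ->; rewrite subrr; exact: deg_lt0.
move=> vw; have xw : x \in w by rewrite -(perm_mem vw) mem_head.
case/splitPr: xw vw => w1 w2; rewrite perm_sym perm_catC /= perm_cons perm_catC => vw.
have -> : uword (x :: v) - uword (w1 ++ x :: w2)
  = ug x * (uword v - uword (w1 ++ w2)) + (ug x * uword w1 - uword w1 * ug x) * uword w2.
  by rewrite uword_cons !uword_cat uword_cons; apply: move_mull.
apply: deg_ltD; first by apply/deg_lt_mulug/IH; rewrite perm_sym.
have := deg_lt_mul_uword w2 (deg_lt_comm x w1); apply: deg_ltW.
by rewrite /= -(perm_size vw) size_cat.
Qed.

End Degree.

Section Symbol.
Variables (k : fieldType) (G : lieAlgType k).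
Variables (C : comNzRingType) (iota : {rmorphism k -> C}).
Implicit Types (s : seq (k * seq G)) (u v : U G) (lam : G -> C).

Definition wsymbol lam (d : nat) s : C :=
  \sum_(p <- s) (size p.2 == d)%N%:R * (iota p.1 * \prod_(x <- p.2) lam x).

(* u has degree at most d, and c is the value at lam of its image in the d-th
   symmetric power of G. *)
Definition symbol lam (d : nat) u c :=
  exists s, [/\ size_lt d.+1 s, u = wsum s & c = wsymbol lam d s].

Lemma wsymbol_cat lam d s t : wsymbol lam d (s ++ t) = wsymbol lam d s + wsymbol lam d t.
Proof. exact: big_cat. Qed.

Lemma wsymbol_scale lam d a s : wsymbol lam d (scale_words a s) = iota a * wsymbol lam d s.
Proof.
rewrite /wsymbol big_map mulr_sumr; apply: eq_bigr => p _.
by rewrite /= rmorphM -mulrA mulrCA.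
Qed.

Lemma wsymbol_cons lam d x s : wsymbol lam d.+1 (cons_words x s) = lam x * wsymbol lam d s.
Proof.
rewrite /wsymbol big_map mulr_sumr; apply: eq_bigr => p _ /=.
by rewrite eqSS big_cons; ring.
Qed.

(** [symbol] refers to some presentation of [u] by words; the functional of [pbw] recovers the value
    from [u] alone. *)
Lemma symbol_uniq lam d u c c' : semilinear_map iota lam ->
  symbol lam d u c -> symbol lam d u c' -> c = c'.
Proof.
move=> lam_semi [s [sd us ->]] [t [td ut ->]].
have [f [f_semi fw]] := pbw d lam_semi.
suff fE r : size_lt d.+1 r -> f (wsum r) = wsymbol lam d r.
  by rewrite -!fE // -us -ut.
elim: r => [|p r IH] /=; first by rewrite /wsum /wsymbol !big_nil (semi0 f_semi).
case/andP => pd rd; rewrite /wsum /wsymbol !big_cons f_semi fw // -/(wsum _).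
by rewrite IH // mulrCA.
Qed.

Lemma symbol0 lam d : symbol lam d 0 0.
Proof. by exists [::]; rewrite /wsum /wsymbol !big_nil. Qed.

Lemma symbol_lin lam d a u v c c' : symbol lam d u c -> symbol lam d v c' ->
  symbol lam d (a *: u + v) (iota a * c + c').
Proof.
move=> [s [sd -> ->]] [t [td -> ->]]; exists (scale_words a s ++ t).
rewrite wsum_cat wsum_scale wsymbol_cat wsymbol_scale; split=> //.
by rewrite /size_lt all_cat -!/(size_lt _ _) size_lt_scale sd.
Qed.

Lemma symbolD lam d u v c c' : symbol lam d u c -> symbol lam d v c' ->
  symbol lam d (u + v) (c + c').
Proof. by move=> /(symbol_lin 1) H /H; rewrite scale1r rmorph1 mul1r. Qed.

Lemma symbolB lam d u v c c' : symbol lam d u c -> symbol lam d v c' ->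
  symbol lam d (u - v) (c - c').
Proof.
move=> H /(symbol_lin (-1)) /(_ H).
by rewrite scaleN1r rmorphN1 mulN1r ![- _ + _]addrC.
Qed.

Lemma symbol_ugM lam d x u c : symbol lam d u c -> symbol lam d.+1 (ug x * u) (lam x * c).
Proof.
move=> [s [sd -> ->]]; exists (cons_words x s).
by rewrite wsum_cons wsymbol_cons size_lt_cons.
Qed.

Lemma symbol_lift lam d D u c : symbol lam d u c -> (d < D)%N -> symbol lam D u 0.
Proof.
move=> [s [sd -> _]] dD; exists s; split=> //.
  by apply: sub_all sd => p /leq_trans; apply; apply: leq_trans dD _.
rewrite /wsymbol big_seq big1 // => p /(allP sd) pd.
by rewrite (ltn_eqF (leq_ltn_trans _ dD)) ?mul0r.
Qed.

Lemma symbol_deg lam d u : deg_lt d u -> symbol lam d u 0.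
Proof.
move=> [s sd us]; exists s; split=> //; first by apply: sub_all sd => p /ltnW.
rewrite /wsymbol big_seq big1 // => p /(allP sd) pd.
by rewrite (ltn_eqF pd) mul0r.
Qed.

Lemma symbol_uword_mul lam w e v c :
  symbol lam e v c -> symbol lam (size w + e) (uword w * v) (\prod_(x <- w) lam x * c).
Proof.
move=> vc; elim: w => [|x w IH]; first by rewrite uword_nil big_nil !mul1r.
by rewrite uword_cons big_cons -!mulrA; apply: symbol_ugM.
Qed.

Lemma symbolM lam d e u v c c' :
  symbol lam d u c -> symbol lam e v c' -> symbol lam (d + e) (u * v) (c * c').
Proof.
move=> [s [sd -> ->]] vc; elim: s sd => [|p s IH] /=.
  by rewrite /wsum /wsymbol !big_nil !mul0r => _; apply: symbol0.
case/andP => pd /IH{}IH; rewrite /wsum /wsymbol !big_cons !mulrDl.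
apply: symbolD => //; rewrite -uscalerAl -[_ *: _]addr0.
have -> : (size p.2 == d)%:R * (iota p.1 * \prod_(x <- p.2) lam x) * c'
  = iota p.1 * ((size p.2 == d)%:R * \prod_(x <- p.2) lam x * c') + 0 by ring.
apply/symbol_lin/symbol0; have := symbol_uword_mul p.2 vc.
case: (eqVneq (size p.2) d) => [->|nd]; first by rewrite mul1r.
rewrite !mul0r => /symbol_lift; apply; rewrite ltn_add2r ltn_neqAle nd.
by rewrite -ltnS.
Qed.

Lemma symbol1 lam : symbol lam 0 1 1.
Proof.
exists [:: (1, [::])]; rewrite /wsum /wsymbol !big_seq1 /= uword_nil big_nil.
by rewrite scale1r rmorph1 !mulr1.
Qed.

Lemma symbol_ug lam x : symbol lam 1 (ug x) (lam x).
Proof. by have := symbol_ugM x (symbol1 lam); rewrite !mulr1. Qed.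

Lemma symbolX lam d u c n : symbol lam d u c -> symbol lam (n * d) (u ^+ n) (c ^+ n).
Proof.
move=> uc; elim: n => [|n IH]; first by rewrite mul0n !expr0; apply: symbol1.
by rewrite !exprS mulSn; apply: symbolM.
Qed.

Lemma symbol_scale lam nu d u c :
  symbol lam d u c -> symbol (fun x => nu * lam x) d u (nu ^+ d * c).
Proof.
move=> [s [sd -> ->]]; exists s; split=> //.
rewrite /wsymbol mulr_sumr; apply: eq_bigr => p _.
case: (eqVneq (size p.2) d) => [<-|_]; last by rewrite !mul0r mulr0.
rewrite !mul1r mulrCA; congr (_ * _); elim: p.2 => [|x w IH].
  by rewrite !big_nil mulr1.
by rewrite !big_cons /= -IH exprS; ring.
Qed.

End Symbol.

Section GenInjective.
Variables (k : fieldType) (G : lieAlgType k).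

(** Every coordinate of [x] is a symbol of degree 1 of [ug x], hence determined by [ug x]. *)
Lemma ug_inj : injective (@ug k G).
Proof.
have [B] := basis_exists G.
move=> x y xy; apply/eqP; rewrite -subr_eq0; apply/eqP.
have {xy}: ug (x - y) = 0 by rewrite linearB /= xy subrr.
move: (x - y) => {x y} x x0; rewrite -(bas_coordK B x).
suff -> : bas_coord B x = 0 by rewrite linear0.
apply/malgP => i; rewrite mcoeff0.
pose lam y : k := (bas_coord B y)@_i.
have lam_semi : semilinear_map idfun lam.
  by move=> a y z; rewrite /lam linearP mcoeffD mcoeffZ.
apply: (symbol_uniq lam_semi (u := ug x) (d := 1)); first exact: symbol_ug.
by rewrite x0; apply: symbol0.
Qed.

End GenInjective.

Section NonzeroSymbol.
Variables (k : fieldType) (G : lieAlgType k) (B : obasis G).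
Local Notation I := (bas_ix B).
Local Notation b := (@bas _ _ B).

Definition basis_words (s : seq (k * seq I)) : seq (k * seq G) :=
  [seq (p.1, map b p.2) | p <- s].

Lemma deg_lt_basis d u : deg_lt d u ->
  exists2 s, size_lt d (basis_words s) & u = wsum (basis_words s).
Proof.
pose P d u := exists2 s, size_lt d (basis_words s) & u = wsum (basis_words s).
have P0 e : P e 0 by exists [::] => //; rewrite /wsum big_nil.
have PD e a v w : P e v -> P e w -> P e (a *: v + w).
  move=> [s sd ->] [t td ->]; exists ([seq (a * p.1, p.2) | p <- s] ++ t).
    rewrite /basis_words map_cat /size_lt all_cat; apply/andP; split=> //.
    by move: sd; rewrite /basis_words /size_lt !all_map.
  rewrite /basis_words map_cat -/(basis_words t) wsum_cat -wsum_scale; congr (wsum _ + _).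
  by rewrite /scale_words -!map_comp.
have lift0 : malg_lift b 0 = 0 by apply: linear0.
have liftP a y z : malg_lift b (a *: y + z) = a *: malg_lift b y + malg_lift b z.
  exact: linearP.
have Pg e x v : P e v -> P e.+1 (ug x * v).
  move=> [s sd ->]; rewrite -(bas_coordK B x).
  elim/malg_ind: (bas_coord B x) => [|a y z Py Pz|i].
  - by rewrite lift0 ug0 mul0r.
  - by rewrite liftP ugP mulrDl -uscalerAl; apply: PD.
  - rewrite malg_liftU -wsum_cons; exists [seq (p.1, i :: p.2) | p <- s].
      by move: sd; rewrite /basis_words /size_lt !all_map.
    by rewrite /basis_words /cons_words -!map_comp.
have Pw w e : (size w < e)%N -> P e (uword w).
  elim: w e => [|x w IH] e; last by case: e => // e we; rewrite uword_cons; apply/Pg/IH.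
  rewrite uword_nil => e0; exists [:: (1, [::])]; first by rewrite /size_lt /= e0.
  by rewrite /wsum big_seq1 /= uword_nil scale1r.
move=> [s sd ->]; rewrite /wsum big_seq; elim/big_rec: _ => [|p v ps Pv]; first exact: P0.
by apply: PD Pv; apply/Pw/(allP sd).
Qed.

Lemma perm_count_enum (n : nat) (v : seq 'I_n) :
  perm_eq v (flatten [seq nseq (count_mem j v) j | j <- enum 'I_n]).
Proof.
apply/allP => j _ /=; rewrite count_flatten -map_comp sumnE big_map.
rewrite big_enum /= (bigD1 j) //= count_nseq /= eqxx mul1n big1 ?addn0 // => i ij.
by rewrite count_nseq /= (negPf ij).
Qed.

Lemma prod_expr_uword n (g : 'I_n -> G) (m : 'I_n -> nat) :
  \prod_(j < n) ug (g j) ^+ m j = uword (map g (flatten [seq nseq (m j) j | j <- enum 'I_n])).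
Proof.
rewrite [LHS](_ : _ = \prod_(j <- enum 'I_n) ug (g j) ^+ m j); last by rewrite enumT [index_enum _]unlock.
elim: (enum _) => [|j s IH]; first by rewrite big_nil uword_nil.
rewrite big_cons IH /= map_cat uword_cat; congr (_ * _).
elim: (m j) => [|e IHe]; first by rewrite uword_nil.
by rewrite exprS IHe /= uword_cons.
Qed.

(* If p has exact degree d and its symbol vanished in the polynomial ring on the
   basis, then symmetrizing the latter would show that p has degree less than d. *)
Theorem nonzero_symbol (p : U G) (ys : seq G) : p != 0 -> all (fun y => y != 0) ys ->
  exists (C : idomainType) (iota : {rmorphism k -> C}) (lam : G -> C),
  [/\ semilinear_map iota lam,
      exists d c, c != 0 /\ symbol iota lam d p c
    & all (fun y => lam y != 0) ys].
Proof.
move=> p0 ys0.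
have [e0 /asboolP De0] : exists d, `[< deg_lt d p >].
  by have [d dp] := deg_lt_exists p; exists d; apply/asboolP.
have [d /asboolP dp dmin] := ex_minnP (ex_intro (fun d => `[< deg_lt d p >]) e0 (asboolT De0)).
(* The bound 0 would make [p] zero, so the minimal bound is [e.+1] and [p] has exact degree [e]. *)
case: d dp dmin => [[[|q s] //= _ p0']|e pe emin].
  by rewrite p0' /wsum big_nil eqxx in p0.
have [s se ps] := deg_lt_basis pe.
(* The basis indices that occur in [p] or in [ys]. They index the variables, and [Xi] sends all
   others to 0. *)
pose l := flatten [seq q.2 | q <- s] ++ flatten [seq (msupp (bas_coord B y) : seq I) | y <- ys].
have sl q : q \in s -> all (mem l) q.2.
  move=> qs; apply/allP => i iq; rewrite /= mem_cat; apply/orP; left.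
  by apply/flattenP; exists q.2 => //; apply: map_f.
have yl y : y \in ys -> {subset msupp (bas_coord B y) <= l}.
  move=> yys i iy; rewrite mem_cat; apply/orP; right; apply/flattenP.
  by exists (msupp (bas_coord B y) : seq I) => //; apply/mapP; exists y.
move: l sl yl => l sl yl; pose n := size l.
have [C [iota [X XP]]] := PolynomialDomain.polynomial_domain k n.
pose tn (j : 'I_n) : I := tnth (in_tuple l) j.
have [psi [psi_semi psiX]] := XP (U G) (fun j => ug (b (tn j))).
pose ix (i : I) : option 'I_n := insub (index i l).
pose Xi i := if ix i is Some j then X j else 0.
have ixP i : i \in l -> exists2 j, ix i = Some j & tn j = i.
  rewrite -index_mem => il; exists (Ordinal il); first by rewrite /ix insubT.
  by rewrite /tn (tnth_nth i) /= nth_index // -index_mem.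
have psi0 : psi 0 = 0.
  by have := psi_semi (-1) 0 0; rewrite rmorphN1 mulr0 addr0 scaleN1r addNr.
exists C, iota, (ext iota Xi); split; first exact: ext_semi.
  exists e, (wsymbol iota (ext iota Xi) e (basis_words s)); split; last first.
    by exists (basis_words s).
  apply/negP => /eqP c0.
  suff dep : deg_lt e p by have := emin e (asboolT dep); rewrite ltnn.
  have := congr1 psi c0; rewrite psi0 => psic0.
  rewrite -[p]subr0 -psic0 ps; move: se sl {ps c0 psic0}.
  elim: s => [|q s IH] /=; rewrite /wsum /wsymbol.
    by rewrite !big_nil psi0 subrr => _ _; apply: deg_lt0.
  case/andP => qe /IH{}IH sl; rewrite !big_cons /= big_map.
  have {}IH : deg_lt e (wsum (basis_words s) - psi (wsymbol iota (ext iota Xi) e (basis_words s))).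
    by apply: IH => r rs; apply: sl; rewrite inE rs orbT.
  have [v [vq XiE]] : exists v, map tn v = q.2 /\
      \prod_(i <- q.2) ext iota Xi (b i) = \prod_(j <- v) X j.
    have := sl q (mem_head _ _); elim: q.2 => [|i w IHw] /=.
      by exists [::]; rewrite !big_nil.
    case/andP => /ixP [j ij ji] /IHw [v [vw ev]]; exists (j :: v).
    by rewrite /= ji vw !big_cons ev ext_bas /Xi ij.
  rewrite XiE.
  set rest := \sum_(_ <- _) _; set rest' := \sum_(_ <- basis_words s) _.
  have -> : (size (map b q.2) == e)%N%:R * (iota q.1 * \prod_(j <- v) X j) + rest'
    = iota ((size (map b q.2) == e)%N%:R * q.1) * (\prod_(j <- v) X j) + rest'.
    by rewrite rmorphM rmorph_nat mulrA.
  rewrite psi_semi psiX.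
  have -> : q.1 *: uword (map b q.2) + rest -
    (((size (map b q.2) == e)%N%:R * q.1) *: \prod_(j < n) ug (b (tn j)) ^+ count_mem j v + psi rest')
    = (q.1 *: uword (map b q.2) - ((size (map b q.2) == e)%N%:R * q.1) *:
         \prod_(j < n) ug (b (tn j)) ^+ count_mem j v) + (rest - psi rest').
    by rewrite opprD addrACA.
  apply: deg_ltD => //; rewrite (prod_expr_uword (b \o tn)).
  case: eqP => [se|/eqP se].
    rewrite mul1r -scalerBr; apply: deg_ltZ; rewrite -se -vq -map_comp.
    by rewrite !size_map -(size_map (b \o tn)); apply/deg_lt_perm/perm_map/perm_count_enum.
  rewrite mul0r scale0r subr0; apply/deg_ltZ/deg_lt_word.
  by rewrite ltn_neqAle se.
(* In degree 1 [psi] maps the value at [y] back to [ug y], which is non-zero by [ug_inj]. *)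
apply/allP => y yys; apply/negP => /eqP y0.
move/allP/(_ y yys)/negP: ys0; apply; apply/eqP/ug_inj; rewrite ug0 -psi0 -y0.
have {}yl := yl y yys; rewrite -{1}(bas_coordK B y) /malg_lift (linear_sum (@ug k G)) /=.
rewrite /ext /mmap big_seq [in RHS]big_seq.
have psiD u v : psi (u + v) = psi u + psi v.
  by have := psi_semi 1 u v; rewrite rmorph1 mul1r scale1r.
elim/big_ind2: _ => [|u1 u2 v1 v2 -> ->|i iy]; first by rewrite psi0.
  by rewrite psiD.
have [j ij ji] := ixP i (yl i iy).
rewrite ugZ /Xi ij -[_ * _]addr0 psi_semi psi0 addr0 -ji; congr (_ *: _).
have := psiX [:: j]; rewrite big_seq1 => ->.
have := perm_count_enum [:: j]; rewrite perm_sym => cj.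
have ej := perm_small_eq (isT : (size [:: j] <= 1)%N) cj.
rewrite (prod_expr_uword (b \o tn)) ej //=.
by rewrite uword_cons uword_nil mulr1.
Qed.

End NonzeroSymbol.

(** * Corner representations and homology *)

Record lie_rep (k : fieldType) (G : lieAlgType k) (V : lmodType k) := LieRep {
  rep_act :> G -> V -> V;
  rep_linearl : forall v, linear (rep_act^~ v);
  rep_linearr : forall x, linear (rep_act x);
  rep_lie : forall x y v,
    rep_act (lie x y) v = rep_act x (rep_act y v) - rep_act y (rep_act x v) }.

Section EnvelopeAction.
Variables (k : fieldType) (G : lieAlgType k) (V : lmodType k) (r : lie_rep G V).
Local Notation T := {malg k[{fmonom G}]}.

Definition wact (w : seq G) (v : V) : V := foldr r v w.

Definition tact (t : T) (v : V) : V := malg_lift (fun m : {fmonom G} => wact m v) t.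

Lemma tact_linearl v : linear (tact^~ v).
Proof. by move=> a s t; rewrite /tact linearP. Qed.

Lemma tact0 v : tact 0 v = 0.
Proof. exact: (linear0 (to_linear (tact_linearl v))). Qed.

Lemma tactB s t v : tact (s - t) v = tact s v - tact t v.
Proof. exact: (linearB (to_linear (tact_linearl v))). Qed.

Lemma tactU (w : seq G) v : tact << FMonom w >> v = wact w v.
Proof. by rewrite /tact malg_liftU. Qed.

Lemma wact_linear w : linear (wact w).
Proof.
elim: w => [|x w IH] a u v //=.
by rewrite -rep_linearr -IH.
Qed.

Lemma tact_linearr t : linear (tact t).
Proof.
move=> a u v; elim/malg_ind: t => [|c s t IHs IHt|[w]].
- by rewrite !tact0 scaler0 addr0.
- rewrite !tact_linearl IHs IHt !scalerDr !scalerA [c * a]mulrC.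
  by rewrite addrACA.
- by rewrite !tactU wact_linear.
Qed.

Lemma tactr0 t : tact t 0 = 0.
Proof. exact: (linear0 (to_linear (tact_linearr t))). Qed.

Lemma tactM s t v : tact (s * t) v = tact s (tact t v).
Proof.
elim/malg_ind: s => [|c s s' IH IH'|[w]].
- by rewrite mul0r !tact0.
- by rewrite mulrDl -scalerAl !tact_linearl [X in _ *: X + _]IH [X in _ + X]IH'.
elim/malg_ind: t => [|c t t' IH IH'|[w']].
- by rewrite mulr0 !tact0 tactr0.
- rewrite mulrDr -(malg_scalerAr c _ t) !tact_linearl tact_linearr.
  by rewrite [X in _ *: X + _]IH [X in _ + X]IH'.
- by rewrite -malgUM -FMonom_cat !tactU /wact foldr_cat.
Qed.

Lemma tact_gen x v : tact (gen x) v = r x v.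
Proof.
have -> : gen x = << FMonom [:: x] >> :> T.
  by congr << _ >>; apply/eqP; rewrite fmP fmU.
by rewrite tactU.
Qed.

Lemma tact_env t v : t \in env_ideal G -> tact t v = 0.
Proof.
pose W (t : T) := `[< forall v, tact t v = 0 >].
have WP : submod_closed W.
  split=> [|a s s' /asboolP Ws /asboolP Ws']; apply/asboolP => u.
    exact: tact0.
  by rewrite tact_linearl Ws Ws' scaler0 addr0.
move=> /env_predP /(_ (SubModule WP)) H.
suff /asboolP : t \in SubModule WP by apply.
apply: H => [a u /asboolP Wu|s].
  by split; apply/asboolP => x; rewrite tactM Wu ?tactr0.
case=> [a x y|x y]; apply/asboolP => u.
  by rewrite tactB tact_linearl !tact_gen rep_linearl subrr.
have exy : tact (gen x * gen y) u = r x (r y u) by rewrite tactM !tact_gen.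
have eyx : tact (gen y * gen x) u = r y (r x u) by rewrite tactM !tact_gen.
move: exy eyx (tact_gen (lie x y) u).
move: (gen x * gen y) (gen y * gen x) (gen (lie x y)) => s1 s2 s3 e1 e2 e3.
by rewrite !tactB e1 e2 e3 rep_lie subrr.
Qed.

Definition uact (u : U G) (v : V) : V := tact (repr u) v.

Lemma uact_upi t v : uact (upi t) v = tact t v.
Proof.
apply/eqP; rewrite -subr_eq0 -tactB; apply/eqP/tact_env.
by rewrite -upi_eq upi_repr.
Qed.

Lemma uact_linearl v : linear (uact^~ v).
Proof.
move=> a x y; rewrite -[x]upi_repr -[y]upi_repr.
have -> : a *: upi (repr x) + upi (repr y) = upi (a *: repr x + repr y).
  by apply/esym/linearP.
by rewrite !uact_upi tact_linearl.
Qed.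

Lemma uact_linearr u : linear (uact u).
Proof. exact: tact_linearr. Qed.

Lemma uactM u u' v : uact (u * u') v = uact u (uact u' v).
Proof.
have -> : u * u' = upi (repr u * repr u') by [].
by rewrite uact_upi tactM.
Qed.

Lemma uact1 v : uact 1 v = v.
Proof.
have -> : 1 = upi 1 :> U G by [].
by rewrite uact_upi -[1]/(<< mone >>) -FMonom_nil tactU.
Qed.

Lemma uact_ug x v : uact (ug x) v = r x v.
Proof. by rewrite uact_upi tact_gen. Qed.

(* The type carries no k-module structure of its own: as an lmodType it can
   only be seen over U G, and k acts on the underlying V. *)
Definition repmod : Type := (fun _ : lie_rep G V => V : Type) r.

HB.instance Definition _ := GRing.Zmodule.copy repmod V.

Lemma uactA u u' (v : repmod) : uact u (uact u' v) = uact (u * u') v.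
Proof. by rewrite uactM. Qed.

Lemma uactDr : right_distributive (uact : U G -> repmod -> repmod) +%R.
Proof. by move=> u x y; have := uact_linearr u 1 x y; rewrite !scale1r. Qed.

Lemma uactDl (v : repmod) : {morph uact^~ v : u u' / u + u'}.
Proof. by move=> u u'; have := uact_linearl v 1 u u'; rewrite !scale1r. Qed.

HB.instance Definition _ := GRing.Zmodule_isLmodule.Build (U G) repmod
  uactA uact1 uactDr uactDl.

Lemma uactE u (v : repmod) : u *: v = uact u v.
Proof. by []. Qed.

End EnvelopeAction.

Section ActionLemmas.
Variables (k : fieldType) (G : lieAlgType k) (V : lmodType k) (r : lie_rep G V).

Lemma uact0l v : uact r 0 v = 0.
Proof. exact: (linear0 (to_linear (uact_linearl r v))). Qed.

Lemma uactZ a u v : uact r (a *: u) v = a *: uact r u v.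
Proof. by have := uact_linearl r v a u 0; rewrite uact0l !addr0. Qed.

Lemma counitP a (u v : U G) : counit (a *: u + v) = a * counit u + counit v.
Proof.
rewrite -[u]upi_repr -[v]upi_repr.
have -> : a *: upi (repr u) + upi (repr v) = upi (a *: repr u + repr v).
  by apply/esym/linearP.
by rewrite !counit_upi mcoeffD mcoeffZ.
Qed.

Lemma counit0 : counit (0 : U G) = 0.
Proof. exact: raddf0. Qed.

Lemma counit_ugM x (u : U G) : counit (ug x * u) = 0.
Proof. by rewrite rmorphM /= counit_ug mul0r. Qed.

Lemma uact_trivial u v : (forall x, r x v = 0) -> uact r u v = counit u *: v.
Proof.
move=> rv; elim/uword_ind: u => [|a u u' IH IH'|w].
- by rewrite uact0l counit0 scale0r.
- by rewrite uact_linearl counitP IH IH' scalerDl scalerA.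
elim: w => [|x w IH]; first by rewrite uword_nil uact1 rmorph1 scale1r.
have r0 c : r x (c *: v) = 0.
  have := rep_linearr r x c v 0; rewrite rv scaler0 addr0 add0r => ->.
  exact: (linear0 (to_linear (rep_linearr r x))).
by rewrite uword_cons counit_ugM scale0r uactM uact_ug IH r0.
Qed.

End ActionLemmas.

Lemma uact_equivariant (k : fieldType) (G : lieAlgType k) (V V' : lmodType k)
  (r : lie_rep G V) (r' : lie_rep G V') (f : {linear V -> V'}) :
  (forall x v, f (r x v) = r' x (f v)) -> forall u v, f (uact r u v) = uact r' u (f v).
Proof.
move=> fr u v; elim/uword_ind: u v => [|a u u' IH IH'|w] v.
- by rewrite !uact0l linear0.
- by rewrite !uact_linearl linearP IH IH'.
elim: w v => [|x w IH] v; first by rewrite uword_nil !uact1.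
by rewrite uword_cons !uactM !uact_ug fr IH.
Qed.

Section QuotientLift.
Variables (R : pzRingType) (V V' : lmodType R) (W : submodule V) (f : {linear V -> V'}).
Hypothesis fW : forall x, x \in W -> f x = 0.

Definition qlift (x : quotm W) : V' := f (repr x).

Lemma qlift_qmod x : qlift (qmod W x) = f x.
Proof.
apply/eqP; rewrite -subr_eq0 -linearB; apply/eqP/fW.
by rewrite -qmod_eq qmod_repr.
Qed.

Lemma qlift_linear : linear qlift.
Proof.
move=> a x y; rewrite -[x]qmod_repr -[y]qmod_repr.
have -> : a *: qmod W (repr x) + qmod W (repr y) = qmod W (a *: repr x + repr y).
  by apply/esym/linearP.
by rewrite !qlift_qmod linearP.
Qed.

End QuotientLift.

Section TensorLemmas.
Variables (k : fieldType) (A : algType k) (M : lmodType A^c) (N : lmodType A).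

Lemma tensDr (m : M) (n n' : N) : tens m (n + n') = tens m n + tens m n'.
Proof.
rewrite /tens -(qmodD (span (@tens_rel k A M N)) << (m, n) >> << (m, n') >>).
by apply: tens_relE; apply: TensDr.
Qed.

Lemma tensDl (m m' : M) (n : N) : tens (m + m') n = tens m n + tens m' n.
Proof.
rewrite /tens -(qmodD (span (@tens_rel k A M N)) << (m, n) >> << (m', n) >>).
by apply: tens_relE; apply: TensDl.
Qed.

Lemma tens0r (m : M) : tens m (0 : N) = 0.
Proof. by apply: (addIr (tens m 0)); rewrite -tensDr !add0r. Qed.

Lemma tens0l (n : N) : tens (0 : M) n = 0.
Proof. by apply: (addIr (tens 0 n)); rewrite -tensDl !add0r. Qed.

Lemma tens_bal (m : M) (a : A) (n : N) : tens m (a *: n) = tens ((a : A^c) *: m) n.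
Proof. by apply/esym/tens_relE; apply: TensBal. Qed.

Lemma tensZ (c : k) (m : M) (n : N) : tens m (c%:A *: n) = c *: tens m n.
Proof.
have -> : c *: tens m n = qmod (span (@tens_rel k A M N)) (c *: << (m, n) >>).
  by apply/esym/linearZ.
by apply: tens_relE; apply: TensZ.
Qed.

Section TensorLift.
Variables (V : lmodType k) (f : M -> N -> V).
Hypothesis fDl : forall m m' n, f (m + m') n = f m n + f m' n.
Hypothesis fDr : forall m n n', f m (n + n') = f m n + f m n'.
Hypothesis fbal : forall m (a : A) n, f ((a : A^c) *: m) n = f m (a *: n).
Hypothesis fZ : forall (c : k) m n, f m (c%:A *: n) = c *: f m n.

Lemma tens_lift_exists : exists g : {linear tensor M N -> V},
  forall m n, g (tens m n) = f m n.
Proof.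
pose g0 : {linear {malg k[(M * N)%type]} -> V} := malg_lift (fun p => f p.1 p.2).
have g0U m n : g0 << (m, n) >> = f m n by rewrite /g0 /= malg_liftU.
have g0W x : x \in span (@tens_rel k A M N) -> g0 x = 0.
  have WP : submod_closed (fun v => g0 v == 0).
    split=> [|a v w /eqP v0 /eqP w0]; apply/eqP; first exact: linear0.
    by rewrite linearP v0 w0 scaler0 addr0.
  move=> xS; apply/eqP; apply: (span_min (W := SubModule WP) _ xS) => {x xS}.
  move=> _ [m m' n|m n n'|m a n|c m n]; rewrite -[_ \in _]/(_ == 0);
    rewrite linearB subr_eq0 ?linearD ?linearZ !g0U.
  - by rewrite fDl.
  - by rewrite fDr.
  - by rewrite fbal.
  - by rewrite fZ.
exists (to_linear (qlift_linear g0W)) => m n.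
exact: etrans (qlift_qmod g0W _) (g0U m n).
Qed.

End TensorLift.
End TensorLemmas.

Section CornerRepresentation.
Variables (k : fieldType) (L : lieAlgType k) (S : lieIdeal L) (A : algType k).

(* rho is an upper triangular representation: E kills the first row of a matrix
   and F its last column, so that rho S only has its top right corner. *)
Record corner_rep := CornerRep {
  corner_map :> L -> A;
  corner_linear : linear corner_map;
  corner_lie : forall a b,
    corner_map (lie a b) = corner_map a * corner_map b - corner_map b * corner_map a;
  corner_E : A;
  corner_F : A;
  corner_mulE : forall a, corner_map a * corner_E = corner_map a;
  corner_Fmul : forall a, corner_F * corner_map a = corner_map a;
  corner_Emul : forall s, s \in S -> corner_E * corner_map s = 0;
  corner_mulF : forall s, s \in S -> corner_map s * corner_F = 0 }.

HB.instance Definition _ (rho : corner_rep) :=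
  GRing.isLinear.Build k L A *:%R rho (corner_linear rho).

Definition finite_image (f : L -> A) :=
  exists (n : nat) (v : 'I_n -> A), forall s, s \in S ->
    exists c : 'I_n -> k, f s = \sum_(i < n) c i *: v i.

(** Inserting [E] in [rho a * rho s] and [F] in [rho s * rho a] changes neither product and makes
    both vanish. *)
Lemma corner_lie0l (rho : corner_rep) a s : s \in S -> rho (lie a s) = 0.
Proof.
move=> Ss; rewrite corner_lie -{1}(corner_mulE rho a) -mulrA corner_Emul // mulr0 sub0r.
by rewrite -(corner_Fmul rho a) mulrA corner_mulF // mul0r oppr0.
Qed.

End CornerRepresentation.

Section CornerModules.
Variables (k : fieldType) (L : lieAlgType k) (S : lieIdeal L) (A : algType k).
Variable rho : corner_rep S A.
Local Notation G := (quotl S).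
Local Notation E := (corner_E rho).
Local Notation F := (corner_F rho).
Local Notation q := (qmod S : L -> G).

Lemma rhoF_eq a b : q a = q b -> rho a * F = rho b * F.
Proof.
move/eqP; rewrite qmod_eq => /(corner_mulF rho); rewrite linearB /= mulrBl.
by move/eqP; rewrite subr_eq0 => /eqP.
Qed.

Lemma Erho_eq a b : q a = q b -> E * rho a = E * rho b.
Proof.
move/eqP; rewrite qmod_eq => /(corner_Emul rho); rewrite linearB /= mulrBr.
by move/eqP; rewrite subr_eq0 => /eqP.
Qed.

(** [rho] does not descend to [L/S], but it does once the last column is deleted by [F], or the
    first row by [E], since this kills [rho S]. *)
Definition act1 (g : G) (v : A) : A := rho (repr g) * F * v.
Definition act2 (g : G) (v : A) : A := E * rho (repr g) * v.

Lemma act1_q a v : act1 (q a) v = rho a * F * v.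
Proof. by rewrite /act1; congr (_ * _); apply: rhoF_eq; rewrite qmod_repr. Qed.

Lemma act2_q a v : act2 (q a) v = E * rho a * v.
Proof. by rewrite /act2; congr (_ * _); apply: Erho_eq; rewrite qmod_repr. Qed.

Lemma act1_linearl v : linear (act1^~ v).
Proof.
move=> a x y; rewrite -[x]qmod_repr -[y]qmod_repr.
have -> : a *: q (repr x) + q (repr y) = q (a *: repr x + repr y) by apply/esym/linearP.
by rewrite !act1_q linearP /= !mulrDl -!scalerAl.
Qed.

Lemma act2_linearl v : linear (act2^~ v).
Proof.
move=> a x y; rewrite -[x]qmod_repr -[y]qmod_repr.
have -> : a *: q (repr x) + q (repr y) = q (a *: repr x + repr y) by apply/esym/linearP.
by rewrite !act2_q linearP /= mulrDr mulrDl -scalerAr -scalerAl.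
Qed.

Lemma act1_linearr x : linear (act1 x).
Proof. by move=> a u v; rewrite /act1 mulrDr -scalerAr. Qed.

Lemma act2_linearr x : linear (act2 x).
Proof. by move=> a u v; rewrite /act2 mulrDr -scalerAr. Qed.

Lemma q_lie a b : lie (q a) (q b) = q (lie a b).
Proof. exact: qmod_lie. Qed.

Lemma act1_lie x y v : act1 (lie x y) v = act1 x (act1 y v) - act1 y (act1 x v).
Proof.
have e a b : rho a * F * rho b = rho a * rho b by rewrite -mulrA corner_Fmul.
rewrite -[x]qmod_repr -[y]qmod_repr q_lie !act1_q corner_lie !mulrBl.
by rewrite !mulrA !e.
Qed.

Lemma act2_lie x y v : act2 (lie x y) v = act2 x (act2 y v) - act2 y (act2 x v).
Proof.
have e a b : E * rho a * E * rho b = E * rho a * rho b.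
  by rewrite -(mulrA E) corner_mulE.
rewrite -[x]qmod_repr -[y]qmod_repr q_lie !act2_q corner_lie mulrBr !mulrBl.
by rewrite !mulrA !e.
Qed.

Definition rep1 := LieRep act1_linearl act1_linearr act1_lie.
Definition rep2 := LieRep act2_linearl act2_linearr act2_lie.

(** It is equivariant from [rep1] to [rep2], and [L/S] acts as 0 on its kernel. Obstructions to
    lifting through it therefore have trivial coefficients. *)
Definition proj (v : A) : A := E * F * v.

Lemma proj_linear : linear proj.
Proof. by move=> a u v; rewrite /proj mulrDr -scalerAr. Qed.
HB.instance Definition _ := GRing.isLinear.Build k A A *:%R proj proj_linear.

Lemma proj_act x v : proj (rep1 x v) = rep2 x (proj v).
Proof.
rewrite /= /act1 /act2 /proj !mulrA -[in RHS](mulrA E) corner_mulE.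
by rewrite -[in LHS](mulrA E) corner_Fmul.
Qed.

Lemma proj_ker x v : proj v = 0 -> rep1 x v = 0.
Proof.
rewrite /proj => EF0; rewrite /= /act1 -(corner_mulE rho) -!mulrA.
by rewrite [E * _]mulrA EF0 mulr0.
Qed.

(** A generator [x] sends 1 to [E * rho x], which is [proj (rho x)] because [F * rho x = rho x].
    Only the augmentation escapes the image of [proj], so lifting is possible on the first
    syzygy. *)
Lemma unit_act u : exists v, uact rep2 u 1 = counit u *: 1 + proj v.
Proof.
elim/uword_ind: u => [|a u u' [v ev] [v' ev']|w].
- by exists 0; rewrite uact0l counit0 scale0r linear0 addr0.
- exists (a *: v + v'); rewrite uact_linearl counitP ev ev' proj_linear.
  by rewrite scalerDl scalerDr scalerA addrACA.
elim: w => [|x w [v ev]].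
  by exists 0; rewrite uword_nil uact1 rmorph1 scale1r linear0 addr0.
exists (counit (uword w) *: rho (repr x) + rep1 x v).
rewrite uword_cons uactM uact_ug ev counit_ugM scale0r add0r proj_linear proj_act.
rewrite (rep_linearr rep2) //=; congr (_ *: _ + _).
by rewrite /act2 /proj mulr1 -mulrA corner_Fmul.
Qed.

End CornerModules.

Lemma scale_lin (R : pzRingType) (V : lmodType R) (c u v : R) (x : V) :
  c *: (u *: x) + v *: x = (c * u + v) *: x.
Proof. by rewrite scalerA scalerDl. Qed.

Lemma ug_scalar (k : fieldType) (G : lieAlgType k) a (x : G) : ug (a *: x) = a%:A * ug x.
Proof. by rewrite ugZ -uscalerAl mul1r. Qed.

Lemma ugD (k : fieldType) (G : lieAlgType k) (x y : G) : ug (x + y) = ug x + ug y.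
Proof. by rewrite -[x]scale1r ugP !scale1r. Qed.

Lemma scale_comm (R : pzRingType) (V : lmodType R) (u v : R) (x : V) :
  u *: (v *: x) - v *: (u *: x) = (u * v - v * u) *: x.
Proof. by rewrite !scalerA scalerBl. Qed.

Lemma lin2 (R : pzRingType) (V V' : lmodType R) (f : {linear V -> V'}) u v x y :
  f (u *: x - v *: y) = u *: f x - v *: f y.
Proof. by rewrite linearB !linearZ. Qed.

Lemma malg_lift2 (R : nzRingType) (K : choiceType) (V : lmodType R) (f : K -> V) u v x y :
  malg_lift f (u *: << x >> - v *: << y >>) = u *: f x - v *: f y.
Proof. by rewrite linearB !linearZ /= !malg_liftU. Qed.

Lemma free_coverU (k : fieldType) (A : algType k) (V : lmodType A) (x : V) :
  free_cover V << x >> = x.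
Proof. exact: malg_liftU. Qed.

Lemma homology_fg_image (k : fieldType) (V2 V1 V0 V : lmodType k)
  (d2 : {linear V2 -> V1}) (d1 : {linear V1 -> V0}) (psi : {linear V1 -> V}) :
  (forall t, psi (d2 t) = 0) -> fg_module (homology d2 d1) ->
  exists n (v : 'I_n -> V), forall z, d1 z = 0 ->
    exists c : 'I_n -> k, psi z = \sum_(i < n) c i *: v i.
Proof.
move=> psid2 [n [b bP]]; exists n, (fun i => psi (@ker_val _ _ _ d1 (repr (b i)))) => y y0.
pose z : kernel d1 := Kernel (introT eqP y0).
have [c cz] := bP (qmod _ z); exists c.
have : z - \sum_(i < n) c i *: repr (b i) \in SubModule (boundary_submod_closed d2 d1).
  rewrite -qmod_eq cz linear_sum; apply/eqP/eq_bigr => i _.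
  by rewrite linearZ /= qmod_repr.
move/asboolP => [t et]; have := congr1 psi et; rewrite psid2.
pose f : {linear kernel d1 -> V} := psi \o @ker_val _ _ _ d1.
rewrite -[LHS]/(f _) linearB => /eqP; rewrite subr_eq0 -[f z]/(psi y) => /eqP ->.
by rewrite linear_sum; apply: eq_bigr => i _; rewrite linearZ.
Qed.

(** * From second homology to the image of the corner *)

Section HomologyBound.
Variables (k : fieldType) (L : lieAlgType k) (S : lieIdeal L) (A : algType k).
Variable rho : corner_rep S A.
Local Notation G := (quotl S).
Local Notation E := (corner_E rho).
Local Notation F := (corner_F rho).
Local Notation q := (qmod S : L -> G).
Local Notation N := (trivl G).
Local Notation V1 := (repmod (rep1 rho)).
Local Notation V2 := (repmod (rep2 rho)).
Local Notation pi := (proj rho).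
Local Notation kv := (@ker_val _ _ _ (free_cover N)).

Lemma proj_uact (u : U G) (v : V1) : pi (u *: v) = u *: (pi v : V2).
Proof.
rewrite !uactE; apply: (uact_equivariant (f := pi)) => x w.
exact: proj_act.
Qed.

(* kappa sends 1 to 1 in degree 0 of the resolution, and lam lifts it through
   proj : V1 -> V2 on the first syzygy.  On boundaries K1, the extension of lam,
   takes values in ker proj, on which L/S acts trivially: this is the 2-cocycle
   detecting rho S. *)
Definition kappa : {linear res N 0 -> V2} := malg_lift (fun c : N => (c : k)%:A : V2).

Lemma proj0 : pi 0 = 0.
Proof. by rewrite /proj mulr0. Qed.

Lemma projD u v : pi (u + v) = pi u + pi v.
Proof. by rewrite /proj mulrDr. Qed.

Lemma kappaE (z : res N 0) :
  exists v : A, kappa z = pi v + (free_cover N z : k)%:A.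
Proof.
elim/malg_ind: z => [|u z z' [v ev] [v' ev']|c].
- by exists 0; rewrite !linear0 scale0r addr0 ?proj0.
- have [w ew] := unit_act rho u.
  exists (uact (rep1 rho) u v + ((free_cover N z : k) *: w + v')).
  have -> : kappa (u *: z + z') = uact (rep2 rho) u (kappa z) + kappa z'.
    exact: linearP.
  have -> : free_cover N (u *: z + z') = counit u * (free_cover N z : k) + (free_cover N z' : k) :> k.
    exact: linearP.
  rewrite ev ev'; move: (free_cover N z : k) (free_cover N z' : k) => c c'.
  have -> : uact (rep2 rho) u (pi v + c%:A) = pi (uact (rep1 rho) u v) + c *: (counit u *: 1 + pi w).
    rewrite -ew addrC uact_linearr addrC; congr (_ + _).
    by apply/esym/(uact_equivariant (f := pi)) => x t; apply: proj_act.
  rewrite projD (proj_linear rho c w v') scalerDr scalerDl scalerA [c * _]mulrC.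
  by rewrite -!addrA; congr (_ + _); rewrite addrCA; congr (_ + _); rewrite addrCA.
- exists 0; rewrite proj0 add0r /kappa /= malg_liftU.
  by congr (_ *: _); rewrite /free_cover malg_liftU.
Qed.

Lemma lift_exists : exists lam : syzygy N 1 -> V1, forall s, pi (lam s) = kappa (kv s).
Proof.
suff H (s : syzygy N 1) : exists v : V1, pi v == kappa (kv s).
  by have [lam lamP] := choice H; exists lam => s; apply/eqP.
have [v ->] := kappaE (kv s); exists v.
case: s => s /= /eqP ->. by rewrite -[X in _ == _ + X]/((0 : k)%:A) scale0r addr0.
Qed.

Definition tens1 n (y : res N n) : tensor (trivr G) (res N n) :=
  @tens k (U G) (trivr G) (res N n) ((1 : k) : trivr G) y.

Lemma tens1_ug n x (y : res N n) : tens1 (ug x *: y) = 0.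
Proof.
rewrite /tens1 tens_bal.
have -> : (ug x : (U G)^c) *: ((1 : k) : trivr G) = 0.
  by rewrite -[LHS]/(counit (ug x) * 1) counit_ug mul0r.
exact: tens0l.
Qed.

Lemma tens1_ug2 n x x' (y y' : res N n) : tens1 (ug x *: y - ug x' *: y') = 0.
Proof.
rewrite -scalerN; move: (- y') => z.
transitivity (tens1 (ug x *: y) + tens1 (ug x' *: z)); first exact: tensDr.
exact: etrans (congr2 +%R (tens1_ug x y) (tens1_ug x' z)) (addr0 _).
Qed.

Lemma tens1_lin n c (y y' : res N n) : tens1 (c%:A *: y + y') = c *: tens1 y + tens1 y'.
Proof. by rewrite /tens1 tensDr tensZ. Qed.

Lemma uact_scalar (V : lmodType k) (r : lie_rep G V) c v : uact r c%:A v = c *: v.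
Proof. by rewrite uactZ uact1. Qed.

Lemma eps_proof (g : G) : free_cover N (ug g *: << (1 : k) : N >>) == 0.
Proof.
have -> : free_cover N (ug g *: << (1 : k) : N >>) = counit (ug g) * 1 :> k.
  by rewrite linearZ /= /free_cover malg_liftU.
by rewrite counit_ug mul0r.
Qed.

(** It stands for [g] in the augmentation ideal. The resolution begins with the free module on the
    set [k], of which only the basis element of 1 is used here. *)
Definition eps (g : G) : syzygy N 1 := Kernel (eps_proof g).

Section Lifted.
Variable lam : syzygy N 1 -> V1.
Hypothesis lamP : forall s, pi (lam s) = kappa (kv s).

Definition K1 : {linear res N 1 -> V1} := malg_lift lam.

Lemma proj_K1 (y : res N 1) : pi (K1 y) = kappa (kv (free_cover (syzygy N 1) y)).
Proof.
elim/malg_ind: y => [|u y y' IH IH'|s].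
- by rewrite !linear0 ?proj0.
- have e1 : K1 (u *: y + y') = u *: K1 y + K1 y' by apply: linearP.
  have e2 : kappa (kv (free_cover (syzygy N 1) (u *: y + y'))) =
    u *: kappa (kv (free_cover (syzygy N 1) y)) +
    kappa (kv (free_cover (syzygy N 1) y')) by rewrite !linearP.
  rewrite e1 e2 -IH -IH' projD; congr (_ + _); exact: proj_uact.
- by rewrite /K1 /= !malg_liftU lamP.
Qed.

Lemma kappa_eps a : kappa (kv (eps (q a))) = pi (rho a).
Proof.
have -> : kappa (kv (eps (q a))) = uact (rep2 rho) (ug (q a)) (1 : k)%:A.
  by rewrite /eps /= linearZ /= /kappa malg_liftU.
rewrite uact_ug /= act2_q scale1r mulr1 /proj -mulrA.
by rewrite corner_Fmul.
Qed.

(** The lift [lam (eps (q b))] and [rho b] have the same image under [proj], so their difference is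
    killed by the action, whichever lift was chosen. *)
Lemma act_lam_eps a b : ug (q a) *: lam (eps (q b)) = rho a * rho b :> A.
Proof.
rewrite uactE uact_ug /=.
have -> : lam (eps (q b)) = rho b + (lam (eps (q b)) - rho b) :> A by rewrite addrC subrK.
have := rep_linearr (rep1 rho) (q a) 1 (rho b) (lam (eps (q b)) - rho b).
rewrite !scale1r /= => ->; rewrite [X in _ + X](_ : _ = 0).
  by rewrite addr0 act1_q -mulrA corner_Fmul.
apply: proj_ker; rewrite /proj mulrBr.
by rewrite -!/(pi _) lamP kappa_eps subrr.
Qed.

(** Hopf's formula on chains: a bracket of [a] and [b] is represented by [a eps(b) - b eps(a)],
    which dies after tensoring with the trivial module. When [s] is in [S], [ug (q s) = 0] and [y]
    lies in the second syzygy, so it gives a cycle of degree 2. *)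
Lemma cycle_exists (s : L) : s \in lie_span predT predT ->
  exists y : res N 1, [/\ kv (free_cover (syzygy N 1) y) = ug (q s) *: << (1 : k) : N >>,
    tens1 y = 0 & K1 y = rho s].
Proof.
pose P s := `[< exists y : res N 1, [/\ kv (free_cover (syzygy N 1) y) = ug (q s) *: << (1 : k) : N >>,
    tens1 y = 0 & K1 y = rho s] >].
have WP : submod_closed P.
  split=> [|a s1 s2 /asboolP[y1 [f1 t1 r1]] /asboolP[y2 [f2 t2 r2]]]; apply/asboolP.
    exists 0; split; rewrite ?linear0 ?ug0 ?scale0r //.
    by rewrite /tens1 tens0r.
  exists (a%:A *: y1 + y2); split.
  - have -> : kv (free_cover (syzygy N 1) (a%:A *: y1 + y2))
      = a%:A *: kv (free_cover (syzygy N 1) y1) + kv (free_cover (syzygy N 1) y2).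
      by rewrite !linearP.
    have -> : ug (q (a *: s1 + s2)) = a%:A * ug (q s1) + ug (q s2).
      rewrite -ug_scalar -ugD; congr ug; exact: qmod_is_linear.
    by rewrite f1 f2; apply: scale_lin.
  - by rewrite tens1_lin t1 t2 scaler0 addr0.
  - have -> : K1 (a%:A *: y1 + y2) = uact (rep1 rho) a%:A (K1 y1) + K1 y2 by apply: linearP.
    by rewrite r1 r2 uact_scalar linearP.
move=> sL; suff /asboolP : s \in SubModule WP by [].
apply: (span_min _ sL) => {s sL} _ [a [b [_ _ ->]]]; apply/asboolP.
exists (ug (q a) *: << eps (q b) >> - ug (q b) *: << eps (q a) >>); split.
- have -> : kv (free_cover (syzygy N 1)
     (ug (q a) *: << eps (q b) >> - ug (q b) *: << eps (q a) >>))
   = ug (q a) *: kv (eps (q b)) - ug (q b) *: kv (eps (q a)).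
    transitivity (kv (ug (q a) *: eps (q b) - ug (q b) *: eps (q a) : syzygy N 1)).
      congr (kv _); exact: malg_lift2.
    exact: (@lin2 _ _ _ (@ker_val _ _ _ (free_cover N) : {linear syzygy N 1 -> res N 0})).
  by rewrite -q_lie ug_lie; apply: scale_comm.
- exact: tens1_ug2.
- have -> : K1 (ug (q a) *: << eps (q b) >> - ug (q b) *: << eps (q a) >>)
   = ug (q a) *: lam (eps (q b)) - ug (q b) *: lam (eps (q a)).
    exact: malg_lift2.
  rewrite corner_lie -!act_lam_eps. by [].
Qed.

Lemma K1_res3 (y : res N 3) : K1 (res_d N 2 (res_d N 3 y)) = 0.
Proof.
have -> : res_d N 2 (res_d N 3 y) = 0.
  rewrite /= ; set z := free_cover _ y.
  by case: z => z /= /eqP ->; rewrite linear0.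
exact: linear0.
Qed.

Lemma uact_K1_res2 u (y : res N 2) :
  u *: K1 (res_d N 2 y) = counit u *: (K1 (res_d N 2 y) : A) :> A.
Proof.
apply: uact_trivial => x; apply: proj_ker; rewrite proj_K1.
have -> : free_cover (syzygy N 1) (res_d N 2 y) = 0.
  by rewrite /=; case: (free_cover _ y) => z /= /eqP.
by rewrite !linear0.
Qed.

Lemma psi_exists : exists psi : {linear tensor (trivr G) (res N 2) -> A},
  forall (c : trivr G) y, psi (tens c y) = (c : k) *: (K1 (res_d N 2 y) : A).
Proof.
apply: tens_lift_exists.
- by move=> c c' y; apply: scalerDl.
- move=> c y y'.
  have -> : K1 (res_d N 2 (y + y')) = K1 (res_d N 2 y) + K1 (res_d N 2 y') by rewrite !linearD.
  exact: scalerDr.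
- move=> c u y; have -> : K1 (res_d N 2 (u *: y)) = u *: K1 (res_d N 2 y) by rewrite !linearZ.
  rewrite uact_K1_res2 scalerA; congr (_ *: _).
  by rewrite mulrC.
- move=> a c y.
  have -> : K1 (res_d N 2 (a%:A *: y)) = a%:A *: K1 (res_d N 2 y) by rewrite !linearZ.
  by rewrite uactE uact_scalar !scalerA mulrC.
Qed.

Lemma tor_finite_image_lift :
  (forall s, s \in S -> s \in lie_span predT predT) ->
  fg_module (lie_homology 2 G) -> finite_image S rho.
Proof.
move=> SL fgH.
have [psi psiP] := psi_exists.
pose d2 := @tens_map k (U G) (trivr G) _ _ (res_d N 2).
pose d3 := @tens_map k (U G) (trivr G) _ _ (res_d N 3).
have psid3 t : psi (d3 t) = 0.
  pose f : {linear {malg k[(trivr G * res N 3)%type]} -> A} :=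
    psi \o d3 \o qmod (span (@tens_rel k (U G) (trivr G) (res N 3))).
  rewrite -[t]qmod_repr -[LHS]/(f (repr t)).
  elim/malg_ind: (repr t) => [|a u v IHu IHv|[c y]].
  - exact: linear0.
  - by rewrite linearP IHu IHv scaler0 addr0.
  - have e : d3 (tens c y) = tens c (res_d N 3 y) by apply: tens_mapE.
    transitivity (psi (tens c (res_d N 3 y))); first by congr (psi _).
    by rewrite psiP K1_res3 scaler0.
have [n [v vP]] := homology_fg_image psid3 fgH.
exists n, v => s Ss.
have [y [fy ty Ky]] := cycle_exists (SL s Ss).
have y0 : free_cover (syzygy N 1) y == 0.
  apply/eqP/val_inj; rewrite -[val _]/(kv _) fy.
  have -> : q s = 0 by apply/eqP; rewrite -[0](linear0 (qmod S)) qmod_eq subr0.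
  by rewrite ug0 scale0r.
pose w : syzygy N 2 := Kernel y0.
have ry : res_d N 2 << w >> = y.
  by rewrite -[LHS]/(@ker_val _ _ _ (free_cover (syzygy N 1)) (free_cover (syzygy N 2) << w >>)) free_coverU.
have z0 : d2 (tens1 (n := 2) << w >>) = 0.
  have -> : d2 (tens1 (n := 2) << w >>) = tens1 (res_d N 2 << w >>) by apply: tens_mapE.
  by rewrite ry ty.
have [c cz] := vP _ z0; exists c; rewrite -cz.
by rewrite /tens1 psiP scale1r ry Ky.
Qed.

End Lifted.

Theorem tor_finite_image :
  (forall s, s \in S -> s \in lie_span predT predT) ->
  fg_module (lie_homology 2 G) -> finite_image S rho.
Proof. by have [lam lamP] := lift_exists; apply: tor_finite_image_lift lamP. Qed.

End HomologyBound.

(** * Corner representations and finite presentability *)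

Section LieHom.
Variables (k : comNzRingType).

Lemma lie_hom_id (L : lieAlgType k) : lie_hom (@id L).
Proof. by []. Qed.

Lemma lie_hom_comp (L M N : lieAlgType k) (f : M -> N) (g : L -> M) :
  lie_hom f -> lie_hom g -> lie_hom (f \o g).
Proof.
by move=> [lf mf] [lg mg]; split=> [a x y|x y] /=; rewrite ?lg ?lf ?mg ?mf.
Qed.

Lemma lie_hom_qmod (L : lieAlgType k) (S : lieIdeal L) :
  lie_hom (qmod S : L -> quotl S).
Proof. by split=> [|x y]; [apply: qmod_is_linear | rewrite -qmod_lie]. Qed.

Lemma lie_hom_inv (L M : lieAlgType k) (f : L -> M) (g : M -> L) :
  lie_hom f -> cancel f g -> cancel g f -> lie_hom g.
Proof.
move=> [lf mf] fK gK; split=> [a x y|x y]; apply: (can_inj fK).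
  by rewrite lf !gK.
by rewrite mf !gK.
Qed.

Lemma free_hom_eq (X : Type) (L : lieAlgType k) (i : X -> L) (M : lieAlgType k)
    (f g : L -> M) :
  free_lie_on i -> lie_hom f -> lie_hom g -> (forall x, f (i x) = g (i x)) -> f =1 g.
Proof.
move=> Lfree hf hg fg; have [h [_ _ hP]] := Lfree M (f \o i).
by move=> x; rewrite (hP f) // (hP g) // => y; rewrite -fg.
Qed.

End LieHom.

Section IdealImage.
Variables (k : comNzRingType) (L : lieAlgType k) (V : lmodType k) (f : {linear L -> V}).

(** Since [f] kills every bracket with [R], the elements of [R] whose image is a combination of the
    images of the generators form an ideal. *)
Lemma fg_ideal_image (R : lieIdeal L) (s : seq L) : ideal_generated_by (mem s) R ->
  (forall x y, y \in R -> f (lie x y) = 0) ->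
  forall x, x \in R -> exists c : 'I_(size s) -> k,
    f x = \sum_(i < size s) c i *: f (nth 0 s i).
Proof.
move=> [sR Rmin] fR x Rx.
pose P y := (y \in R) &&
  `[< exists c : 'I_(size s) -> k, f y = \sum_(i < size s) c i *: f (nth 0 s i) >].
have WP : submod_closed P.
  split=> [|a y z /andP[Ry /asboolP[c fy]] /andP[Rz /asboolP[d fz]]].
    apply/andP; split; first exact: rpred0.
    apply/asboolP; exists (fun=> 0); rewrite linear0 big1 // => i _.
    by rewrite scale0r.
  apply/andP; split; first by apply: rpredD => //; apply: rpredZ.
  apply/asboolP; exists (fun i => a * c i + d i).
  rewrite linearP fy fz scaler_sumr -big_split /=.
  by apply: eq_bigr => i _; rewrite scalerDl scalerA.
have WI y z : z \in SubModule WP -> lie y z \in SubModule WP.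
  move=> /andP[Rz _]; apply/andP; split; first exact: mem_lier.
  by apply/asboolP; exists (fun=> 0); rewrite fR // big1 // => j _; rewrite scale0r.
have /andP[_ /asboolP //] : x \in LieIdeal WI.
apply: Rmin Rx => y ys; apply/andP; split; first exact: sR.
move: ys; rewrite -[y \in _]/(y \in s) -index_mem => ys; apply/asboolP.
exists (fun i => (i == Ordinal ys)%:R).
rewrite (bigD1 (Ordinal ys)) //= eqxx scale1r nth_index -?index_mem //.
by rewrite big1 ?addr0 // => i /negPf ->; rewrite scale0r.
Qed.

End IdealImage.

Section FiniteImage.
Variables (k : fieldType) (L : lieAlgType k) (S : lieIdeal L) (A : algType k).
Variable rho : corner_rep S A.

Lemma fg_ideal_finite_image : fg_ideal S -> finite_image S rho.
Proof.
move=> [s sS]; exists (size s), (fun i => rho (nth 0 s i)) => x Sx.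
apply: (fg_ideal_image (f := rho) sS _ Sx) => y z; exact: corner_lie0l.
Qed.

Lemma finitely_presented_finite_image (X : Type) (i : X -> L) :
  free_lie_on i -> (forall s, s \in S -> s \in lie_span predT predT) ->
  finitely_presented (quotl S) -> finite_image S rho.
Proof.
move=> Lfree SL [n [F [j [R [Ffree [s sR] [f [hf [g fK gK]]]]]]]].
have hg := lie_hom_inv hf fK gK.
(* Freeness of [L] and of [F] lifts the isomorphism and its inverse to [psi] and [phi]. *)
have [psi [hpsi psii _]] := Lfree F (fun x => repr (f (qmod S (i x)))).
have [phi [hphi phij _]] := Ffree L (fun x => repr (g (qmod R (j x)))).
have psiE x : qmod R (psi x) = f (qmod S x).
  apply: (free_hom_eq Lfree (f := qmod R \o psi : L -> quotl R) (g := f \o qmod S)).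
  - exact: lie_hom_comp (lie_hom_qmod R) hpsi.
  - exact: lie_hom_comp hf (lie_hom_qmod S).
  - by move=> y /=; rewrite psii qmod_repr.
have phiE x : qmod S (phi x) = g (qmod R x).
  apply: (free_hom_eq Ffree (f := qmod S \o phi : F -> quotl S) (g := g \o qmod R)).
  - exact: lie_hom_comp (lie_hom_qmod S) hphi.
  - exact: lie_hom_comp hg (lie_hom_qmod R).
  - by move=> y /=; rewrite phij qmod_repr.
have f0 : f 0 = 0 by apply: (linear0 (to_linear hf.1)).
have g0 : g 0 = 0 by apply: (linear0 (to_linear hg.1)).
have mem_qmod (M : lieAlgType k) (J : lieIdeal M) x : (x \in J) = (qmod J x == 0).
  by rewrite -(linear0 (qmod J)) qmod_eq subr0.
have psiR x : x \in S -> psi x \in R.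
  by rewrite !mem_qmod psiE => /eqP ->; rewrite f0.
have phiS x : x \in R -> phi x \in S.
  by rewrite !mem_qmod phiE => /eqP ->; rewrite g0.
have back x : phi (psi x) - x \in S.
  by rewrite -qmod_eq phiE psiE fK.
have psi0 : psi 0 = 0 by apply: (linear0 (to_linear hpsi.1)).
have phi0 : phi 0 = 0 by apply: (linear0 (to_linear hphi.1)).
have lr : linear (rho \o phi) by move=> a x y /=; rewrite hphi.1 linearP.
(* [rho \o phi] kills all brackets with [R], because [phi] maps [R] into [S]. *)
have imR x : x \in R -> exists c : 'I_(size s) -> k,
    rho (phi x) = \sum_(t < size s) c t *: rho (phi (nth 0 s t)).
  apply: (fg_ideal_image (f := to_linear lr) sR) => y z Rz.
  by rewrite /= hphi.2 corner_lie0l // phiS.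
exists (size s), (fun t => rho (phi (nth 0 s t))) => x Sx.
have [c cx] := imR _ (psiR x Sx); exists c; rewrite -cx.
(* On brackets [rho \o phi \o psi] agrees with [rho]: [phi (psi a)] differs from [a] by an element
   of [S], whose image has zero product with every [rho b]. By [SL] this covers [S]. *)
have WP : submod_closed (fun y => `[< rho (phi (psi y)) = rho y >]).
  split=> [|a y z /asboolP ey /asboolP ez]; apply/asboolP.
    by rewrite psi0 phi0.
  by rewrite hpsi.1 hphi.1 !corner_linear ey ez.
suff /asboolP -> : x \in SubModule WP by [].
apply: (span_min _ (SL x Sx)) => _ [a [b [_ _ ->]]]; apply/asboolP.
rewrite hpsi.2 hphi.2.
have rhoS y z : rho (phi (psi y)) * rho (phi (psi z)) = rho y * rho z.
  have -> : phi (psi y) = y + (phi (psi y) - y) by rewrite addrC subrK.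
  have -> : phi (psi z) = z + (phi (psi z) - z) by rewrite addrC subrK.
  move: (_ - y) (back y) (_ - z) (back z) => u Su v Sv.
  have e1 w : rho u * rho w = 0.
    by rewrite -(corner_Fmul rho w) mulrA corner_mulF // mul0r.
  have e2 w : rho w * rho v = 0.
    by rewrite -(corner_mulE rho w) -mulrA corner_Emul // mulr0.
  by rewrite !linearD /= mulrDl !mulrDr e1 e2 e1 !addr0.
by rewrite !corner_lie !rhoS.
Qed.

End FiniteImage.

(** * Free Lie algebras and Fox derivatives *)

Definition commlie (k : comNzRingType) (A : algType k) : Type := A.

Section CommutatorLie.
Variables (k : comNzRingType) (A : algType k).

HB.instance Definition _ := GRing.Lmodule.copy (commlie A) A.

Definition commutator (x y : commlie A) : commlie A := (x : A) * (y : A) - (y : A) * (x : A).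

Lemma commutator_linearl y : linear (commutator^~ y).
Proof.
move=> a u v; rewrite /commutator mulrDl mulrDr opprD addrACA scalerBr.
by rewrite -scalerAl -scalerAr.
Qed.

Lemma commutator_linearr x : linear (commutator x).
Proof.
move=> a u v; rewrite /commutator mulrDl mulrDr opprD addrACA scalerBr.
by rewrite -scalerAl -scalerAr.
Qed.

Lemma commutatorxx x : commutator x x = 0.
Proof. exact: subrr. Qed.

Lemma commutator_jacobi x y z :
  commutator x (commutator y z) + commutator y (commutator z x)
  + commutator z (commutator x y) = 0.
Proof.
rewrite /commutator !mulrBr !mulrBl !mulrA !opprB.
set a := x * y * z; set b := x * z * y; set c := y * z * x.
set d := z * y * x; set e := y * x * z; set f := z * x * y.
rewrite !addrA [LHS](ACl ((1*12)*(7*2)*(3*10)*(5*4)*(11*6)*(9*8))) /=.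
by rewrite !subrr !addr0.
Qed.

HB.instance Definition _ := Lmodule_isLieAlgebra.Build k (commlie A)
  commutator_linearl commutator_linearr commutatorxx commutator_jacobi.

End CommutatorLie.

Section FreeLie.
Variables (k : comNzRingType) (X : Type) (L : lieAlgType k) (i : X -> L).
Hypothesis Lfree : free_lie_on i.

Lemma free_lie_alg_hom (A : algType k) (g : X -> A) :
  exists f : L -> A, [/\ linear f, forall a b, f (lie a b) = f a * f b - f b * f a
    & forall x, f (i x) = g x].
Proof.
by have [f [[lf mf] fi _]] := Lfree (g : X -> commlie A); exists f.
Qed.

Section Generation.
Variable W : submodule L.
Hypothesis W_lie : forall a b, a \in W -> b \in W -> lie a b \in W.

(** A subalgebra encoded as the kernel of a quotient map, which already is a module. *)
Definition sublie : Type := kernel (qmod W : {linear L -> quotm W}).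
HB.instance Definition _ := GRing.Lmodule.copy sublie (kernel (qmod W : {linear L -> quotm W})).
Definition sval (x : sublie) : L := @ker_val _ _ _ (qmod W : {linear L -> quotm W}) x.

Lemma mem_kernel x : (qmod W x == 0) = (x \in W).
Proof. by rewrite -(linear0 (qmod W)) qmod_eq subr0. Qed.

Lemma sublie_mem (x : sublie) : sval x \in W.
Proof. by rewrite -mem_kernel; case: x. Qed.

Lemma sub_lie_proof (x y : sublie) : qmod W (lie (sval x) (sval y)) == 0.
Proof. by rewrite mem_kernel W_lie // sublie_mem. Qed.

Definition sub_lie (x y : sublie) : sublie := Kernel (sub_lie_proof x y).

Lemma sval_inj : injective sval.
Proof. exact: val_inj. Qed.

Lemma sval_lin : linear sval.
Proof. by move=> a u v; apply: (linearP (@ker_val _ _ _ (qmod W : {linear L -> quotm W}))). Qed.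

Lemma sval0 : sval 0 = 0.
Proof. exact: (linear0 (@ker_val _ _ _ (qmod W : {linear L -> quotm W}))). Qed.

Lemma svalD u v : sval (u + v) = sval u + sval v.
Proof. exact: (linearD (@ker_val _ _ _ (qmod W : {linear L -> quotm W}))). Qed.

Lemma svalE x y : sval (sub_lie x y) = lie (sval x) (sval y).
Proof. by []. Qed.

Lemma sub_lie_linearl y : linear (sub_lie^~ y).
Proof. by move=> a u v; apply: sval_inj; rewrite sval_lin !svalE sval_lin lie_linearl. Qed.

Lemma sub_lie_linearr x : linear (sub_lie x).
Proof. by move=> a u v; apply: sval_inj; rewrite sval_lin !svalE sval_lin lie_linearr. Qed.

Lemma sub_liexx x : sub_lie x x = 0.
Proof. by apply: sval_inj; rewrite sval0 svalE liexx. Qed.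

Lemma sub_lie_jacobi x y z :
  sub_lie x (sub_lie y z) + sub_lie y (sub_lie z x) + sub_lie z (sub_lie x y) = 0.
Proof. by apply: sval_inj; rewrite sval0 !svalD !svalE lie_jacobi. Qed.

HB.instance Definition _ := Lmodule_isLieAlgebra.Build k sublie
  sub_lie_linearl sub_lie_linearr sub_liexx sub_lie_jacobi.

(** The homomorphism from [L] to the subalgebra [W], followed by the inclusion, fixes the
    generators, so it is the identity. *)
Lemma free_lie_generated : (forall x, i x \in W) -> forall a, a \in W.
Proof.
move=> iW a.
have iK x : qmod W (i x) == 0 by rewrite mem_kernel.
have [g [hg gi _]] := Lfree (fun x => Kernel (iK x) : sublie).
have -> : a = sval (g a).
  apply: (free_hom_eq Lfree (f := id) (g := sval \o g)) => //.
    by apply: lie_hom_comp hg; split=> // c x y; apply: sval_lin.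
  by move=> x /=; rewrite gi.
exact: sublie_mem.
Qed.

End Generation.
End FreeLie.

(* On {malg k[K]} itself an algType instance is only available for commutative
   K, hence this alias. *)
Definition free_alg (k : comNzRingType) (X : choiceType) : Type := {malg k[{fmonom X}]}.

HB.instance Definition _ (k : comNzRingType) (X : choiceType) :=
  GRing.Lalgebra.copy (free_alg k X) {malg k[{fmonom X}]}.

HB.instance Definition _ (k : comNzRingType) (X : choiceType) :=
  GRing.Lalgebra_isAlgebra.Build k (free_alg k X) (@malg_scalerAr {fmonom X} k).

(** * Free associative algebras and last-letter derivatives *)

Section FreeAlgebra.
Variables (k : fieldType) (X : choiceType).
Local Notation T := {malg k[{fmonom X}]}.

Definition tword (w : seq X) : T := << FMonom w >>.

Lemma twordM v w : tword v * tword w = tword (v ++ w).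
Proof. by rewrite /tword FMonom_cat malgUM. Qed.

Lemma tword_nil : tword [::] = 1.
Proof. by rewrite /tword FMonom_nil. Qed.

Lemma tword_ind (P : T -> Prop) :
  P 0 -> (forall a u v, P u -> P v -> P (a *: u + v)) ->
  (forall w, P (tword w)) -> forall t, P t.
Proof. by move=> P0 PD Pw; apply: malg_ind => // -[w]; apply: Pw. Qed.

Section Lift.
Variables (A : algType k) (g : X -> A).

Definition alg_lift : {linear T -> A} :=
  malg_lift (fun w : {fmonom X} => \prod_(x <- (w : seq X)) g x).

Lemma alg_lift_word w : alg_lift (tword w) = \prod_(x <- w) g x.
Proof. exact: malg_liftU. Qed.

Lemma alg_lift1 : alg_lift 1 = 1.
Proof. by rewrite -tword_nil alg_lift_word big_nil. Qed.

Lemma alg_liftM s t : alg_lift (s * t) = alg_lift s * alg_lift t.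
Proof.
elim/tword_ind: s => [|a s s' IH IH'|v].
- by rewrite mul0r linear0 mul0r.
- rewrite mulrDl -scalerAl !linearP mulrDl -scalerAl.
  by rewrite [X in _ *: X + _]IH [X in _ + X]IH'.
elim/tword_ind: t => [|a t t' IH IH'|w].
- by rewrite mulr0 linear0 mulr0.
- transitivity (a *: alg_lift (tword v * t) + alg_lift (tword v * t')).
    by rewrite mulrDr -(malg_scalerAr a _ t); apply: linearP.
  apply: etrans (congr2 (fun p p' => a *: p + p') IH IH') _.
  by rewrite linearP mulrDr -scalerAr.
by rewrite twordM !alg_lift_word big_cat.
Qed.

End Lift.

Definition last_deriv_word (x : X) (w : seq X) : T :=
  if rev w is y :: r then if y == x then tword (rev r) else 0 else 0.

(** A Fox derivative: every [t] is [aug t] plus the sum over [x] of the products of [last_deriv x t]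
    by the letter [x]. *)
Definition last_deriv (x : X) : {linear T -> T} :=
  malg_lift (fun w : {fmonom X} => last_deriv_word x w).

Lemma last_deriv_nil x : last_deriv x 1 = 0.
Proof. by rewrite -tword_nil [LHS]malg_liftU. Qed.

Lemma last_deriv_rcons x w y : last_deriv x (tword (rcons w y)) = (y == x)%:R *: tword w.
Proof.
rewrite [LHS]malg_liftU /last_deriv_word rev_rcons revK.
by case: (y == x); rewrite ?scale1r ?scale0r.
Qed.

Definition aug (t : T) : k := t@_mone.

Lemma augP a s t : aug (a *: s + t) = a * aug s + aug t.
Proof. by rewrite /aug mcoeffD mcoeffZ. Qed.

Lemma aug0 : aug 0 = 0.
Proof. exact: mcoeff0. Qed.

Lemma augM s t : aug (s * t) = aug s * aug t.
Proof. exact: (rmorphM (@mcoeff {fmonom X} k mone)). Qed.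

Lemma aug_rcons w y : aug (tword (rcons w y)) = 0.
Proof.
rewrite /aug /tword mcoeffU; case: eqP => // /(congr1 (@fdeg X)).
by rewrite fdeg1 /fdeg /= size_rcons.
Qed.

Lemma aug1 : aug 1 = 1.
Proof. by rewrite /aug mcoeff1 eqxx. Qed.

Lemma last_derivM x s t : last_deriv x (s * t) = s * last_deriv x t + aug t *: last_deriv x s.
Proof.
elim/tword_ind: t => [|a t t' IH IH'|w].
- by rewrite mulr0 !linear0 mulr0 aug0 scale0r addr0.
- transitivity (a *: last_deriv x (s * t) + last_deriv x (s * t')).
    by rewrite mulrDr -(malg_scalerAr a s t); apply: linearP.
  apply: etrans (congr2 (fun p p' => a *: p + p') IH IH') _.
  rewrite [X in _ = s * X + _]linearP mulrDr -(malg_scalerAr a s) augP scalerDl scalerDr scalerA.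
  by rewrite addrACA.
elim/last_ind: w => [|w y _].
  by rewrite tword_nil mulr1 last_deriv_nil mulr0 add0r aug1 scale1r.
rewrite aug_rcons scale0r addr0 last_deriv_rcons.
elim/tword_ind: s => [|a s s' IH IH'|v].
- by rewrite !mul0r linear0.
- rewrite mulrDl -scalerAl; transitivity (a *: last_deriv x (s * tword (rcons w y)) + last_deriv x (s' * tword (rcons w y))).
    exact: linearP.
  apply: etrans (congr2 (fun p p' => a *: p + p') IH IH') _.
  by rewrite mulrDl -scalerAl.
by rewrite twordM -rcons_cat last_deriv_rcons -malg_scalerAr twordM.
Qed.

(** Stripping letters from the right reduces every coefficient to the augmentation of an iterated
    derivative. *)
Lemma coef_rcons x w t : t@_(FMonom (rcons w x)) = (last_deriv x t)@_(FMonom w).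
Proof.
elim/tword_ind: t => [|a s t IH IH'|v].
- have -> : last_deriv x 0 = 0 by apply: linear0.
  by rewrite !mcoeff0.
- have -> : last_deriv x (a *: s + t) = a *: last_deriv x s + last_deriv x t by apply: linearP.
  by rewrite !mcoeffD !mcoeffZ IH IH'.
elim/last_ind: v => [|v y _].
  rewrite tword_nil last_deriv_nil mcoeff0 mcoeff1; case: eqP => // e.
  by have := aug_rcons w x; rewrite /aug -e /tword mcoeffUU => /eqP; rewrite oner_eq0.
rewrite last_deriv_rcons mcoeffZ /tword !mcoeffU.
have e (v' w' : seq X) : (FMonom v' == FMonom w') = (v' == w') by rewrite fmP.
by rewrite !e eqseq_rcons andbC; case: (y == x); rewrite ?mul1r ?mul0r.
Qed.

Lemma tword_eq0 (t : T) : (forall w, t@_(FMonom w) = 0) -> t = 0.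
Proof. by move=> t0; apply/malgP => -[w]; rewrite t0 mcoeff0. Qed.

End FreeAlgebra.

Lemma move_mulr (R : nzRingType) (t m x : R) :
  t * m * x = t * x * m + t * (m * x - x * m).
Proof. by rewrite mulrBr !mulrA addrC subrK. Qed.

Lemma sub_mul_split (R : nzRingType) (e p x w : R) :
  e * p - x * w = x * (p - w) + (e - x) * p.
Proof. by rewrite mulrBr mulrBl [RHS]addrC addrA subrK. Qed.

Lemma malg_sub_mem (R : nzRingType) (K : choiceType) (V : lmodType R) (W : submodule V)
    (h g : {linear {malg R[K]} -> V}) :
  (forall x, h << x >> - g << x >> \in W) -> forall t, h t - g t \in W.
Proof.
move=> hg; apply: malg_ind => [|a u v hu hv|//]; first by rewrite (linear0 h) (linear0 g) subrr rpred0.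
have -> : h (a *: u + v) - g (a *: u + v) = a *: (h u - g u) + (h v - g v).
  have eh : h (a *: u + v) = a *: h u + h v by apply: linearP.
  have eg : g (a *: u + v) = a *: g u + g v by apply: linearP.
  by rewrite eh eg opprD addrACA scalerBr.
by apply: rpredD => //; apply: rpredZ.
Qed.

Section FoxDerivative.
Variables (k : fieldType) (X : choiceType) (L : lieAlgType k) (i : X -> L).
Hypothesis Lfree : free_lie_on i.
Variable I : lieIdeal L.
Local Notation T := {malg k[{fmonom X}]}.
Local Notation Q := (quotl I).
Local Notation q := (qmod I : L -> Q).

Variable iota : L -> T.
Hypothesis iota_lin : linear iota.
Hypothesis iota_lie : forall a b, iota (lie a b) = iota a * iota b - iota b * iota a.
Hypothesis iota_i : forall x, iota (i x) = tword k [:: x].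

Lemma iota0 : iota 0 = 0.
Proof. exact: (linear0 (to_linear iota_lin)). Qed.

Lemma iotaB a b : iota (a - b) = iota a - iota b.
Proof. exact: (linearB (to_linear iota_lin)). Qed.

Lemma alg_lift_iota (G : lieAlgType k) (g : L -> G) : lie_hom g ->
  forall a, alg_lift (fun x => ug (g (i x))) (iota a) = ug (g a).
Proof.
move=> hg; set f := alg_lift _.
have fM := alg_liftM (fun x => ug (g (i x))).
apply: (free_hom_eq Lfree (M := commlie (U G)) (f := f \o iota) (g := ug (G := G) \o g)).
- split=> [a x y|x y] /=; first by rewrite iota_lin linearP.
  by rewrite iota_lie linearB /=; apply: congr2; rewrite fM.
- split=> [a x y|x y] /=; first by rewrite hg.1 ugP.
  by rewrite hg.2 ug_lie.
- by move=> x /=; rewrite iota_i /f alg_lift_word big_seq1.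
Qed.

(** The algebra map from [T] to [U L] sends [iota a] to [ug a], and [ug] is injective by
    Poincare-Birkhoff-Witt. *)
Lemma iota_inj : injective iota.
Proof.
move=> a b ab; apply: (@ug_inj k L).
by rewrite -!(alg_lift_iota (lie_hom_id L)) ab.
Qed.

Lemma aug_iota a : aug (iota a) = 0.
Proof.
have WP : submod_closed (fun a => aug (iota a) == 0).
  split=> [|c x y /eqP ax /eqP ay]; apply/eqP; first by rewrite iota0 aug0.
  by rewrite iota_lin augP ax ay mulr0 addr0.
apply/eqP; apply: (free_lie_generated Lfree (W := SubModule WP)) => [x y|x].
  move=> /eqP ax /eqP ay; apply/eqP; rewrite iota_lie -scaleN1r addrC augP.
  have e u v : aug (iota u) = 0 -> aug (iota u * iota v) = 0.
    by move=> u0; rewrite augM u0 mul0r.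
  by rewrite [X in _ * X + _]e // [X in _ + X]e // mulr0 addr0.
by apply/eqP; rewrite iota_i -[[:: x]]/(rcons [::] x) aug_rcons.
Qed.

Definition phi : {linear T -> U Q} := alg_lift (fun x => ug (q (i x))).

Lemma phiM s t : phi (s * t) = phi s * phi t.
Proof. exact: alg_liftM. Qed.

Lemma phi_iota a : phi (iota a) = ug (q a).
Proof. exact: alg_lift_iota (lie_hom_qmod I) a. Qed.

Definition fox x0 a := phi (last_deriv k x0 (iota a)).

Lemma fox_linear x0 : linear (fox x0).
Proof. by move=> c a b; rewrite /fox iota_lin !linearP. Qed.

Lemma fox_mul x0 a b : phi (last_deriv k x0 (iota a * iota b)) = ug (q a) * fox x0 b.
Proof. by rewrite last_derivM aug_iota scale0r addr0 phiM phi_iota. Qed.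

Lemma fox_lie x0 a b : fox x0 (lie a b) = ug (q a) * fox x0 b - ug (q b) * fox x0 a.
Proof.
rewrite -!fox_mul {1}/fox iota_lie.
by move: (iota a * iota b) (iota b * iota a) => u v; rewrite !linearB.
Qed.

Lemma fox_i x0 x : fox x0 (i x) = (x == x0)%:R.
Proof.
rewrite /fox iota_i -[[:: x]]/(rcons [::] x) last_deriv_rcons tword_nil.
by rewrite linearZ /= alg_lift1; case: (x == x0); rewrite ?scale1r ?scale0r.
Qed.

(* The left ideal of T generated by I, which is two-sided because I is an
   ideal of L, and is the kernel of T -> U Q. *)
Definition ideal_span : submodule T :=
  span (fun z => exists t m, m \in I /\ z = t * iota m).

Lemma ideal_span_mull s z : z \in ideal_span -> s * z \in ideal_span.
Proof.
have WP : submod_closed (fun z => s * z \in ideal_span).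
  split=> [|c x y xS yS].
    by rewrite -[_ \in _]/(s * 0 \in ideal_span) mulr0 rpred0.
  rewrite -[_ \in _]/(s * (c *: x + y) \in ideal_span) mulrDr -(malg_scalerAr c s x).
  by apply: rpredD; [apply: rpredZ; exact: xS | exact: yS].
apply: (span_min (W := SubModule WP)) => _ [t [m [Im ->]]].
rewrite -[_ \in _]/(s * (t * iota m) \in ideal_span) mulrA.
by apply: mem_span; exists (s * t), m.
Qed.

Lemma ideal_span_mulr s z : z \in ideal_span -> z * s \in ideal_span.
Proof.
elim/tword_ind: s z => [|c s s' IH IH'|w] z zS.
- by rewrite mulr0 rpred0.
- rewrite mulrDr -(malg_scalerAr c z s); apply: rpredD; last exact: IH'.
  exact/rpredZ/IH.
elim: w z zS => [|x w IH] z zS; first by rewrite tword_nil mulr1.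
rewrite -[x :: w]/([:: x] ++ w) -twordM mulrA; apply: IH.
have WP : submod_closed (fun z => z * tword k [:: x] \in ideal_span).
  split=> [|c u v uS vS].
    by rewrite -[_ \in _]/(0 * tword k [:: x] \in ideal_span) mul0r rpred0.
  rewrite -[_ \in _]/((c *: u + v) * tword k [:: x] \in ideal_span) mulrDl -scalerAl.
  by apply: rpredD; [apply: rpredZ; exact: uS | exact: vS].
apply: (span_min (W := SubModule WP) _ zS) => _ [t [m [Im ->]]].
rewrite -[_ \in _]/(t * iota m * tword k [:: x] \in ideal_span).
have -> : t * iota m * tword k [:: x] = t * tword k [:: x] * iota m + t * iota (lie m (i x)).
  by rewrite iota_lie iota_i; apply: move_mulr.
apply: rpredD; apply: mem_span; first by exists (t * tword k [:: x]), m.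
by exists t, (lie m (i x)); split=> //; apply: mem_liel.
Qed.

(** Choosing representatives of the letters gives a map [s] from words in [Q] to [T]. It sends the
    relations of [U Q] into [ideal_span], and it undoes the lift [lft] of [phi] modulo
    [ideal_span]. *)
Lemma ker_phi t : phi t = 0 -> t \in ideal_span.
Proof.
pose lft : {linear T -> free_alg k Q} :=
  alg_lift (A := free_alg k Q) (fun x => tword k [:: q (i x)]).
pose s : {linear {malg k[{fmonom Q}]} -> free_alg k X} :=
  alg_lift (A := free_alg k X) (fun g : Q => iota (repr g)).
have sM u v : s (u * v) = s u * s v by apply: alg_liftM.
have genE (g : Q) : gen g = tword k [:: g].
  by congr << _ >>; apply/eqP; rewrite fmP fmU.
have sg g : s (gen g) = iota (repr g) by rewrite genE /s alg_lift_word big_seq1.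
have iotaI m : m \in I -> iota m \in ideal_span.
  by move=> Im; apply: mem_span; exists 1, m; rewrite mul1r.
have phiE : phi t = upi (lft t).
  elim/tword_ind: (t) => [|c u v IHu IHv|w].
  - by rewrite (linear0 phi) (linear0 lft) (linear0 (@upi k Q)).
  - apply: etrans (linearP _ _ _ _) _.
    apply: etrans (congr2 (fun p p' => c *: p + p') IHu IHv) _.
    apply: etrans (esym (linearP (@upi k Q) _ _ _)) _.
    congr upi; exact/esym/linearP.
  rewrite [LHS]alg_lift_word [lft _]alg_lift_word.
  elim: w => [|x w IH]; first by rewrite !big_nil rmorph1.
  by rewrite !big_cons IH rmorphM /= -genE.
have sJ u : u \in env_ideal Q -> s u \in ideal_span.
  have WP : submod_closed (fun z => s z \in ideal_span).
    split=> [|c u' v uS vS].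
      by rewrite -[_ \in _]/(s 0 \in ideal_span) linear0 rpred0.
    rewrite -[_ \in _]/(s (c *: u' + v) \in ideal_span) linearP.
    by apply: rpredD; [apply: rpredZ; exact: uS | exact: vS].
  move=> /env_predP /(_ (SubModule WP)); apply.
    move=> a z zS; split.
      by rewrite -[_ \in _]/(s (a * z) \in ideal_span) sM; apply: ideal_span_mull.
    by rewrite -[_ \in _]/(s (z * a) \in ideal_span) sM; apply: ideal_span_mulr.
  move=> _ [a x y|x y].
    rewrite -[_ \in _]/(s (gen (a *: x + y) - (a *: gen x + gen y)) \in ideal_span).
    rewrite linearB linearP /= !sg -iota_lin -iotaB; apply: iotaI.
    by rewrite -qmod_eq qmod_repr qmod_is_linear !qmod_repr.
  rewrite -[_ \in _]/(s (gen (lie x y) - (gen x * gen y - gen y * gen x)) \in ideal_span).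
  have -> : s (gen (lie x y) - (gen x * gen y - gen y * gen x)) =
     iota (repr (lie x y)) - iota (lie (repr x) (repr y)).
    have sgg g h : s (gen g * gen h) = iota (repr g) * iota (repr h).
      by apply: etrans (sM _ _) _; congr (_ * _); apply: sg.
    rewrite iota_lie.
    transitivity (s (gen (lie x y)) - (s (gen x * gen y) - s (gen y * gen x))).
      by move: (gen x * gen y) (gen y * gen x) => u1 u2; rewrite !linearB.
    exact: (congr2 (fun u v => u - v) (sg _) (congr2 (fun u v => u - v) (sgg _ _) (sgg _ _))).
  rewrite -iotaB; apply: iotaI.
  by rewrite -qmod_eq qmod_repr -qmod_lie !qmod_repr.
have diff : s (lft t) - t \in ideal_span.
  apply: (malg_sub_mem (h := s \o lft) (g := idfun)) => -[w].
  change (s (lft (tword k w)) - tword k w \in ideal_span).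
  have liftw v : s (lft (tword k v)) = \prod_(x <- v) (iota (repr (q (i x))) : free_alg k X).
    rewrite /lft alg_lift_word; elim: v => [|x v IH].
      by rewrite !big_nil; apply: alg_lift1.
    by rewrite !big_cons [LHS]sM IH -genE sg.
  rewrite liftw {liftw}; elim: w => [|x w IH].
    by rewrite big_nil tword_nil -[X in X \in _]/((1 : T) - 1) subrr rpred0.
  rewrite big_cons -[x :: w]/([:: x] ++ w) -twordM.
  move: (\prod_(y <- w) _) IH => p pw.
  have -> : (iota (repr (q (i x))) : T) * p - tword k [:: x] * tword k w
    = tword k [:: x] * (p - tword k w) + (iota (repr (q (i x))) - tword k [:: x]) * p.
    exact: sub_mul_split.
  apply: rpredD; first exact: ideal_span_mull.
  apply: ideal_span_mulr; rewrite -iota_i -iotaB; apply: iotaI.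
  by rewrite -qmod_eq qmod_repr.
rewrite phiE => /eqP; rewrite -[0](linear0 (@upi k Q)) upi_eq subr0 => /sJ H.
by rewrite -(rpredBl _ H).
Qed.

(* If all Fox derivatives vanish on I, the ideal of T generated by I is stable
   under the last-letter derivatives; as it lies in the augmentation ideal, all
   coefficients of its elements vanish. *)
Theorem fox_neq0 : (exists2 m, m \in I & m != 0) ->
  exists x0 m, m \in I /\ fox x0 m != 0.
Proof.
move=> [m0 Im0 m00]; apply: contrapT => nf.
have fox0 x0 m : m \in I -> fox x0 m = 0.
  by move=> Im; apply: contrapT => /eqP fm; apply: nf; exists x0, m.
move/eqP: m00; apply; apply: iota_inj; rewrite iota0.
have stable x0 t : t \in ideal_span -> last_deriv k x0 t \in ideal_span.
  have WP : submod_closed (fun z => last_deriv k x0 z \in ideal_span).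
    split=> [|c u v uS vS].
      by rewrite -[_ \in _]/(last_deriv k x0 0 \in ideal_span) linear0 rpred0.
    rewrite -[_ \in _]/(last_deriv k x0 (c *: u + v) \in ideal_span) linearP.
    by apply: rpredD; [apply: rpredZ; exact: uS | exact: vS].
  apply: (span_min (W := SubModule WP)) => _ [s [m [Im ->]]].
  rewrite -[_ \in _]/(last_deriv k x0 (s * iota m) \in ideal_span).
  rewrite last_derivM aug_iota scale0r addr0; apply/ideal_span_mull/ker_phi.
  exact: fox0.
have aug_span t : t \in ideal_span -> aug t = 0.
  have WP : submod_closed (fun z : T => aug z == 0).
    split=> [|c x y /eqP ax /eqP ay]; apply/eqP; first by rewrite aug0.
    by rewrite augP ax ay mulr0 addr0.
  move=> tS; apply/eqP; apply: (span_min (W := SubModule WP) _ tS) => _ [s [m [Im ->]]].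
  by apply/eqP; rewrite augM aug_iota mulr0.
have coef0 w : forall t, t \in ideal_span -> t@_(FMonom w) = 0.
  elim/last_ind: w => [|w x IH] t tS; last by rewrite coef_rcons; apply/IH/stable.
  by have := aug_span t tS; rewrite /aug -FMonom_nil.
apply: tword_eq0 => w; apply: coef0; rewrite -[iota m0]mul1r.
by apply: mem_span; exists 1, m0.
Qed.

End FoxDerivative.

(** From here on a single Fox derivative is known only as a cocycle on [L] with values in [U (L/I)],
    fixed by its values on the generators. *)
Theorem fox_derivative (k : fieldType) (X : choiceType) (L : lieAlgType k) (i : X -> L)
    (I : lieIdeal L) :
  free_lie_on i -> (exists2 m, m \in I & m != 0) ->
  exists (x0 : X) (D : L -> U (quotl I)),
    [/\ linear D,
        forall a b, D (lie a b) = ug (qmod I a : quotl I) * D b - ug (qmod I b : quotl I) * D a,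
        forall x, D (i x) = (x == x0)%:R
      & exists2 m, m \in I & D m != 0].
Proof.
move=> Lfree Inz.
have [iota [il im ii]] := free_lie_alg_hom Lfree (A := free_alg k X) (fun x => tword k [:: x]).
have [x0 [m [Im fm]]] := fox_neq0 Lfree il im ii Inz.
exists x0, (fox i I iota x0); split.
- exact: fox_linear.
- exact: fox_lie.
- exact: fox_i.
- by exists m.
Qed.

(** * Triangular representations *)

(* Square matrices over a k-algebra, with k (and not H) as ring of scalars. *)
Definition kmx (k : comNzRingType) (H : algType k) (n : nat) : Type := 'M[H]_n.+1.

Section MatrixAlgebra.
Variables (k : comNzRingType) (H : algType k) (n : nat).

HB.instance Definition _ := GRing.NzRing.copy (kmx H n) 'M[H]_n.+1.

Definition kmx_scale (c : k) (M : kmx H n) : kmx H n := \matrix_(i, j) (c *: M i j).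

Lemma kmx_scaleA a b M : kmx_scale a (kmx_scale b M) = kmx_scale (a * b) M.
Proof. by apply/matrixP => i j; rewrite !mxE scalerA. Qed.

Lemma kmx_scale1 : left_id 1 kmx_scale.
Proof. by move=> M; apply/matrixP => i j; rewrite !mxE scale1r. Qed.

Lemma kmx_scaleDr : right_distributive kmx_scale +%R.
Proof. by move=> a M N; apply/matrixP => i j; rewrite !mxE scalerDr. Qed.

Lemma kmx_scaleDl M : {morph kmx_scale^~ M : a b / a + b}.
Proof. by move=> a b; apply/matrixP => i j; rewrite !mxE scalerDl. Qed.

HB.instance Definition _ := GRing.Zmodule_isLmodule.Build k (kmx H n)
  kmx_scaleA kmx_scale1 kmx_scaleDr kmx_scaleDl.

Lemma kmx_scaleAl (a : k) (M N : kmx H n) : a *: (M * N) = (a *: M) * N.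
Proof.
apply/matrixP => i j; rewrite !mxE scaler_sumr; apply: eq_bigr => l _.
by rewrite mxE scalerAl.
Qed.

HB.instance Definition _ := GRing.Lmodule_isLalgebra.Build k (kmx H n) kmx_scaleAl.

Lemma kmx_scaleAr (a : k) (M N : kmx H n) : a *: (M * N) = M * (a *: N).
Proof.
apply/matrixP => i j; rewrite !mxE scaler_sumr; apply: eq_bigr => l _.
by rewrite mxE scalerAr.
Qed.

HB.instance Definition _ := GRing.Lalgebra_isAlgebra.Build k (kmx H n) kmx_scaleAr.

Implicit Types M N : kmx H n.

(** [inord] reads an index above [n] as 0, hence the bounds by [n] in [depth] and [ent_eq]. *)
Definition ent M (i j : nat) : H := M (inord i) (inord j).

Lemma entP a M N i j : ent (a *: M + N) i j = a *: ent M i j + ent N i j.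
Proof. by rewrite /ent !mxE. Qed.

Lemma entB M N i j : ent (M - N) i j = ent M i j - ent N i j.
Proof. by rewrite /ent !mxE. Qed.

Lemma ent0 i j : ent 0 i j = 0.
Proof. by rewrite /ent mxE. Qed.

Lemma entM M N i j : ent (M * N) i j = \sum_(0 <= l < n.+1) ent M i l * ent N l j.
Proof.
rewrite /ent mxE big_mkord; apply: eq_bigr => l _.
by rewrite inord_val.
Qed.

Lemma ent_eq M N : (forall i j, (i <= n)%N -> (j <= n)%N -> ent M i j = ent N i j) -> M = N.
Proof.
move=> MN; apply/matrixP => i j.
by have := MN i j (leq_ord i) (leq_ord j); rewrite /ent !inord_val.
Qed.

Definition depth (d : nat) M :=
  forall i j, (i <= n)%N -> (j <= n)%N -> (j < i + d)%N -> ent M i j = 0.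

Lemma depth0 d : depth d 0.
Proof. by move=> i j *; rewrite ent0. Qed.

Lemma depth_lin d a M N : depth d M -> depth d N -> depth d (a *: M + N).
Proof. by move=> Md Nd i j *; rewrite entP Md ?Nd // scaler0 addr0. Qed.

Lemma depthB d M N : depth d M -> depth d N -> depth d (M - N).
Proof. by move=> Md Nd i j *; rewrite entB Md ?Nd // subr0. Qed.

Lemma depthM d e M N : depth d M -> depth e N -> depth (d + e) (M * N).
Proof.
move=> Md Ne i j ni nj ij; rewrite entM big_nat big1 // => l /andP[_ ln].
have [li|il] := ltnP l (i + d); first by rewrite Md ?mul0r.
by rewrite Ne ?mulr0 //; lia.
Qed.

Lemma ent_mul d e M N i : depth d M -> depth e N -> (i + d + e <= n)%N ->
  ent (M * N) i (i + d + e)%N = ent M i (i + d)%N * ent N (i + d)%N (i + d + e)%N.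
Proof.
move=> Md Ne iden; rewrite entM (bigD1_seq (i + d)%N) ?iota_uniq ?mem_index_iota //=; last lia.
rewrite big_nat_cond big1 ?addr0 // => l /andP[/andP[_ ln] lid].
have [li|il] := ltnP l (i + d); first by rewrite Md ?mul0r //; lia.
by rewrite Ne ?mulr0 //; move/eqP: lid; lia.
Qed.

Lemma ent_mul_super M N i : depth 0 M -> depth 0 N -> (i < n)%N ->
  ent (M * N) i i.+1 = ent M i i * ent N i i.+1 + ent M i i.+1 * ent N i.+1 i.+1.
Proof.
move=> M0 N0 ni; rewrite entM (big_cat_nat (n := i)) //=; last lia.
rewrite big_nat big1 ?add0r => [|l li]; last by rewrite M0 ?mul0r //; lia.
rewrite big_ltn; last lia.
rewrite big_ltn; last lia.
rewrite big_nat big1 ?addr0 // => l /andP[li ln].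
by rewrite N0 ?mulr0 //; lia.
Qed.

End MatrixAlgebra.

Section Triangular.
Variables (k : fieldType) (X : Type) (L : lieAlgType k) (i : X -> L) (H : algType k) (n : nat).
Hypothesis Lfree : free_lie_on i.
Variables (sg : nat -> L -> H) (c : nat -> X -> H).
Hypothesis sg_lin : forall l, linear (sg l).
Hypothesis sg_lie : forall l a b, sg l (lie a b) = sg l a * sg l b - sg l b * sg l a.

Definition tri_spec (rho : L -> kmx H n) :=
  [/\ linear rho, forall a b, rho (lie a b) = rho a * rho b - rho b * rho a,
      forall a, depth 0 (rho a),
      forall a l, (l <= n)%N -> ent (rho a) l l = sg l a
    & forall x l, (l < n)%N -> ent (rho (i x)) l l.+1 = c l x].

Lemma tri_exists : exists rho, tri_spec rho.
Proof.
pose gm (x : X) : kmx H n := \matrix_(s, t) if (s == t :> nat) then sg s (i x)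
  else if s.+1 == t then c s x else 0.
have [rho [rl rL ri]] := free_lie_alg_hom Lfree gm.
have ent_gm x s t : (s <= n)%N -> (t <= n)%N -> ent (rho (i x)) s t
    = if (s == t)%N then sg s (i x) else if s.+1 == t then c s x else 0.
  by move=> sn tn; rewrite ri /ent mxE !inordK.
have rho0 : rho 0 = 0 by apply: (linear0 (to_linear rl)).
have sg0 l : sg l 0 = 0 by apply: (linear0 (to_linear (sg_lin l))).
pose P a := `[< depth 0 (rho a) /\ forall l, (l <= n)%N -> ent (rho a) l l = sg l a >].
have WP : submod_closed P.
  split=> [|e a b /asboolP[da ga] /asboolP[db gb]]; apply/asboolP.
    by rewrite rho0; split=> [|l ln]; [apply: depth0 | rewrite ent0 sg0].
  rewrite rl; split=> [|l ln]; first exact: depth_lin.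
  by rewrite entP ga // gb // sg_lin.
have H0 a : a \in SubModule WP.
  apply: (free_lie_generated Lfree) => [{}a b /asboolP[da ga] /asboolP[db gb]|x].
    apply/asboolP; rewrite rL; split=> [|l ln].
      by apply: depthB; rewrite -[0%N]addn0; apply: depthM.
    have e (M N : kmx H n) : depth 0 M -> depth 0 N -> ent (M * N) l l = ent M l l * ent N l l.
      by move=> M0 N0; have := @ent_mul _ _ _ _ _ _ _ l M0 N0; rewrite !addn0; apply.
    by rewrite entB !e // !ga // !gb // sg_lie.
  apply/asboolP; split=> [s t sn tn|l ln]; last by rewrite ent_gm // eqxx.
  by rewrite addn0 => ts; rewrite ent_gm // (gtn_eqF ts) gtn_eqF // ltnS ltnW.
have HP a : depth 0 (rho a) /\ forall l, (l <= n)%N -> ent (rho a) l l = sg l a.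
  by apply/asboolP; apply: H0.
exists rho; split.
- exact: rl.
- exact: rL.
- by move=> a; case: (HP a).
- by move=> a; case: (HP a).
- move=> x l ln; rewrite (ent_gm x l l.+1 (ltnW ln) ln).
  by rewrite (ltn_eqF (ltnSn l)) eqxx.
Qed.

Variable rho : L -> kmx H n.
Hypothesis rho_tri : tri_spec rho.

Lemma tri_super l a b : (l < n)%N -> ent (rho (lie a b)) l l.+1 =
  (sg l a * ent (rho b) l l.+1 - ent (rho b) l l.+1 * sg l.+1 a)
  - (sg l b * ent (rho a) l l.+1 - ent (rho a) l l.+1 * sg l.+1 b).
Proof.
case: rho_tri => _ rL d0 dg _ ln; rewrite rL entB !ent_mul_super // !dg //; try exact: ltnW.
by rewrite !opprD !opprK addrACA -!addrA; congr (_ + _); rewrite addrA addrC.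
Qed.

Lemma tri_corner_rep (S : lieIdeal L) :
  (forall a, sg 0 a = 0) -> (forall a, sg n a = 0) ->
  (forall s, s \in S -> forall a b, (a <= n)%N -> (b <= n)%N ->
     ~~ ((a == 0%N) && (b == n)) -> ent (rho s) a b = 0) ->
  exists r : corner_rep S (kmx H n), corner_map r = rho.
Proof.
case: rho_tri => rl rL d0 dg _ sg0 sgn Sc.
(* The first column and the last row of every [rho a] are zero, so [E] on the right and [F] on the
   left change nothing; on the other side they delete the first row and the last column. *)
pose E : kmx H n := \matrix_(a, b) ((a == b) && (a != 0 :> nat))%:R.
pose F : kmx H n := \matrix_(a, b) ((a == b) && (a != n :> nat))%:R.
have entE M a b : (a <= n)%N -> (b <= n)%N -> ent (E * M) a b = (a != 0)%N%:R * ent M a b.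
  move=> an bn; rewrite /ent mxE (bigD1 (inord a)) //= big1 => [|l la].
    by rewrite addr0 mxE eqxx inordK.
  by rewrite mxE eq_sym (negPf la) mul0r.
have entF M a b : (a <= n)%N -> (b <= n)%N -> ent (F * M) a b = (a != n)%:R * ent M a b.
  move=> an bn; rewrite /ent mxE (bigD1 (inord a)) //= big1 => [|l la].
    by rewrite addr0 mxE eqxx inordK.
  by rewrite mxE eq_sym (negPf la) mul0r.
have entEr M a b : (a <= n)%N -> (b <= n)%N -> ent (M * E) a b = ent M a b * (b != 0)%N%:R.
  move=> an bn; rewrite /ent mxE (bigD1 (inord b)) //= big1 => [|l lb].
    by rewrite addr0 mxE eqxx inordK.
  by rewrite mxE (negPf lb) mulr0.
have entFr M a b : (a <= n)%N -> (b <= n)%N -> ent (M * F) a b = ent M a b * (b != n)%:R.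
  move=> an bn; rewrite /ent mxE (bigD1 (inord b)) //= big1 => [|l lb].
    by rewrite addr0 mxE eqxx inordK.
  by rewrite mxE (negPf lb) mulr0.
have h1 a : rho a * E = rho a.
  apply: ent_eq => s t sn tn; rewrite entEr //; case: (eqVneq t 0%N) => [->|_]; last by rewrite mulr1.
  rewrite mulr0; case: s sn => [|s] sn; first by rewrite dg // sg0.
  by rewrite d0 // addn0.
have h2 a : F * rho a = rho a.
  apply: ent_eq => s t sn tn; rewrite entF //; case: (eqVneq s n) => [->|_]; last by rewrite mul1r.
  rewrite mul0r; case: (eqVneq t n) => [->|tn']; first by rewrite dg // sgn.
  by rewrite d0 // addn0 ltn_neqAle tn'.
have h3 s : s \in S -> E * rho s = 0.
  move=> Ss; apply: ent_eq => a b an bn; rewrite entE // ent0.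
  case: (eqVneq a 0%N) => [_|a0]; first by rewrite mul0r.
  by rewrite Sc ?mulr0 // (negPf a0).
have h4 s : s \in S -> rho s * F = 0.
  move=> Ss; apply: ent_eq => a b an bn; rewrite entFr // ent0.
  case: (eqVneq b n) => [_|bn']; first by rewrite mulr0.
  by rewrite Sc ?mul0r // (negPf bn') andbF.
by exists (CornerRep rl rL h1 h2 h3 h4).
Qed.

End Triangular.

Lemma bimodule_lie (R : nzRingType) (a b c d h : R) :
  (a * b - b * a) * h - h * (c * d - d * c)
  = a * (b * h - h * d) - (b * h - h * d) * c - (b * (a * h - h * c) - (a * h - h * c) * d).
Proof.
rewrite !(mulrBl, mulrBr) !mulrA.
move: (a * b * h) (b * a * h) (h * c * d) (h * d * c) (a * h * d) (b * h * c) => x1 x2 x3 x4 x5 x6.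
by rewrite !opprB !addrA [RHS](ACl (1*8*3*6*(4*7)*(2*5)))/= addNr (addNr x5) !addr0.
Qed.

Lemma bimodule_linearl (k : comNzRingType) (A : algType k) (c : k) (x y z w h : A) :
  (c *: x + y) * h - h * (c *: z + w) = c *: (x * h - h * z) + (y * h - h * w).
Proof. by rewrite mulrDl mulrDr opprD addrACA scalerBr -scalerAl -scalerAr. Qed.

Lemma bimodule_linearr (k : comNzRingType) (A : algType k) (c : k) (x z u v : A) :
  x * (c *: u + v) - (c *: u + v) * z = c *: (x * u - u * z) + (x * v - v * z).
Proof. by rewrite mulrDl mulrDr opprD addrACA scalerBr -scalerAl -scalerAr. Qed.

(** * Superdiagonal entries as orbit maps on a bimodule *)

Section Omega.
Variables (k : fieldType) (Q G : lieAlgType k) (s t : Q -> G).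
Hypotheses (hs : lie_hom s) (ht : lie_hom t).

(** How a superdiagonal entry changes under a bracket, [s] and [t] being the diagonal maps in its
    row and in its column. *)
Definition bim_act (x : Q) (h : U G) : U G := ug (s x) * h - h * ug (t x).

Lemma bim_linearl h : linear (bim_act^~ h).
Proof.
by move=> a x y; rewrite /bim_act hs.1 ht.1 !ugP; apply: bimodule_linearl.
Qed.

Lemma bim_linearr x : linear (bim_act x).
Proof.
by move=> a u v; apply: bimodule_linearr.
Qed.

Lemma bim_lie x y h : bim_act (lie x y) h = bim_act x (bim_act y h) - bim_act y (bim_act x h).
Proof. by rewrite /bim_act hs.2 ht.2 !ug_lie; apply: bimodule_lie. Qed.

Definition bim_rep := LieRep bim_linearl bim_linearr bim_lie.

(** A superdiagonal entry that is 1 on [x0] and 0 on the other generators turns out to be [omega] of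
    the Fox derivative. *)
Definition omega (u : U Q) : U G := uact bim_rep u 1.

Lemma omega1 : omega 1 = 1.
Proof. exact: uact1. Qed.

Lemma omega_ug x u : omega (ug x * u) = ug (s x) * omega u - omega u * ug (t x).
Proof. by rewrite /omega uactM uact_ug. Qed.

Lemma omega_linear : linear omega.
Proof. exact: uact_linearl. Qed.

Lemma omega0 : omega 0 = 0.
Proof. exact: (linear0 (to_linear omega_linear)). Qed.

Lemma omegaB u v : omega (u - v) = omega u - omega v.
Proof. exact: (linearB (to_linear omega_linear)). Qed.

Variables (C : comNzRingType) (iota : {rmorphism k -> C}) (lam : G -> C).

(** Left and right multiplication agree on symbols, so the action of [x] multiplies the symbol by
    [lam (s x) - lam (t x)]. *)
Lemma symbol_omega d u c : symbol iota (fun x => lam (s x) - lam (t x)) d u c ->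
  symbol iota lam d (omega u) c.
Proof.
move=> [w [wd -> ->]]; elim: w wd => [|p w IH] /=.
  by rewrite /wsum /wsymbol !big_nil omega0 => _; apply: symbol0.
case/andP => pd /IH{}IH; rewrite /wsum /wsymbol !big_cons omega_linear mulrCA.
apply: symbol_lin => // {IH}.
have H : symbol iota lam (size p.2) (omega (uword p.2)) (\prod_(x <- p.2) (lam (s x) - lam (t x))).
  elim: p.2 => [|x v IH]; first by rewrite uword_nil omega1 big_nil; apply: symbol1.
  rewrite uword_cons omega_ug big_cons mulrBl /=.
  apply: symbolB; first exact: symbol_ugM.
  by rewrite mulrC -addn1; apply: symbolM => //; apply: symbol_ug.
case: eqP => [<-|/eqP pnd]; first by rewrite mul1r.
rewrite mul0r; apply: symbol_lift H _.
by rewrite ltn_neqAle pnd.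
Qed.

End Omega.

(** * Ideal powers, iterated brackets and unbounded degree *)

Section IdealPower.
Variables (k : fieldType) (L : lieAlgType k) (I : lieIdeal L).

Lemma ideal_powS n : ideal_pow I n.+2 = lie_prod (ideal_pow I n.+1) I.
Proof. by []. Qed.

Lemma mem_ideal_powS n a b : a \in ideal_pow I n.+1 -> b \in I ->
  lie a b \in ideal_pow I n.+2.
Proof. by move=> an bI; rewrite ideal_powS; apply: mem_span; exists a, b. Qed.

Lemma ideal_pow_derived n s : (1 < n)%N -> s \in ideal_pow I n -> s \in lie_span (L := L) predT predT.
Proof.
case: n => [|[|n]] // _; rewrite ideal_powS; apply: span_min => y [a [b [_ _ ->]]].
by apply: mem_span; exists a, b.
Qed.

Variables (H : algType k) (n : nat) (rho : L -> kmx H n).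
Hypothesis rho_lin : linear rho.
Hypothesis rho_lie : forall a b, rho (lie a b) = rho a * rho b - rho b * rho a.
Hypothesis rho_I : forall m, m \in I -> depth 1 (rho m).

Lemma depth_closed d : submod_closed (fun a => `[< depth d (rho a) >]).
Proof.
split=> [|e a b /asboolP da /asboolP db]; apply/asboolP.
  by have -> : rho 0 = 0 := linear0 (to_linear rho_lin); apply: depth0.
by rewrite rho_lin; apply: depth_lin.
Qed.

Lemma ideal_pow_depth d s : s \in ideal_pow I d.+1 -> depth d.+1 (rho s).
Proof.
elim: d s => [|d IH] s; first exact: rho_I.
rewrite ideal_powS => sS; apply/asboolP.
apply: (span_min (W := SubModule (depth_closed d.+2)) _ sS) => _ [a [b [Ia Ib ->]]].
apply/asboolP; rewrite rho_lie; apply: depthB.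
  by rewrite -addn1; apply: depthM (IH a Ia) (rho_I Ib).
by rewrite -add1n; apply: depthM (rho_I Ib) (IH a Ia).
Qed.

(** Among the paths from [l] to [l + d.+2], depth allows only those where [m] makes a unit step at
    the end or at the start. *)
Lemma ent_bracket d u m l : u \in ideal_pow I d.+1 -> m \in I -> (l + d.+2 <= n)%N ->
  ent (rho (lie u m)) l (l + d.+2)%N
  = ent (rho u) l (l + d.+1)%N * ent (rho m) (l + d.+1)%N (l + d.+1).+1
    - ent (rho m) l l.+1 * ent (rho u) l.+1 (l.+1 + d.+1)%N.
Proof.
move=> Iu Im ldn; have dK := ideal_pow_depth Iu; have d1 := rho_I Im.
rewrite rho_lie entB; have -> : (l + d.+2 = l + d.+1 + 1)%N by lia.
rewrite (ent_mul dK d1) ?addn1; last lia.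
have -> : ((l + d.+1).+1 = l + 1 + d.+1)%N by lia.
by rewrite (ent_mul d1 dK) ?addn1 //; lia.
Qed.

End IdealPower.

Section Unbounded.
Variables (k : fieldType) (L G : lieAlgType k) (S : lieIdeal L) (n : nat).
Variables (C : comNzRingType) (iota : {rmorphism k -> C}) (lam : G -> C).
Hypothesis lam_semi : semilinear_map iota lam.

Lemma deg_lt_family e (v : 'I_e -> U G) : exists d, forall j, deg_lt d (v j).
Proof.
elim: e v => [|e IH] v; first by exists 0%N; case.
have [d dv] := IH (fun j => v (lift ord0 j)); have [d' dv'] := deg_lt_exists (v ord0).
exists (maxn d d') => j; case: (unliftP ord0 j) => [j'|] ->.
  by apply: deg_ltW (dv j'); apply: leq_maxl.
by apply: deg_ltW dv'; apply: leq_maxr.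
Qed.

(** On a finite-dimensional image the entries have bounded degree, so their symbols in larger
    degrees vanish. *)
Lemma unbounded_infinite (rho : L -> kmx (U G) n) a b :
  (forall d, exists D s c, [/\ (d <= D)%N, s \in S, c != 0 & symbol iota lam D (ent (rho s) a b) c]) ->
  ~ finite_image S rho.
Proof.
move=> unb [e [v vP]].
have [d dv] := deg_lt_family (fun j => ent (v j) a b).
have [D [s [c [dD Ss c0 sc]]]] := unb d.
have [f rs] := vP s Ss; move/eqP: c0; apply.
apply: (symbol_uniq lam_semi sc); apply: symbol_deg; apply: deg_ltW dD _.
rewrite rs; elim/big_ind: _ => [|x y dx dy|j _]; first by rewrite ent0; apply: deg_lt0.
  by rewrite -[x]scale1r entP scale1r; apply: deg_ltD.
by rewrite -[_ *: _]addr0 entP ent0 addr0; apply: deg_ltZ.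
Qed.

End Unbounded.

Section IterDiff.
Variable C : zmodType.

(** An alternating sum with binomial coefficients; in an iterated bracket it collects the positions
    of the first element among the [K] others. *)
Fixpoint iter_diff (K : nat) (B : nat -> C) (l : nat) : C :=
  if K is K'.+1 then iter_diff K' B l - iter_diff K' B l.+1 else B l.

Lemma iter_diff0 K (B : nat -> C) l :
  (forall t, (l <= t <= l + K)%N -> B t = 0) -> iter_diff K B l = 0.
Proof.
elim: K l => [|K IH] l B0 /=; first by rewrite B0 ?addn0 ?leqnn.
by rewrite !IH ?subr0 // => t tl; apply: B0; lia.
Qed.

Lemma iter_diff_head K (B : nat -> C) :
  (forall t, (0 < t <= K)%N -> B t = 0) -> iter_diff K B 0 = B 0%N.
Proof.
elim: K => [|K IH] B0 //=; rewrite IH ?iter_diff0 ?subr0 // => t tK; apply: B0; lia.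
Qed.

End IterDiff.

Lemma coef_iter_diff (C : nzRingType) r K (B : nat -> {poly C}) l :
  (iter_diff K B l)`_r = iter_diff K (fun t => (B t)`_r) l.
Proof. by elim: K l => [|K IH] l //=; rewrite coefB !IH. Qed.

Section Walk.
Variables (k : fieldType) (X : choiceType) (L : lieAlgType k) (i : X -> L).
Hypothesis Lfree : free_lie_on i.
Variables (I : lieIdeal L) (x0 : X).
Local Notation Q := (quotl I).
Variable D : L -> U Q.
Hypothesis D_lin : linear D.
Hypothesis D_lie :
  forall a b, D (lie a b) = ug (qmod I a : Q) * D b - ug (qmod I b : Q) * D a.
Hypothesis D_gen : forall x, D (i x) = (x == x0)%:R.

Lemma qmod_ideal m : m \in I -> qmod I m = 0 :> Q.
Proof. by move=> Im; apply/eqP; rewrite -(linear0 (qmod I)) qmod_eq subr0. Qed.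

Lemma D_ideal a m : m \in I -> D (lie a m) = ug (qmod I a : Q) * D m.
Proof. by move=> Im; rewrite D_lie (qmod_ideal Im) ug0 mul0r subr0. Qed.

Variables (G : lieAlgType k) (n : nat) (h : nat -> Q -> G).
Hypothesis h_hom : forall l, lie_hom (h l).

Definition diag_map l (a : L) : U G := ug (h l (qmod I a : Q)).

Lemma diag_map_linear l : linear (diag_map l).
Proof. by move=> c a b; rewrite /diag_map linearP (h_hom l).1 ugP. Qed.

Lemma diag_map_lie l a b :
  diag_map l (lie a b) = diag_map l a * diag_map l b - diag_map l b * diag_map l a.
Proof. by rewrite /diag_map -qmod_lie (h_hom l).2 ug_lie. Qed.

Lemma diag_map_ideal l m : m \in I -> diag_map l m = 0.
Proof.
move=> Im; rewrite /diag_map qmod_ideal //.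
by have -> : h l 0 = 0 := linear0 (to_linear (h_hom l).1); rewrite ug0.
Qed.

Lemma walk_exists :
  exists rho, tri_spec i diag_map (fun _ x => (x == x0)%:R) (n := n) rho.
Proof. exact: tri_exists diag_map_linear diag_map_lie. Qed.

Variable rho : L -> kmx (U G) n.
Hypothesis rho_tri : tri_spec i diag_map (fun _ x => (x == x0)%:R) rho.

(** Both sides are cocycles for the same bimodule action and agree on the free generators. *)
Lemma walk_super l a : (l < n)%N ->
  ent (rho a) l l.+1 = omega (h_hom l) (h_hom l.+1) (D a).
Proof.
move=> ln; have rl : linear rho by case: rho_tri.
have om0 := omega_linear (h_hom l) (h_hom l.+1).
have WP : submod_closed (fun a =>
    `[< ent (rho a) l l.+1 = omega (h_hom l) (h_hom l.+1) (D a) >]).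
  split=> [|c u v /asboolP ue /asboolP ve]; apply/asboolP.
    have -> : rho 0 = 0 := linear0 (to_linear rl).
    have -> : D 0 = 0 := linear0 (to_linear D_lin).
    by rewrite ent0 omega0.
  by rewrite rl entP ue ve D_lin om0.
apply/asboolP; apply: (free_lie_generated (W := SubModule WP) Lfree).
  move=> u v /asboolP ue /asboolP ve; apply/asboolP.
  apply: etrans (tri_super rho_tri u v ln) _; rewrite ue.
  rewrite ve D_lie omegaB; apply: congr2.
    exact: (esym (omega_ug _ _ _ _)).
  congr (- _).
  exact: (esym (omega_ug _ _ _ _)).
move=> x; apply/asboolP; case: rho_tri => _ _ _ _ ->; last exact: ln.
by rewrite D_gen; case: eqP => _; rewrite ?omega1 ?omega0.
Qed.

Lemma walk_depth1 m : m \in I -> depth 1 (rho m).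
Proof.
case: rho_tri => _ _ d0 dg _ Im s t sn tn; rewrite addn1 ltnS leq_eqVlt => /predU1P[->|ts].
  by rewrite dg // diag_map_ideal.
by apply: d0; rewrite ?addn0.
Qed.

Definition chain (e m : L) K := iter K (fun u => lie u m) e.

Lemma chain_ideal e m K : e \in I -> m \in I -> chain e m K \in ideal_pow I K.+1.
Proof. by move=> Ie Im; elim: K => [|K IH] //; apply: mem_ideal_powS. Qed.

Variables (C : comNzRingType) (iota : {rmorphism k -> C}) (lam : G -> C).
Variables (e m : L) (A B : nat -> C) (d d' : nat).
Hypotheses (Ie : e \in I) (Im : m \in I).
Hypothesis symbol_m : forall l, (l < n)%N -> symbol iota lam d (ent (rho m) l l.+1) (A l).
Hypothesis symbol_e : forall l, (l < n)%N ->
  symbol iota lam d' (ent (rho e) l l.+1) (A l * B l).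

(** Leading terms commute, so the product of the [A] over all places is common to every position of
    [e]; what is left is the iterated difference of [B]. *)
Lemma symbol_chain K l : (l + K < n)%N ->
  symbol iota lam (d' + K * d) (ent (rho (chain e m K)) l (l + K.+1)%N)
    (\prod_(t < K.+1) A (l + t)%N * iter_diff K B l).
Proof.
have [rl rL _ _ _] := rho_tri.
elim: K l => [|K IH] l lK; first by rewrite big_ord1 !addn0 addn1; apply: symbol_e; lia.
rewrite (ent_bracket rl rL walk_depth1 (chain_ideal K Ie Im) Im); last lia.
rewrite mulrBr; apply: symbolB.
  rewrite big_ord_recr /= -mulrA [A _ * _]mulrC mulrA.
  have -> : (d' + K.+1 * d = d' + K * d + d)%N by rewrite mulSn; lia.
  by apply: symbolM; [apply: IH | apply: symbol_m]; lia.
rewrite big_ord_recl addn0 -mulrA.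
have -> : (d' + K.+1 * d = d + (d' + K * d))%N by rewrite mulSn; lia.
apply: symbolM; first by apply: symbol_m; lia.
have -> : \prod_(t < K.+1) A (l + lift ord0 t)%N = \prod_(t < K.+1) A (l.+1 + t)%N.
  by apply: eq_bigr => t _; rewrite /= /bump /= add1n addnS.
by apply: IH; lia.
Qed.

End Walk.

(** * The representation over a power of L/I *)

Definition lie_power (k : comNzRingType) (Q : lieAlgType k) (N : nat) : Type := {ffun 'I_N -> Q}.

Section LiePower.
Variables (k : comNzRingType) (Q : lieAlgType k) (N : nat).
Local Notation P := (lie_power Q N).

HB.instance Definition _ := GRing.Lmodule.copy P {ffun 'I_N -> Q}.

Definition power_lie (f g : P) : P := [ffun i => lie (f i) (g i)].

Lemma power_lie_linearl g : linear (power_lie^~ g).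
Proof. by move=> c f f'; apply/ffunP => i; rewrite !ffunE lie_linearl. Qed.

Lemma power_lie_linearr f : linear (power_lie f).
Proof. by move=> c g g'; apply/ffunP => i; rewrite !ffunE lie_linearr. Qed.

Lemma power_liexx f : power_lie f f = 0.
Proof. by apply/ffunP => i; rewrite !ffunE liexx. Qed.

Lemma power_lie_jacobi x y z :
  power_lie x (power_lie y z) + power_lie y (power_lie z x) + power_lie z (power_lie x y) = 0.
Proof. by apply/ffunP => i; rewrite !ffunE lie_jacobi. Qed.

HB.instance Definition _ := Lmodule_isLieAlgebra.Build k P
  power_lie_linearl power_lie_linearr power_liexx power_lie_jacobi.

(** Slots are counted from 1, hence [i.+1]. The guard on [l] makes the map of index 0 vanish, as
    those of index above [N] do, which gives the zero ends of the diagonal. *)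
Definition tail_map (l : nat) (x : Q) : P := [ffun i : 'I_N => if (0 < l <= i.+1)%N then x else 0].

Lemma tail_map_hom l : lie_hom (tail_map l).
Proof.
split=> [c x y|x y]; apply/ffunP => i; rewrite !ffunE; case: ifP => _ //.
  by rewrite scaler0 addr0.
by rewrite (linear0 (lie 0)).
Qed.

Lemma tail_map0 x : tail_map 0 x = 0.
Proof. by apply/ffunP => i; rewrite !ffunE. Qed.

Lemma tail_mapN l x : (N < l)%N -> tail_map l x = 0.
Proof.
move=> Nl; apply/ffunP => i; rewrite !ffunE.
by have := ltn_ord i; case: ifP => //; lia.
Qed.

End LiePower.

Section PowerForm.
Variables (k : fieldType) (Q : lieAlgType k) (N : nat).
Variables (C : comNzRingType) (iota : {rmorphism k -> C}) (lam : Q -> C).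
Hypothesis lam_semi : semilinear_map iota lam.

(** Distinct powers of a single variable keep the slots apart, and the values stay in a domain when
    [C] is one. *)
Definition power_form (f : lie_power Q N) : {poly C} := \sum_(i < N) (lam (f i))%:P * 'X^(i.+1).

Lemma power_form_semi : semilinear_map (polyC \o iota) power_form.
Proof.
move=> c f g; rewrite /power_form mulr_sumr -big_split; apply: eq_bigr => i _ /=.
by rewrite !ffunE lam_semi rmorphD rmorphM /= mulrDl mulrA.
Qed.

Definition power_weight (l : nat) : {poly C} :=
  if l is 0%N then - \sum_(i < N) 'X^(i.+1) else 'X^l.

Lemma power_form_tail l x : (l <= N)%N ->
  power_form (tail_map N l x) - power_form (tail_map N l.+1 x) = power_weight l * (lam x)%:P.
Proof.
move=> lN; have l0 : lam 0 = 0 := semi0 lam_semi.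
rewrite /power_form -sumrB; case: l lN => [|l] lN /=.
  rewrite mulNr mulr_suml -sumrN; apply: eq_bigr => i _.
  by rewrite !ffunE /= l0 mul0r sub0r mulrC.
rewrite (bigD1 (Ordinal lN)) //= big1 => [|j jl].
  by rewrite !ffunE /= leqnn ltnn l0 mul0r subr0 addr0 mulrC.
rewrite !ffunE /=; have {}jl : (j != l :> nat) by [].
by rewrite !ltnS leq_eqVlt eq_sym (negPf jl) /= subrr.
Qed.

End PowerForm.

Lemma symbol_map (k : fieldType) (G : lieAlgType k) (C C' : comNzRingType)
    (iota : {rmorphism k -> C}) (phi : {rmorphism C -> C'}) (lam : G -> C) d u c :
  symbol iota lam d u c -> symbol (phi \o iota) (phi \o lam) d u (phi c).
Proof.
move=> [s [sd -> ->]]; exists s; split=> //.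
rewrite /wsymbol rmorph_sum; apply: eq_bigr => p _.
by rewrite !rmorphM rmorph_nat rmorph_prod.
Qed.

Section Weights.
Variables (C : idomainType) (N : nat).

Lemma coef0X (T : {poly C}) j : T`_0 = 1 -> (T ^+ j)`_0 = 1.
Proof. by move=> T0; rewrite -!horner_coef0 in T0 *; rewrite hornerE T0 expr1n. Qed.

Lemma coef1X (T : {poly C}) j : T`_0 = 1 -> (T ^+ j)`_1 = j%:R * T`_1.
Proof.
move=> T0; elim: j => [|j IH]; first by rewrite expr0 mul0r coef1.
rewrite exprS coefM big_ord_recl big_ord1 /= T0 IH coef0X // mulr1 mul1r.
by rewrite -natr1 mulrDl mul1r.
Qed.

(** This is [1 + X + .. + X^N], written so that its two lowest coefficients can be read off. *)
Definition weight_tail : {poly C} := 1 + 'X * \sum_(i < N) 'X^i.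

Lemma weight_tail0 : weight_tail`_0 = 1.
Proof. by rewrite coefD coefXM coef1 addr0. Qed.

Lemma weight_tail1 : weight_tail`_1 = (0 < N)%N%:R.
Proof.
rewrite coefD coefXM coef1 add0r coef_sum; case: N => [|M]; first by rewrite big_ord0.
by rewrite big_ord_recl /= coefXn eqxx big1 ?addr0 // => i _; rewrite coefXn.
Qed.

Lemma power_weight0 : power_weight N.+1 C 0 = - ('X * weight_tail).
Proof.
rewrite /power_weight /weight_tail mulrDr mulr1 mulr_sumr big_ord_recl /=; congr (- _).
by rewrite mulr_sumr; congr (_ + _); apply: eq_bigr => i _; rewrite -!exprS.
Qed.

Lemma power_weight_neq0 l : power_weight N.+1 C l != 0.
Proof.
case: l => [|l]; last by rewrite -size_poly_eq0 size_polyXn.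
rewrite power_weight0 oppr_eq0 mulf_neq0 ?polyX_eq0 //.
by apply/eqP => /(congr1 (fun p : {poly C} => p`_0)) /eqP; rewrite weight_tail0 coef0 oner_eq0.
Qed.

Lemma coef_weight0 (q : C) j e :
  ((power_weight N.+1 C 0 * q%:P) ^+ j)`_(j + e) = (- q) ^+ j * (weight_tail ^+ j)`_e.
Proof.
have -> : power_weight N.+1 C 0 * q%:P = (- q)%:P * ('X * weight_tail).
  by rewrite power_weight0 polyCN; ring.
rewrite !exprMn -rmorphXn coefCM; congr (_ * _).
by rewrite coefXnM ltnNge leq_addr /= addKn.
Qed.

Lemma coef_weightS (q : C) j l r :
  ((power_weight N.+1 C l.+1 * q%:P) ^+ j)`_r = (r == l.+1 * j)%N%:R * q ^+ j.
Proof. by rewrite /= exprMn -rmorphXn coefMC -exprM coefXn. Qed.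

(* Only the term of index 0 contributes to the coefficient of degree j + 1. *)
Lemma iter_diff_weight_neq0 (q : C) j K : q != 0 -> (1 < j)%N -> j%:R != 0 :> C ->
  (0 < N)%N -> iter_diff K (fun l => (power_weight N.+1 C l * q%:P) ^+ j) 0 != 0.
Proof.
move=> q0 j1 jC N0; suff: (iter_diff K (fun l => (power_weight N.+1 C l * q%:P) ^+ j) 0)`_(j + 1) != 0.
  by apply: contra_neq => ->; rewrite coef0.
rewrite coef_iter_diff iter_diff_head => [|[|l] // _].
  rewrite coef_weight0 coef1X ?weight_tail0 // weight_tail1 N0 mulr1.
  by rewrite mulf_neq0 // expf_neq0 // oppr_eq0.
rewrite coef_weightS; suff -> : (j + 1 == l.+1 * j)%N = false by rewrite mul0r.
(* Equality would mean that [j] times the index before its successor is 1, which [1 < j]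
   excludes. *)
by case: l => [|l]; nia.
Qed.

(** In degree [j] both terms contribute, and for odd [j] they add up to [-2 q^j]. *)
Lemma diff_weight_neq0 (q : C) j : q != 0 -> odd j -> 2%:R != 0 :> C ->
  iter_diff 1 (fun l => (power_weight N.+1 C l * q%:P) ^+ j) 0 != 0.
Proof.
move=> q0 jo C2; suff: (iter_diff 1 (fun l => (power_weight N.+1 C l * q%:P) ^+ j) 0)`_(j + 0) != 0.
  by apply: contra_neq => ->; rewrite coef0.
rewrite coef_iter_diff /= coef_weight0 coef0X ?weight_tail0 // mulr1.
rewrite -[X in _ - X]/(_`_(j + 0)) (coef_weightS q j 0) addn0 mul1n eqxx mul1r.
rewrite exprNn -signr_odd jo expr1 mulN1r -opprD oppr_eq0 -mulr2n -mulr_natl.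
by rewrite mulf_neq0 // expf_neq0.
Qed.

End Weights.

Lemma infinite_corner (k : fieldType) (X : Type) (L : lieAlgType k) (i : X -> L) (I : lieIdeal L)
    (H : algType k) n (sg : nat -> L -> H) c (rho : L -> kmx H n) :
  (0 < n)%N -> tri_spec i sg c rho ->
  (forall a, sg 0 a = 0) -> (forall a, sg n a = 0) -> (forall m, m \in I -> depth 1 (rho m)) ->
  ~ finite_image (ideal_pow I n) rho ->
  exists r : corner_rep (ideal_pow I n) (kmx H n), ~ finite_image (ideal_pow I n) (corner_map r).
Proof.
move=> n0 tri sg0 sgn d1 inf; have [rl rL _ _ _] := tri.
have [|r rE] := tri_corner_rep tri (S := ideal_pow I n) sg0 sgn; last by exists r; rewrite rE.
case: n n0 rho tri d1 rl rL {inf sgn} => // n _ rho tri d1 rl rL s sn a b an bn ab.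
by apply: (ideal_pow_depth rl rL d1 sn) => //; move: ab; lia.
Qed.

Section PowerWalk.
Variables (k : fieldType) (X : choiceType) (L : lieAlgType k) (i : X -> L).
Hypothesis Lfree : free_lie_on i.
Variables (I : lieIdeal L) (x0 : X).
Local Notation Q := (quotl I).
Variable D : L -> U Q.
Hypothesis D_lin : linear D.
Hypothesis D_lie :
  forall a b, D (lie a b) = ug (qmod I a : Q) * D b - ug (qmod I b : Q) * D a.
Hypothesis D_gen : forall x, D (i x) = (x == x0)%:R.
Variables (m q : L).
Hypotheses (Im : m \in I) (Dm : D m != 0) (q_notin : q \notin I).

Lemma qmod_neq0 : qmod I q != 0 :> Q.
Proof. by rewrite -(linear0 (qmod I)) qmod_eq subr0. Qed.

Lemma iter_lie_ideal j : iter j (lie q) m \in I.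
Proof. by elim: j => [|j IH] //=; apply: mem_lier. Qed.

Lemma D_iter_lie j : D (iter j (lie q) m) = ug (qmod I q : Q) ^+ j * D m.
Proof.
elim: j => [|j IH] /=; first by rewrite expr0 mul1r.
apply: etrans (D_ideal D_lie q (iter_lie_ideal j)) _; rewrite IH exprS.
exact: mulrA.
Qed.

Theorem power_walk_infinite n : (1 < n)%N -> ((2 < n)%N \/ 2%:R != 0 :> k) ->
  exists r : corner_rep (ideal_pow I n) (kmx (U (lie_power Q n.-1)) n),
    ~ finite_image (ideal_pow I n) (corner_map r).
Proof.
case: n => [|[|N]] // _ hN /=.
pose h l : Q -> lie_power Q N.+1 := tail_map N.+1 l.
have h_hom l : lie_hom (h l) := @tail_map_hom _ _ _ l.
have [rho tri] := walk_exists Lfree x0 N.+2 h_hom.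
have d1 := walk_depth1 h_hom tri.
apply: (infinite_corner _ tri _ _ d1) => //.
- by move=> a; rewrite /diag_map /h tail_map0 ug0.
- by move=> a; rewrite /diag_map /h tail_mapN // ug0.
have [B] := basis_exists Q.
have ys0 : all (fun y => y != 0) [:: qmod I q : Q] by rewrite /= qmod_neq0.
have [C [iota [lam [lam_semi [d [c [c0 Dc]]]]]]] := nonzero_symbol B Dm ys0.
rewrite /= andbT => lamq.
have iC0 : 2%:R != 0 :> k -> 2%:R != 0 :> C.
  by rewrite -(rmorph_nat iota) fmorph_eq0.
pose B' j l : {poly C} := (power_weight N.+1 C l * (lam (qmod I q : Q))%:P) ^+ j.
pose A l : {poly C} := power_weight N.+1 C l ^+ d * c%:P.
have A0 l : A l != 0 by rewrite mulf_neq0 ?polyC_eq0 // expf_neq0 // power_weight_neq0.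
have weight l : (l < N.+2)%N -> (fun x : Q => power_form lam (h l x) - power_form lam (h l.+1 x))
    = (fun x => power_weight N.+1 C l * (polyC \o lam) x).
  by move=> lN; apply/funext => x; apply: power_form_tail.
have sym_m l : (l < N.+2)%N -> symbol (polyC \o iota) (power_form lam) d (ent (rho m) l l.+1) (A l).
  move=> lN; rewrite (walk_super Lfree D_lin D_lie D_gen h_hom tri) //.
  apply: symbol_omega; rewrite weight //; apply: symbol_scale.
  exact: symbol_map.
have sym_e j l : (l < N.+2)%N -> symbol (polyC \o iota) (power_form lam) (j + d)
    (ent (rho (iter j (lie q) m)) l l.+1) (A l * B' j l).
  move=> lN; rewrite (walk_super Lfree D_lin D_lie D_gen h_hom tri) // D_iter_lie.
  apply: symbol_omega; rewrite weight //.
  have -> : A l * B' j l = power_weight N.+1 C l ^+ (j + d) * (lam (qmod I q : Q) ^+ j * c)%:P.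
    by rewrite /A /B' exprMn exprD rmorphM rmorphXn /=; ring.
  apply: symbol_scale; apply: symbol_map; apply: symbolM => //.
  by rewrite -[X in symbol _ _ X]muln1; apply/symbolX/symbol_ug.
(* With one slot an odd [j] will do, as 2 is invertible then. With more slots [j] must be non-zero
   in [C], and one of two consecutive integers is. *)
have good dd : exists2 j, (dd <= j)%N & iter_diff N.+1 (B' j) 0 != 0.
  have [N0|N0] := posnP N.
    subst N; exists dd.*2.+1; first by rewrite -addnn; lia.
    apply: diff_weight_neq0; rewrite //= ?odd_double //.
    by apply: iC0; case: hN.
  have [j1|j1] := eqVneq (dd.+2%:R : C) 0; last first.
    by exists dd.+2; [lia | apply: iter_diff_weight_neq0].
  exists dd.+3; [lia | apply: iter_diff_weight_neq0 => //].
  by rewrite -natr1 j1 add0r oner_eq0.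
apply: (unbounded_infinite (power_form_semi lam_semi) (a := 0%N) (b := N.+2)).
move=> dd; have [j jd fj] := good dd.
have ch := chain_ideal N.+1 (iter_lie_ideal j) Im.
have sy := symbol_chain h_hom tri (iter_lie_ideal j) Im sym_m (B := B' j) (sym_e j) (K := N.+1) (l := 0%N) (ltnSn _).
exists (j + d + N.+1 * d)%N, (chain (iter j (lie q) m) m N.+1),
  (\prod_(t < N.+2) A (0 + t)%N * iter_diff N.+1 (B' j) 0); split; last exact: sy.
- by rewrite -addnA; apply: leq_trans jd (leq_addr _ _).
- exact: ch.
- by rewrite mulf_neq0 // //; apply/prodf_neq0 => t _; apply: A0.
Qed.

End PowerWalk.

(** * Characteristic two *)

(** A commutator loses one degree, and by the Leibniz rule each of the [j] factors [y] contributes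
    the same symbol. *)
Lemma symbol_comm_exp (k : fieldType) (G : lieAlgType k) (C : comNzRingType)
    (iota : {rmorphism k -> C}) (lam : G -> C) x y j :
  symbol iota lam j (ug x * ug y ^+ j - ug y ^+ j * ug x)
    (j%:R * lam y ^+ j.-1 * lam (lie x y)).
Proof.
elim: j => [|j IH]; first by rewrite !expr0 mulr1 mul1r subrr !mul0r; apply: symbol0.
have -> : ug x * ug y ^+ j.+1 - ug y ^+ j.+1 * ug x
    = ug (lie x y) * ug y ^+ j + ug y * (ug x * ug y ^+ j - ug y ^+ j * ug x).
  by rewrite ug_lie exprS; apply: comm_mull.
have -> : j.+1%:R * lam y ^+ j.+1.-1 * lam (lie x y)
    = lam (lie x y) * lam y ^+ j + lam y * (j%:R * lam y ^+ j.-1 * lam (lie x y)).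
  rewrite -natr1 /=; case: j {IH} => [|j]; rewrite /= ?exprS; ring.
apply: symbolD; last exact: symbol_ugM.
by apply: symbol_ugM; rewrite -[X in symbol _ _ X]muln1; apply/symbolX/symbol_ug.
Qed.

Lemma zero_lie_hom (k : fieldType) (Q G : lieAlgType k) : lie_hom (fun _ : Q => 0 : G).
Proof. by split=> [c x y|x y]; rewrite ?scaler0 ?addr0 ?linear0. Qed.

Lemma mull_exp (R S : nzRingType) (f : R -> S) x y : (forall u, f (x * u) = y * f u) ->
  forall j u, f (x ^+ j * u) = y ^+ j * f u.
Proof.
move=> fx; elim=> [|j IH] u; first by rewrite !expr0 !mul1r.
by rewrite !exprS -!mulrA fx IH.
Qed.

Lemma mulr_exp (R S : nzRingType) (f : R -> S) x y : (forall u, f (x * u) = f u * y) ->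
  forall j u, f (x ^+ j * u) = f u * y ^+ j.
Proof.
move=> fx; elim=> [|j IH] u; first by rewrite !expr0 mulr1 mul1r.
by rewrite exprS -mulrA fx IH exprSr mulrA.
Qed.

Lemma mulrN_odd (R : nzRingType) (u x y : R) j : odd j -> u * - x * (- y) ^+ j = u * x * y ^+ j.
Proof. by move=> jo; rewrite exprNn -signr_odd jo expr1 mulN1r !mulrN mulNr opprK. Qed.

Lemma corner_identity (R : nzRingType) (p0 p1 a w : R) :
  p0 * a * w * p1 - p0 * (w * (a * p1)) = p0 * (a * w - w * a) * p1.
Proof. by rewrite mulrBr mulrBl !mulrA. Qed.

Section CharTwo.
Variables (k : fieldType) (X : choiceType) (L : lieAlgType k) (i : X -> L).
Hypothesis Lfree : free_lie_on i.
Variables (I : lieIdeal L) (x0 : X).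
Local Notation Q := (quotl I).
Variable D : L -> U Q.
Hypothesis D_lin : linear D.
Hypothesis D_lie :
  forall a b, D (lie a b) = ug (qmod I a : Q) * D b - ug (qmod I b : Q) * D a.
Hypothesis D_gen : forall x, D (i x) = (x == x0)%:R.
Hypothesis k2 : 2%:R = 0 :> k.
Variables (m : L).
Hypotheses (Im : m \in I) (Dm : D m != 0).

Section NonAbelian.
Variables (a q : L).
Hypothesis aq : lie (qmod I a : Q) (qmod I q) != 0.

(** With diagonal [0, Q, 0], [om0] reverses words up to sign while [om1] keeps their order. The
    corner compares the two orders and so produces a commutator. *)
Definition mid_map (l : nat) : Q -> Q := if l == 1%N then id else fun=> 0.

Lemma mid_map_hom l : lie_hom (mid_map l).
Proof. by rewrite /mid_map; case: ifP => _; [split | apply: zero_lie_hom]. Qed.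

Local Notation om0 := (omega (mid_map_hom 0) (mid_map_hom 1)).
Local Notation om1 := (omega (mid_map_hom 1) (mid_map_hom 2)).

Lemma omega_left x u : om0 (ug x * u) = om0 u * - ug x.
Proof. by rewrite omega_ug ug0 mul0r sub0r mulrN. Qed.

Lemma omega_right x u : om1 (ug x * u) = ug x * om1 u.
Proof. by rewrite omega_ug ug0 mulr0 subr0. Qed.

Theorem nonabelian_infinite : exists r : corner_rep (ideal_pow I 2) (kmx (U Q) 2),
  ~ finite_image (ideal_pow I 2) (corner_map r).
Proof.
have [rho tri] := walk_exists Lfree x0 2 mid_map_hom.
have d1 := walk_depth1 mid_map_hom tri.
apply: (infinite_corner _ tri _ _ d1) => //; try by move=> b; rewrite /diag_map ug0.
have [B] := basis_exists Q.
have ys0 : all (fun y => y != 0) [:: lie (qmod I a : Q) (qmod I q); qmod I q : Q].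
  rewrite /= aq andbT /=; apply: contraNneq aq => ->; by rewrite linear0.
have [C [iota [lam [lam_semi [d [c [c0 Dc]]]]]]] := nonzero_symbol B Dm ys0.
rewrite /= andbT => /andP[lam_aq lam_q].
pose e j := iter j (lie q) (lie a m).
have Ie j : e j \in I by elim: j => [|j IH] /=; apply: mem_lier.
have De j : D (e j) = ug (qmod I q : Q) ^+ j * (ug (qmod I a : Q) * D m).
  elim: j => [|j IH]; first by rewrite mul1r; apply: (D_ideal D_lie).
  apply: etrans (D_ideal D_lie q (Ie j)) _; rewrite IH exprS.
  exact: mulrA.
have C2 : 2%:R = 0 :> C by rewrite -(rmorph_nat iota) k2 rmorph0.
have Codd j : odd j -> j%:R = 1 :> C.
  by move=> jo; rewrite -[j]odd_double_half jo -mul2n natrD natrM C2 mul0r addr0.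
have super := walk_super Lfree D_lin D_lie D_gen mid_map_hom tri.
have corner j : odd j -> ent (rho (lie (e j) m)) 0 2
    = om0 (D m) * (ug (qmod I a : Q) * ug (qmod I q : Q) ^+ j
        - ug (qmod I q : Q) ^+ j * ug (qmod I a : Q)) * om1 (D m).
  move=> jo; have [rl rL _ _ _] := tri.
  have := ent_bracket rl rL d1 (d := 0) (l := 0) (Ie j) Im (leqnn 2).
  rewrite !super // De => ->.
  have -> : om0 (ug (qmod I q : Q) ^+ j * (ug (qmod I a : Q) * D m))
      = om0 (D m) * ug (qmod I a : Q) * ug (qmod I q : Q) ^+ j.
    apply: etrans (mulr_exp (omega_left (qmod I q : Q)) j _) _.
    by rewrite omega_left; apply: mulrN_odd.
  have -> : om1 (ug (qmod I q : Q) ^+ j * (ug (qmod I a : Q) * D m))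
      = ug (qmod I q : Q) ^+ j * (ug (qmod I a : Q) * om1 (D m)).
    apply: etrans (mull_exp (omega_right (qmod I q : Q)) j _) _.
    by rewrite omega_right.
  exact: corner_identity.
apply: (unbounded_infinite lam_semi (a := 0%N) (b := 2)) => dd.
(* An odd [j] is 1 in characteristic two, so the factor [j] of the commutator's symbol survives. *)
have [jo jd] : odd (dd.*2.+1) /\ (dd <= dd.*2.+1)%N by rewrite /= odd_double -addnn; split; lia.
move: (dd.*2.+1) jo jd => j jo jd.
exists (d + j + d)%N, (lie (e j) m),
   ((- 1) ^+ d * c * (j%:R * lam (qmod I q : Q) ^+ j.-1 * lam (lie (qmod I a : Q) (qmod I q : Q))) * c).
split; last first.
- rewrite corner //; apply: symbolM; first (apply: symbolM; last exact: symbol_comm_exp).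
    apply: symbol_omega; have -> : (fun x : Q => lam (mid_map 0 x) - lam (mid_map 1 x)) = (fun x => - 1 * lam x).
      by apply/funext => x; rewrite /= (semi0 lam_semi) sub0r mulN1r.
    exact: symbol_scale.
  apply: symbol_omega; have -> : (fun x : Q => lam (mid_map 1 x) - lam (mid_map 2 x)) = lam.
    by apply/funext => x; rewrite /= (semi0 lam_semi) subr0.
  exact: Dc.
- by rewrite Codd // mul1r !mulf_neq0 // expf_neq0 // oppr_eq0 oner_eq0.
- exact: (mem_ideal_powS (n := 0)).
- lia.
Qed.

End NonAbelian.
End CharTwo.

(** * Abelian quotient in characteristic two *)

Section FourByFour.
Variables (k : comNzRingType) (H : algType k).
Hypothesis HC : forall u v : H, u * v = v * u.
Implicit Types M N : kmx H 3.

Lemma ent4 M N s t : ent (M * N) s t = ent M s 0 * ent N 0 t + ent M s 1 * ent N 1 t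
  + ent M s 2 * ent N 2 t + ent M s 3 * ent N 3 t.
Proof. by rewrite entM unlock /= addr0 !addrA. Qed.

(** The shape of the image of [I], which the linear form kills. Since the last two superdiagonal
    entries agree, the bracket of two such matrices cancels at [(1, 3)] and only its corner
    remains. *)
Definition balanced M := [/\ depth 1 M, ent M 0 1 = 0 & ent M 1 2 = ent M 2 3].

Lemma balanced_corner M N : balanced M -> balanced N ->
  ent (M * N - N * M) 0 3 = ent M 0 2 * ent N 2 3 - ent N 0 2 * ent M 2 3.
Proof.
move=> [dM M01 _] [dN N01 _]; rewrite entB !ent4 M01 N01.
by rewrite !(dM 0%N 0%N, dN 0%N 0%N, dM 3%N 3%N, dN 3%N 3%N) // !(mul0r, mulr0, add0r, addr0).
Qed.

Lemma balanced_bracket M N a b : balanced M -> balanced N -> (a <= 3)%N -> (b <= 3)%N ->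
  ~~ ((a == 0%N) && (b == 3)) -> ent (M * N - N * M) a b = 0.
Proof.
move=> [dM M01 M12] [dN N01 N12] a3 b3 ab; have [ba|ba] := ltnP b (a + 2).
  by apply: (depthB (d := 2)) => //; rewrite -[2%N]/(1 + 1)%N; apply: depthM.
have : (a == 0%N) && (b == 2) || (a == 1%N) && (b == 3) by move: ab ba a3 b3; lia.
case/orP => /andP[/eqP -> /eqP ->]; rewrite entB.
  rewrite !(ent_mul (i := 0) dM dN, ent_mul (i := 0) dN dM) //= M01 N01.
  by rewrite !mul0r subrr.
rewrite (ent_mul (i := 1) dM dN) // (ent_mul (i := 1) dN dM) //= M12 N12 HC.
by rewrite subrr.
Qed.

(** Meant for [M = rho q]: the entry 1, the value of the linear form at [q], feeds the superdiagonal
    entry of [N] into place [(0, 2)]. *)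
Lemma ent02_bracket M N : depth 0 M -> ent M 0 0 = 0 -> ent M 0 1 = 1 -> balanced N ->
  ent (M * N - N * M) 0 2 = ent N 1 2 - ent N 0 2 * ent M 2 2.
Proof.
move=> dM M00 M01 [dN N01 _]; rewrite entB !ent4 M00 M01 N01.
rewrite !(dN 0%N 0%N, dN 2%N 2%N, dN 3%N 2%N, dM 3%N 2%N) //.
by rewrite !(mul0r, mulr0, add0r, addr0, mul1r).
Qed.

End FourByFour.

Lemma comm_ug_envelope (k : fieldType) (Q : lieAlgType k) :
  (forall x y : Q, lie x y = 0) -> forall u v : U Q, u * v = v * u.
Proof.
move=> Qab; have ugC (x y : Q) : ug x * ug y = ug y * ug x.
  by apply/eqP; rewrite -subr_eq0 -ug_lie Qab ug0.
have ugw (x : Q) w : ug x * uword w = uword w * ug x.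
  elim: w => [|y w IH]; first by rewrite uword_nil mulr1 mul1r.
  by rewrite uword_cons; apply: commrM; [exact: ugC | exact: IH].
have ugu (x : Q) u : ug x * u = u * ug x.
  elim/uword_ind: u => [|c u v IHu IHv|w]; last exact: ugw.
    by rewrite mulr0 mul0r.
  by rewrite mulrDr mulrDl -scalerAr -scalerAl IHu IHv.
move=> u v; elim/uword_ind: u => [|c u u' IHu IHv|w].
- by rewrite mulr0 mul0r.
- by rewrite mulrDr mulrDl -scalerAr -scalerAl IHu IHv.
elim: w => [|y w IH]; first by rewrite uword_nil mulr1 mul1r.
by rewrite uword_cons; apply/commr_sym/commrM; apply: commr_sym; [apply: ugu | apply: IH].
Qed.

Lemma linear_form_exists (k : fieldType) (V : lmodType k) (v : V) : v != 0 ->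
  exists f : V -> k, (forall c x y, f (c *: x + y) = c * f x + f y) /\ f v = 1.
Proof.
move=> v0; have [B] := basis_exists V.
have [b vb] : exists b, (bas_coord B v)@_b != 0.
  apply: contrapT => nb; move/eqP: v0; apply; rewrite -(bas_coordK B v).
  suff -> : bas_coord B v = 0 by rewrite linear0.
  apply/malgP => b; rewrite mcoeff0; apply: contrapT => /eqP vb.
  by apply: nb; exists b.
exists (fun x => ((bas_coord B v)@_b)^-1 * (bas_coord B x)@_b); split; last exact: mulVf.
by move=> c x y; rewrite linearP mcoeffD mcoeffZ mulrDr mulrCA.
Qed.

Section CommutativeCharTwo.
Variables (R : nzRingType).
Hypothesis RC : forall x y : R, x * y = y * x.
Hypothesis R2 : forall x : R, x + x = 0.

Lemma oppr_char2 (x : R) : - x = x.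
Proof. by apply/eqP; rewrite eq_sym -subr_eq0 opprK R2. Qed.

Lemma bracket_char2 (s t y z a b : R) :
  (0 * s - y * a) - (0 * t - z * b) = a * y - b * z.
Proof. by rewrite !mul0r !sub0r opprK !oppr_char2 (RC a) (RC b). Qed.

Lemma bracket_right (y z a b : R) : (a * y - y * 0) - (b * z - z * 0) = a * y - b * z.
Proof. by rewrite !mulr0 !subr0. Qed.

Lemma corner_rec (q p : R) (beta : nat -> R) :
  (forall j, beta j.+1 = q ^+ j * p - beta j * q) ->
  forall j, beta j = j%:R * (q ^+ j.-1 * p) + beta 0 * q ^+ j.
Proof.
move=> rec; elim=> [|j IH]; first by rewrite mul0r add0r expr0 mulr1.
rewrite rec IH oppr_char2 mulrDl addrA -[X in _ + X]mulrA -exprSr; congr (_ + _).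
rewrite -natr1 mulrDl mul1r addrC; congr (_ + _).
case: j {IH} => [|j]; first by rewrite !mul0r.
by rewrite /= [q ^+ _.+1]exprSr -!mulrA; congr (_ * (_ * _)); apply: RC.
Qed.

Lemma corner_value (q p : R) (beta : nat -> R) j :
  (forall j, beta j.+1 = q ^+ j * p - beta j * q) ->
  beta j * p - beta 0 * (q ^+ j * p) = j%:R * (q ^+ j.-1 * p) * p.
Proof. by move=> /corner_rec ->; rewrite mulrDl !mulrA addrK. Qed.

End CommutativeCharTwo.

Section Abelian.
Variables (k : fieldType) (X : choiceType) (L : lieAlgType k) (i : X -> L).
Hypothesis Lfree : free_lie_on i.
Variables (I : lieIdeal L) (x0 : X).
Local Notation Q := (quotl I).
Variable D : L -> U Q.
Hypothesis D_lin : linear D.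
Hypothesis D_lie :
  forall a b, D (lie a b) = ug (qmod I a : Q) * D b - ug (qmod I b : Q) * D a.
Hypothesis D_gen : forall x, D (i x) = (x == x0)%:R.
Hypothesis k2 : 2%:R = 0 :> k.
Variables (m q : L).
Hypotheses (Im : m \in I) (Dm : D m != 0) (q_notin : q \notin I).
Hypothesis Qab : forall x y : Q, lie x y = 0.

Lemma envelope_comm (u v : U Q) : u * v = v * u.
Proof. exact: comm_ug_envelope. Qed.

Lemma envelope_char2 (u : U Q) : u + u = 0.
Proof. by rewrite -mulr2n -scaler_nat k2 scale0r. Qed.

Section AbelianWalk.
Variable f : Q -> k.
Hypothesis f_lin : forall c x y, f (c *: x + y) = c * f x + f y.
Hypothesis fq : f (qmod I q) = 1.

Lemma form0 : f 0 = 0.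
Proof. by have := f_lin (-1) 0 0; rewrite scaler0 addr0 mulN1r addNr. Qed.

Definition ab_diag (l : nat) (a : L) : U Q := if l == 2 then ug (qmod I a : Q) else 0.

Lemma ab_diag_linear l : linear (ab_diag l).
Proof.
move=> c a b; rewrite /ab_diag; case: ifP => _; first by rewrite linearP ugP.
by rewrite scaler0 addr0.
Qed.

Lemma ab_diag_lie l a b :
  ab_diag l (lie a b) = ab_diag l a * ab_diag l b - ab_diag l b * ab_diag l a.
Proof.
rewrite /ab_diag; case: ifP => _; first by rewrite -qmod_lie ug_lie.
by rewrite mul0r subrr.
Qed.

Definition ab_super (l : nat) (x : X) : U Q :=
  if l is 0%N then f (qmod I (i x)) *: 1 else (x == x0)%:R.

Variable rho : L -> kmx (U Q) 3.
Hypothesis rho_tri : tri_spec i ab_diag ab_super rho.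

(** Both sides vanish on brackets: the entry because the first two diagonal entries are 0, the form
    because [L/I] is abelian. *)
Lemma ab_super0 a : ent (rho a) 0 1 = f (qmod I a) *: 1.
Proof.
have [rl _ _ _ rg] := rho_tri; have f0 := form0.
have WP : submod_closed (fun a => `[< ent (rho a) 0 1 = f (qmod I a) *: 1 >]).
  split=> [|c u v /asboolP ue /asboolP ve]; apply/asboolP.
    have -> : rho 0 = 0 := linear0 (to_linear rl).
    by rewrite ent0 linear0 f0 scale0r.
  by rewrite rl entP ue ve linearP f_lin scalerDl scalerA.
apply/asboolP; apply: (free_lie_generated (W := SubModule WP) Lfree).
  move=> u v _ _; apply/asboolP.
  apply: etrans (tri_super rho_tri u v (isT : 0 < 3)%N) _.
  by rewrite -qmod_lie [qlie _ _]Qab f0 scale0r /ab_diag /= !mul0r !mulr0 !subr0.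
by move=> x; apply/asboolP; apply: (rg x 0%N).
Qed.

(** The non-zero diagonal entry acts from the right at place 1 and from the left at place 2.
    Commutativity and characteristic two remove the difference, so both entries obey the rule of
    [D]. *)
Lemma ab_superS l a : (0 < l < 3)%N -> ent (rho a) l l.+1 = D a.
Proof.
case/andP => l0 l3; have [rl _ _ _ rg] := rho_tri.
have WP : submod_closed (fun a => `[< ent (rho a) l l.+1 = D a >]).
  split=> [|c u v /asboolP ue /asboolP ve]; apply/asboolP.
    have -> : rho 0 = 0 := linear0 (to_linear rl).
    have -> : D 0 = 0 := linear0 (to_linear D_lin).
    exact: ent0.
  by rewrite rl entP ue ve D_lin.
apply/asboolP; apply: (free_lie_generated (W := SubModule WP) Lfree).
  move=> u v /asboolP ue /asboolP ve; apply/asboolP.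
  apply: etrans (tri_super rho_tri u v l3) _; rewrite ue ve D_lie /ab_diag.
  case: l l0 l3 {ue ve WP} => [|[|[|l]]] // _ _ /=.
    exact: (bracket_char2 envelope_comm envelope_char2).
  exact: bracket_right.
by move=> x; apply/asboolP; rewrite rg // /ab_super D_gen; case: l l0 {l3 WP}.
Qed.

Lemma ab_balanced e : e \in I -> balanced (rho e).
Proof.
move=> Ie; have [_ _ d0 dg _] := rho_tri; have qe := qmod_ideal Ie.
split; last by rewrite !ab_superS.
  move=> s t sn tn; rewrite addn1 ltnS leq_eqVlt => /predU1P[->|ts].
    by rewrite dg // /ab_diag qe ug0 if_same.
  by apply: d0; rewrite ?addn0.
by rewrite ab_super0 qe form0 scale0r.
Qed.

Lemma ab_corner_rec e : e \in I ->
  ent (rho (lie q e)) 0 2 = D e - ent (rho e) 0 2 * ug (qmod I q : Q).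
Proof.
move=> Ie; have [_ rL d0 dg _] := rho_tri.
have M01 : ent (rho q) 0 1 = 1 by rewrite ab_super0 fq scale1r.
have M00 : ent (rho q) 0 0 = 0 by rewrite dg.
have eD : ent (rho e) 1 2 = D e by apply: ab_superS.
have eq : ent (rho q) 2 2 = ug (qmod I q : Q) by rewrite dg.
rewrite rL; apply: etrans (ent02_bracket (d0 q) M00 M01 (ab_balanced Ie)) _.
by rewrite eD eq.
Qed.

End AbelianWalk.

Theorem abelian_infinite : exists r : corner_rep (ideal_pow I 2) (kmx (U Q) 3),
  ~ finite_image (ideal_pow I 2) (corner_map r).
Proof.
have q0 : qmod I q != 0 :> Q by apply: qmod_neq0.
have [f [f_lin fq]] := linear_form_exists q0.
have [rho tri] := tri_exists 3 Lfree (ab_super f) ab_diag_linear ab_diag_lie.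
have bal e (Ie : e \in I) := ab_balanced f_lin tri Ie.
have [rl rL d0 dg _] := tri.
have corner0 s : s \in ideal_pow I 2 -> forall a b, (a <= 3)%N -> (b <= 3)%N ->
    ~~ ((a == 0%N) && (b == 3)) -> ent (rho s) a b = 0.
  move=> sS a b a3 b3 ab; apply/eqP.
  have WP : submod_closed (fun s => ent (rho s) a b == 0).
    split=> [|c u v /eqP ue /eqP ve]; apply/eqP.
      have -> : rho 0 = 0 := linear0 (to_linear rl).
      exact: ent0.
    by rewrite rl entP ue ve scaler0 addr0.
  apply: (span_min (W := SubModule WP) _ sS) => _ [u [v [Iu Iv ->]]].
  apply/eqP; rewrite rL.
  exact: (balanced_bracket envelope_comm (bal _ Iu) (bal _ Iv) a3 b3 ab).
have [r rE] : exists r : corner_rep (ideal_pow I 2) (kmx (U Q) 3), corner_map r = rho.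
  exact: (tri_corner_rep tri).
exists r; rewrite rE => {r rE}.
have [B] := basis_exists Q.
have ys0 : all (fun y => y != 0) [:: qmod I q : Q] by rewrite /= q0.
have [C [iota [lam [lam_semi [d [c [c0 Dc]]]]]]] := nonzero_symbol B Dm ys0.
rewrite /= andbT => lam_q.
pose e j := iter j (lie q) m.
have Ie j : e j \in I by apply: iter_lie_ideal.
have De j : D (e j) = ug (qmod I q : Q) ^+ j * D m by apply: D_iter_lie.
have rec j : ent (rho (e j.+1)) 0 2
    = ug (qmod I q : Q) ^+ j * D m - ent (rho (e j)) 0 2 * ug (qmod I q : Q).
  by rewrite -De; apply: (ab_corner_rec f_lin fq tri (Ie j)).
have corner j : ent (rho (lie (e j) m)) 0 3
    = j%:R * (ug (qmod I q : Q) ^+ j.-1 * D m) * D m.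
  rewrite rL; apply: etrans (balanced_corner (bal _ (Ie j)) (bal _ Im)) _.
  rewrite !(ab_superS tri) // De.
  exact: (corner_value (beta := fun j => ent (rho (e j)) 0 2) envelope_comm envelope_char2 _ rec).
have Codd j : odd j -> j%:R = 1 :> U Q.
  by move=> jo; rewrite -[j]odd_double_half jo -addnn !natrD envelope_char2 addr0.
apply: (unbounded_infinite lam_semi (a := 0%N) (b := 3)) => dd.
(* For the odd [j = dd.*2.+1] the factor [j] is 1, and [q^(j-1)] has degree [dd.*2]. *)
exists (dd.*2 + d + d)%N, (lie (e dd.*2.+1) m), (lam (qmod I q : Q) ^+ dd.*2 * c * c).
split; last first.
- rewrite corner Codd ?oddS ?odd_double //= mul1r.
  apply: symbolM => //; apply: symbolM => //.
  by rewrite -[X in symbol _ _ X]muln1; apply/symbolX/symbol_ug.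
- by rewrite !mulf_neq0 // expf_neq0.
- exact: (mem_ideal_powS (n := 0)).
- by rewrite -addnn; lia.
Qed.

End Abelian.

(** * Choice of the representation and conclusion *)

Theorem infinite_corner_exists (k : fieldType) (X : choiceType) (L : lieAlgType k) (i : X -> L)
    (Lfree : free_lie_on i) (I : lieIdeal L) (n : nat) :
  (exists2 x : L, x \in I & x != 0) -> (exists x : L, x \notin I) -> (1 < n)%N ->
  exists (A : algType k) (r : corner_rep (ideal_pow I n) A),
    ~ finite_image (ideal_pow I n) (corner_map r).
Proof.
move=> Inz [q qI] n1; have [x0 [D [D_lin D_lie D_gen [m Im Dm]]]] := fox_derivative Lfree Inz.
have [n2|n2] := ltnP 2 n.
  have [r rP] := power_walk_infinite Lfree D_lin D_lie D_gen Im Dm qI n1 (or_introl n2).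
  by exists (kmx (U (lie_power (quotl I) n.-1)) n), r.
have {n1 n2}-> : n = 2 by apply/eqP; rewrite eqn_leq n2.
have [k2|k2] := eqVneq (2%:R : k) 0; last first.
  have [r rP] := power_walk_infinite Lfree D_lin D_lie D_gen Im Dm qI (ltnSn 1) (or_intror k2).
  by exists (kmx (U (lie_power (quotl I) 1)) 2), r.
have [Qab|nab] := pselect (forall x y : quotl I, lie x y = 0).
  have [r rP] := abelian_infinite Lfree D_lin D_lie D_gen k2 Im Dm qI Qab.
  by exists (kmx (U (quotl I)) 3), r.
have [x [y xy]] : exists x y : quotl I, lie x y != 0.
  apply: contrapT => nxy; apply: nab => x y; apply: contrapT => /eqP xy.
  by apply: nxy; exists x, y.
rewrite -[x]qmod_repr -[y]qmod_repr in xy.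
have [r rP] := nonabelian_infinite Lfree D_lin D_lie D_gen k2 Im Dm xy.
by exists (kmx (U (quotl I)) 2), r.
Qed.

Theorem theorem1p1 (k : fieldType) (X : Type) (L : lieAlgType k) (i : X -> L)
    (Lfree : free_lie_on i) (I : lieIdeal L)
    (Inz : exists2 x : L, x \in I & x != 0) (Iproper : exists x : L, x \notin I) :
  ~ fg_ideal (lie_prod I I) /\
  (forall n : nat, (1 < n)%N ->
     ~ fg_module (lie_homology 2 (quotl (ideal_pow I n))) /\
     ~ finitely_presented (quotl (ideal_pow I n))).
Proof.
(* [{classic X}] equips the set of generators with the choice structure needed to form words in
   it. *)
have corner n := @infinite_corner_exists k {classic X} L i Lfree I n Inz Iproper.
split=> [fg|n n1].
  (* [ideal_pow I 2] is [lie_prod I I] by computation. *)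
  have [A [r []]] := corner 2 isT.
  exact: (fg_ideal_finite_image r fg).
have [A [r r_inf]] := corner n n1.
have der s : s \in ideal_pow I n -> s \in lie_span (L := L) predT predT by apply: ideal_pow_derived.
split=> [fg|fp]; apply: r_inf.
  exact: (tor_finite_image r der fg).
exact: (finitely_presented_finite_image r Lfree der fp).
Qed.
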